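(* Assume the setting below (in particular (C1), (C2) and $\mu^*=0$). Let $\delta\in(0,1)$ be such that $n\ge |O|+8p+16\log(4/\delta)$, and let $$\lambda = 6\Big(\frac{p\log(2np/\delta)}{n}\Big)^{1/2}.$$ If $40|O|p\big(13\log(2np/\delta)+2(1+M_E)^2\big)\le n-|O|$, then with probability at least $1-3\delta$, $$\|\widehat\Theta-\Theta^*\|_{1,1}\le 3C_0\max_j(\omega^*_{jj})^{-1/2}\,|O|\,p\Big(\frac{\log(2np/\delta)}{n}\Big)^{1/2},$$ $$\|\widehat\Theta-\Theta^*\|_{2,1}\le 3C_0\max_j(\omega^*_{jj})^{-1/2}\,|O|\Big(\frac{p\log(2np/\delta)}{n}\Big)^{1/2},$$ $$\|\widehat\Theta-\Theta^*\|_{2,2}\le C_0\max_j(\omega^*_{jj})^{-1/2}\Big(\frac{|O|p\log(2np/\delta)}{n}\Big)^{1/2},$$ where $C_0$ is a universal constant with $C_0<4224$.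
   Context: Setting. Let $n,p\ge 1$ be integers and $[n]=\{1,\dots,n\}$. The observed matrix is $X=Y+E^*\in\mathbb R^{n\times p}$ where (C1) the $n$ rows of $Y$ are independent $\mathcal N_p(\mu^*,\Sigma^* )$ vectors, $\Sigma^*$ positive definite; (C2) $E^*$ is deterministic, $[n]=I\cup O$ is a partition (inliers $I$, outliers $O$) such that the $i$-th row of $E^*$ is zero for every $i\in I$, and every row of $E^*(\Sigma^* )^{-1/2}$ has Euclidean norm at most $M_E\sqrt p$. It is assumed that $\mu^*=0$. Let $\Omega^*=(\Sigma^* )^{-1}$ with diagonal entries $\omega^*_{jj}$, $B^*=\Omega^*\,\mathrm{diag}(\Omega^* )^{-1}$ (so $B^*_{jj}=1$), $X^{(n)}=X/\sqrt n$, $\Theta^*=E^*B^*/\sqrt n$, $\xi=X^{(n)}B^*-\Theta^*$. Notation: $A_{i,\bullet}$, $A_{\bullet,j}$ are the $i$-th row and $j$-th column of a matrix $A$, $A_{K,J}$ the submatrix with row indices in $K$ and column indices in $J$, $j^c=[p]\setminus\{j\}$; $\|A\|_{q_1,q_2}=(\sum_i\|A_{i,\bullet}\|_{q_1}^{q_2})^{1/q_2}$ (usual modification when a parameter is $\infty$), so $\|A\|_{2,2}$ is the Frobenius norm and $\|A\|_{1,1}$ the entrywise $\ell_1$ norm. $Z^j$ denotes the orthogonal projector in $\mathbb R^n$ onto the orthogonal complement of the span of the columns of $X_{\bullet,j^c}$. Estimator: for $\lambda\ge0$, $\widehat\Theta$ is a minimizer over $\Theta\in\mathbb R^{n\times p}$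 of $\sum_{j=1}^p\|Z^j(X^{(n)}_{\bullet,j}-\Theta_{\bullet,j})\|_2+\lambda\|\Theta\|_{2,1}$; equivalently $(\widehat B,\widehat\Theta)$ minimizes $\|(X^{(n)}B-\Theta)^\top\|_{2,1}+\lambda\|\Theta\|_{2,1}$ over $\Theta\in\mathbb R^{n\times p}$ and $B\in\mathbb R^{p\times p}$ with all $B_{jj}=1$. *)

(* Defs.v *)
From HB Require Import structures.
From mathcomp Require Import all_boot all_order all_algebra.
From mathcomp Require Import all_classical all_reals all_analysis.
Set Implicit Arguments. Unset Strict Implicit. Unset Printing Implicit Defensive.
Import Order.TTheory GRing.Theory Num.Theory.
Local Open Scope classical_set_scope.
Local Open Scope ring_scope.

Section Defs.
Context {R : realType}.

Definition vnorm2 {n : nat} (v : 'cV[R]_n) : R :=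
  Num.sqrt (\sum_(i < n) v i 0 ^+ 2).

Definition norm11 {n p : nat} (A : 'M[R]_(n, p)) : R :=
  \sum_(i < n) \sum_(j < p) `|A i j|.

Definition norm21 {n p : nat} (A : 'M[R]_(n, p)) : R :=
  \sum_(i < n) Num.sqrt (\sum_(j < p) A i j ^+ 2).

Definition norm22 {n p : nat} (A : 'M[R]_(n, p)) : R :=
  Num.sqrt (\sum_(i < n) \sum_(j < p) A i j ^+ 2).

(* Zm is the orthogonal projector of R^n onto the orthogonal complement of the
   span of the columns of A: Zm symmetric idempotent, and the range of the
   complementary projector 1 - Zm is the column span of A. *)
Definition orth_proj_compl {n k : nat} (Zm : 'M[R]_n) (A : 'M[R]_(n, k)) : Prop :=
  Zm^T = Zm /\ Zm *m Zm = Zm /\ ((1%:M - Zm) == A^T)%MS.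

Definition robust_obj {n p : nat} (Zs : 'I_p -> 'M[R]_n) (Xn : 'M[R]_(n, p))
    (lambda : R) (Th : 'M[R]_(n, p)) : R :=
  \sum_(j < p) vnorm2 (Zs j *m (col j Xn - col j Th)) + lambda * norm21 Th.

Definition symmetric_pd {p : nat} (S : 'M[R]_p) : Prop :=
  S^T = S /\ forall x : 'rV[R]_p, x != 0 -> 0 < (x *m S *m x^T) 0 0.

Definition max_inv_sqrt_diag {p : nat} (Om : 'M[R]_p) : R :=
  \big[Num.max/0]_(j < p) (Num.sqrt (Om j j))^-1.

Definition Bstar {p : nat} (Om : 'M[R]_p) : 'M[R]_p :=
  Om *m invmx (diag_mx (\row_j Om j j)).

End Defs.

Section Prob.
Context {d : measure_display} {T : measurableType d} {R : realType}.

Definition row_sigma {n p : nat} (Y : T -> 'M[R]_(n, p)) (i : 'I_n) : set (set T) :=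
  <<s [set A | exists (j : 'I_p) (B : set R),
                 measurable B /\ A = (fun w => Y w i j) @^-1` B] >>.

Definition rows_independent {n p : nat} (P : probability T R)
    (Y : T -> 'M[R]_(n, p)) : Prop :=
  forall A : 'I_n -> set T, (forall i, row_sigma Y i (A i)) ->
    P (\bigcap_(i in [set: 'I_n]) A i) = (\prod_(i < n) P (A i))%E.

(* the i-th row of Y is N_p(0, S): every non-trivial linear combination
   a . Y_i is N(0, a S a^T) (Cramer-Wold definition of the Gaussian vector) *)
Definition row_gaussian {n p : nat} (P : probability T R)
    (Y : T -> 'M[R]_(n, p)) (i : 'I_n) (S : 'M[R]_p) : Prop :=
  forall a : 'rV[R]_p, a != 0 -> forall B : set R, measurable B ->
    P ((fun w => (a *m (row i (Y w))^T) 0 0) @^-1` B)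
    = normal_prob 0 (Num.sqrt ((a *m S *m a^T) 0 0)) B.

End Prob.

(* Main.v *)
Require Import Defs.
From HB Require Import structures.
From mathcomp Require Import all_boot all_order all_algebra.
From mathcomp Require Import all_classical all_reals all_analysis.
From mathcomp Require Import measurable_realfun.
From mathcomp Require Import ring lra.
Set Implicit Arguments. Unset Strict Implicit. Unset Printing Implicit Defensive.
Import Order.TTheory GRing.Theory Num.Theory.
Import numFieldNormedType.Exports.
Local Open Scope classical_set_scope.
Local Open Scope ring_scope.

(* Write D for the estimation error, x_j for column j of Y B^* normalised to
   variance one, and P_j = 1 - Z^j.

   Comparing the objective at the estimator and at Theta^* puts D in the cone
   (1 - c) S_Oc <= (1 + c) S_O (S_O and S_Oc are the sums of the row norms of D over
   the outliers and the inliers) as soon as each row of (Z^j xi_j / |Z^j xi_j|)_j has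
   norm at most c lambda, and bounds the curvature sum
   sum_j z_j^2 / (2 |Z^j xi_j| + z_j), where z_j = |Z^j D_j|, by
   lambda ((1 + 2c) S_O - (1 - 2c) S_Oc). On the cone, the part of D removed by
   the projectors is small: P_j D_j lies in the span of the whitened design
   W = X M^T, with M Sigma M^T = 1, whose inlier rows have least singular value of
   order sqrt n while every row of W is short. Hence |D|^2 <= 2 sum_j z_j^2 and the
   curvature bound gives the rates. Without outliers the cone forces D = 0.

   The x_j are independent of the other columns of Y, hence of P_j: row by row this
   is an identity between the laws of linear combinations, turned into
   independence by a Cramer-Wold argument (finite measures on R that integrate all
   the functions cos(s x + t) equally are equal, since cos(x / sqrt N)^N tends to a
   Gaussian bump). Conditioning on the design then gives the Gaussian tails of the
   entries of Z^j x_j and the chi-square tail of |P_j x_j|^2, the latter by peeling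
   off the directions of a Gram-Schmidt basis. The singular value bound is a union
   bound over an integer grid. *)

(** * Optimality conditions and the cone *)

Section l2_norm.
Context {R : realType}.

Definition l2 {I : finType} (f : I -> R) : R := Num.sqrt (\sum_i f i ^+ 2).

Lemma l2_ge0 (I : finType) (f : I -> R) : 0 <= l2 f.
Proof. exact: sqrtr_ge0. Qed.

Lemma sumsq_ge0 (I : finType) (f : I -> R) : 0 <= \sum_i f i ^+ 2.
Proof. by apply: sumr_ge0 => i _; exact: sqr_ge0. Qed.

Lemma l2_sqr (I : finType) (f : I -> R) : l2 f ^+ 2 = \sum_i f i ^+ 2.
Proof. by rewrite sqr_sqrtr// sumsq_ge0. Qed.

Lemma eq_l2 (I : finType) (f g : I -> R) : f =1 g -> l2 f = l2 g.
Proof. by move=> fg; congr Num.sqrt; apply: eq_bigr => i _; rewrite fg. Qed.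

Lemma ler_sqr2 (x y : R) : 0 <= y -> x ^+ 2 <= y ^+ 2 -> x <= y.
Proof.
move=> y0 xy; rewrite leNgt; apply/negP => yx.
have x0 : 0 < x by exact: le_lt_trans yx.
by move: xy; rewrite leNgt ltr_pXn2r ?yx// nnegrE ltW.
Qed.

Lemma CS_sqr (I : finType) (f g : I -> R) :
  (\sum_i f i * g i) ^+ 2 <= (\sum_i f i ^+ 2) * (\sum_i g i ^+ 2).
Proof.
set a := \sum_i f i ^+ 2; set b := \sum_i g i ^+ 2; set c := \sum_i f i * g i.
have a0 : 0 <= a := sumsq_ge0 f.
have key : 0 <= a * (a * b - c ^+ 2).
  rewrite (_ : _ * _ = \sum_i (a * g i - c * f i) ^+ 2) ?sumsq_ge0//.
  under eq_bigr do rewrite sqrrB !exprMn.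
  rewrite big_split/= big_split/= sumrN -!mulr_sumr -/a -/b.
  rewrite (_ : \sum_i _ *+ 2 = 2 * (a * c * c)); first by ring.
  rewrite /c [in RHS]mulr_sumr mulr_sumr; apply: eq_bigr => i _.
  by rewrite -mulr_natl; ring.
have [a_gt0|a_le0] := ltP 0 a.
  by move: key; rewrite pmulr_rge0// subr_ge0.
have {a_le0}a_eq0 : a = 0 by apply/eqP; rewrite eq_le a0 a_le0.
have f0 i : f i = 0.
  move/eqP: a_eq0; rewrite psumr_eq0; last by move=> ? _; exact: sqr_ge0.
  by move/allP/(_ i (mem_index_enum i)); rewrite /= sqrf_eq0 => /eqP.
by rewrite /c big1 ?expr0n ?mulr_ge0 ?sumsq_ge0// => i _; rewrite f0 mul0r.
Qed.

Lemma CS (I : finType) (f g : I -> R) : \sum_i f i * g i <= l2 f * l2 g.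
Proof.
apply: ler_sqr2; first by rewrite mulr_ge0// l2_ge0.
by rewrite exprMn !l2_sqr CS_sqr.
Qed.

Lemma l2D (I : finType) (f g : I -> R) : l2 (fun i => f i + g i) <= l2 f + l2 g.
Proof.
apply: ler_sqr2; first by rewrite addr_ge0// l2_ge0.
rewrite l2_sqr; under eq_bigr do rewrite sqrrD.
rewrite big_split/= big_split/= sumrMnl -!l2_sqr sqrrD lerD2r lerD2l.
by rewrite lerMn2r CS orbT.
Qed.

Lemma l2N (I : finType) (f : I -> R) : l2 (fun i => - f i) = l2 f.
Proof. by congr Num.sqrt; apply: eq_bigr => i _; rewrite sqrrN. Qed.

Lemma l2Z (I : finType) (a : R) (f : I -> R) : l2 (fun i => a * f i) = `|a| * l2 f.
Proof.
rewrite /l2; under eq_bigr do rewrite exprMn.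
by rewrite -mulr_sumr sqrtrM ?sqr_ge0// sqrtr_sqr.
Qed.

Lemma l2_eq0 (I : finType) (f : I -> R) : l2 f = 0 -> forall i, f i = 0.
Proof.
move=> f0 i; have : \sum_i f i ^+ 2 = 0 by rewrite -l2_sqr f0 expr0n.
move/eqP; rewrite psumr_eq0; last by move=> ? _; exact: sqr_ge0.
by move/allP/(_ i (mem_index_enum i)); rewrite /= sqrf_eq0 => /eqP.
Qed.

Lemma sum_le_sqrt_card (I : finType) (A : {set I}) (f : I -> R) :
  \sum_(i in A) f i <= Num.sqrt #|A|%:R * l2 f.
Proof.
rewrite big_mkcond/= (_ : \sum_i _ = \sum_i (i \in A)%:R * f i); last first.
  by apply: eq_bigr => i _; case: (i \in A); rewrite ?mul1r ?mul0r.
apply: le_trans (CS _ _) _; rewrite ler_wpM2r ?l2_ge0// /l2.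
under eq_bigr do rewrite -natrX.
rewrite -natr_sum ler_wsqrtr// ler_nat -sum1_card [in leqRHS]big_mkcond/=.
by apply: leq_sum => i _; case: (i \in A).
Qed.

End l2_norm.

Section projectors.
Context {R : realType}.

Definition dotv {n : nat} (u v : 'cV[R]_n) : R := \sum_i u i 0 * v i 0.

Lemma vnorm2_l2 n (v : 'cV[R]_n) : vnorm2 v = l2 (fun i => v i 0).
Proof. by []. Qed.

Lemma dotvE n (u v : 'cV[R]_n) : dotv u v = (u^T *m v) 0 0.
Proof. by rewrite mxE; apply: eq_bigr => i _; rewrite mxE. Qed.

Lemma dotvC n (u v : 'cV[R]_n) : dotv u v = dotv v u.
Proof. by apply: eq_bigr => i _; rewrite mulrC. Qed.

Lemma dotvDl n (u v w : 'cV[R]_n) : dotv (u + v) w = dotv u w + dotv v w.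
Proof. by rewrite -big_split/=; apply: eq_bigr => i _; rewrite mxE mulrDl. Qed.

Lemma dotvNl n (u w : 'cV[R]_n) : dotv (- u) w = - dotv u w.
Proof. by rewrite -sumrN; apply: eq_bigr => i _; rewrite mxE mulNr. Qed.

Lemma dotvZl n a (u w : 'cV[R]_n) : dotv (a *: u) w = a * dotv u w.
Proof. by rewrite mulr_sumr; apply: eq_bigr => i _; rewrite mxE mulrA. Qed.

Lemma dotvDr n (u v w : 'cV[R]_n) : dotv w (u + v) = dotv w u + dotv w v.
Proof. by rewrite dotvC dotvDl !(dotvC w). Qed.

Lemma dotvNr n (u w : 'cV[R]_n) : dotv w (- u) = - dotv w u.
Proof. by rewrite dotvC dotvNl dotvC. Qed.

Lemma dotvZr n a (u w : 'cV[R]_n) : dotv w (a *: u) = a * dotv w u.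
Proof. by rewrite dotvC dotvZl dotvC. Qed.

Lemma dotvv n (u : 'cV[R]_n) : dotv u u = vnorm2 u ^+ 2.
Proof. by rewrite vnorm2_l2 l2_sqr; apply: eq_bigr => i _; rewrite expr2. Qed.

Lemma dotv_mulmx n m (A : 'M[R]_(n, m)) u v : dotv (A *m u) v = dotv u (A^T *m v).
Proof. by rewrite !dotvE trmx_mul mulmxA. Qed.

Lemma dotv_CS n (u v : 'cV[R]_n) : dotv u v <= vnorm2 u * vnorm2 v.
Proof. exact: CS. Qed.

Lemma vnorm2_ge0 n (u : 'cV[R]_n) : 0 <= vnorm2 u.
Proof. exact: l2_ge0. Qed.

Lemma vnorm2D n (u v : 'cV[R]_n) : vnorm2 (u + v) <= vnorm2 u + vnorm2 v.
Proof.
apply: le_trans (l2D _ _); rewrite le_eqVlt; apply/orP; left; apply/eqP.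
by apply: eq_l2 => i; rewrite mxE.
Qed.

Lemma vnorm2N n (u : 'cV[R]_n) : vnorm2 (- u) = vnorm2 u.
Proof. by rewrite -[RHS]l2N; apply: eq_l2 => i; rewrite mxE. Qed.

Lemma vnorm2Z n a (u : 'cV[R]_n) : vnorm2 (a *: u) = `|a| * vnorm2 u.
Proof. by rewrite -[RHS]l2Z; apply: eq_l2 => i; rewrite mxE. Qed.

Section one_projector.
Variables (n : nat) (Z : 'M[R]_n).
Hypotheses (Zsym : Z^T = Z) (Zid : Z *m Z = Z).

Lemma dot_proj u v : dotv (Z *m u) (Z *m v) = dotv (Z *m u) v.
Proof. by rewrite !dotvE !trmx_mul Zsym -mulmxA (mulmxA Z) Zid mulmxA. Qed.

Lemma proj_pythagoras u :
  vnorm2 u ^+ 2 = vnorm2 (Z *m u) ^+ 2 + vnorm2 ((1%:M - Z) *m u) ^+ 2.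
Proof.
rewrite -!dotvv dot_proj mulmxBl mul1mx !(dotvDl, dotvDr, dotvNl, dotvNr).
rewrite dot_proj (dotvC u (Z *m u)); ring.
Qed.

Lemma vnorm2_proj_le u : vnorm2 (Z *m u) <= vnorm2 u.
Proof.
apply: ler_sqr2; first exact: vnorm2_ge0.
by rewrite (proj_pythagoras u) lerDl sqr_ge0.
Qed.

End one_projector.

Lemma orth_proj_compl0 n k (Z : 'M[R]_n) (A : 'M[R]_(n, k)) :
  orth_proj_compl Z A -> Z *m A = 0.
Proof.
move=> [Zs [ZZ /andP[_ /submxP[C AE]]]].
have : A^T *m Z = 0 by rewrite AE -mulmxA mulmxBl ZZ mul1mx subrr mulmx0.
by move/(congr1 trmx); rewrite trmx_mul trmxK Zs trmx0.
Qed.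

Lemma orth_proj_compl_span n k (Z : 'M[R]_n) (A : 'M[R]_(n, k)) :
  orth_proj_compl Z A -> exists D, 1%:M - Z = A *m D.
Proof.
move=> [Zs [ZZ /andP[/submxP[C AE] _]]]; exists C^T.
by rewrite -[RHS]trmxK trmx_mul trmxK -AE linearB/= trmx1 Zs.
Qed.

Lemma col'_mul n p (X : 'M[R]_(n, p)) j : col' j X = X *m col' j 1%:M.
Proof. by rewrite -[in LHS](mulmx1 X); apply/matrixP=> a b; rewrite !mxE; apply: eq_bigr => c _; rewrite !mxE. Qed.

End projectors.

Section optimality.
Context {R : realType}.
Variables (n p : nat) (Xn Ths Thhat : 'M[R]_(n, p)) (B : 'M[R]_p).
Variables (Zs : 'I_p -> 'M[R]_n) (O : {set 'I_n}) (lambda c : R).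
Hypothesis Zsym : forall j, (Zs j)^T = Zs j.
Hypothesis Zid : forall j, Zs j *m Zs j = Zs j.
Hypothesis ZX : forall j k, k != j -> Zs j *m col k Xn = 0.
Hypothesis B1 : forall j, B j j = 1.
Hypothesis lambda_ge0 : 0 <= lambda.
Hypothesis ThsO : forall i, i \notin O -> forall j, Ths i j = 0.
Hypothesis Thhat_opt :
  forall Th, robust_obj Zs Xn lambda Thhat <= robust_obj Zs Xn lambda Th.
Let xi := Xn *m B - Ths.
Let b j := vnorm2 (Zs j *m col j xi).
Hypothesis b_gt0 : forall j, 0 < b j.
Hypothesis c_ge0 : 0 <= c.
Hypothesis Vle : forall i,
  \sum_j ((Zs j *m col j xi) i 0 / b j) ^+ 2 <= (c * lambda) ^+ 2.

Let Delta := Thhat - Ths.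
Let a j := vnorm2 (Zs j *m (col j xi - col j Delta)).
Let z j := vnorm2 (Zs j *m col j Delta).
Let S_O := \sum_(i in O) l2 (Delta i).
Let S_Oc := \sum_(i in ~: O) l2 (Delta i).

Let dotb j := dotv (Zs j *m col j xi) (col j Delta).

Lemma proj_residual j Th : Zs j *m (col j Xn - col j Th) =
  Zs j *m (col j xi - col j (Th - Ths)).
Proof.
have -> : col j xi - col j (Th - Ths) = Xn *m col j B - col j Th.
  rewrite /xi; apply/matrixP => i k; rewrite !mxE.
  under [in RHS]eq_bigr do rewrite mxE.
  by ring.
rewrite !mulmxBr; congr (_ - _).
have -> : Xn *m col j B = \sum_k B k j *: col k Xn.
  apply/matrixP => i k; rewrite !mxE summxE; apply: eq_bigr => l _.
  by rewrite !mxE mulrC.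
rewrite mulmx_sumr (bigD1 j)//= B1 scale1r big1 ?addr0// => k kj.
by rewrite -scalemxAr ZX// scaler0.
Qed.

Lemma objective_gap : lambda * (S_Oc - S_O) <= \sum_j (b j - a j).
Proof.
have := Thhat_opt Ths; rewrite /robust_obj.
under eq_bigr do rewrite proj_residual.
have -> : \sum_(j < p) vnorm2 (Zs j *m (col j Xn - col j Ths)) = \sum_j b j.
  by apply: eq_bigr => j _; rewrite proj_residual subrr linear0 subr0.
rewrite -/Delta sumrB => H.
have {H}H : lambda * (norm21 Thhat - norm21 Ths) <= \sum_j b j - \sum_j a j.
  rewrite mulrBr; move: H; rewrite -/(a _).
  set u := \sum_i _; set v := \sum_j _ => H.
  by rewrite lerBrDr addrAC lerBlDr addrC.
apply: le_trans H; rewrite ler_wpM2l//.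
have -> : norm21 Thhat = \sum_(i in O) l2 (Thhat i) + \sum_(i in ~: O) l2 (Thhat i).
  by rewrite /norm21 (bigID (mem O))/=; congr (_ + _); apply: eq_bigl => i; rewrite inE.
have -> : norm21 Ths = \sum_(i in O) l2 (Ths i).
  rewrite /norm21 (bigID (mem O))/= [X in _ + X]big1 ?addr0// => i iO.
  by rewrite big1 ?sqrtr0// => j _; rewrite ThsO// expr0n.
have -> : S_Oc = \sum_(i in ~: O) l2 (Thhat i).
  apply: eq_bigr => i; rewrite inE => iO; apply: eq_l2 => j.
  by rewrite !mxE (ThsO iO) subr0.
have : \sum_(i in O) l2 (Ths i) <= \sum_(i in O) l2 (Thhat i) + S_O.
  rewrite -big_split/=; apply: ler_sum => i _.
  rewrite -[X in _ <= _ + X]l2N; apply: le_trans (l2D _ _).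
  rewrite le_eqVlt; apply/orP; left; apply/eqP; apply: eq_l2 => j.
  by rewrite !mxE opprB addrC subrK.
lra.
Qed.

Lemma weighted_dot (w : 'I_p -> R) (W : R) : 0 <= W -> (forall j, 0 <= w j <= W) ->
  \sum_j w j * (dotb j / b j) <= W * (c * lambda) * (S_O + S_Oc).
Proof.
move=> W0 wW.
have -> : S_O + S_Oc = \sum_i l2 (Delta i).
  rewrite [RHS](bigID (mem O))/=; congr (_ + _).
  by apply: eq_bigl => i; rewrite inE.
rewrite mulr_sumr.
have -> : \sum_j w j * (dotb j / b j) =
    \sum_i \sum_j (w j * ((Zs j *m col j xi) i 0 / b j)) * Delta i j.
  rewrite exchange_big/=; apply: eq_bigr => j _.
  rewrite /dotb /dotv mulr_suml mulr_sumr; apply: eq_bigr => i _.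
  have -> : (col j Delta) i 0 = Delta i j by rewrite mxE.
  by ring.
apply: ler_sum => i _; apply: le_trans (CS _ _) _.
rewrite ler_wpM2r ?l2_ge0//; apply: ler_sqr2; first by rewrite !mulr_ge0.
rewrite l2_sqr exprMn; apply: le_trans (_ : W ^+ 2 *
  \sum_j ((Zs j *m col j xi) i 0 / b j) ^+ 2 <= _); last first.
  by rewrite ler_wpM2l ?sqr_ge0// Vle.
rewrite mulr_sumr; apply: ler_sum => j _; rewrite exprMn.
by have /andP[w0 wle] := wW j; rewrite ler_wpM2r ?sqr_ge0// lerXn2r.
Qed.

Lemma residual_gap j : b j - a j <= dotb j / b j.
Proof.
rewrite ler_pdivlMr// mulrBl -expr2 lerBlDr -lerBlDl.
rewrite /b -dotvv dot_proj// -/(b j) /dotb.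
have := dotv_CS (Zs j *m col j xi) (Zs j *m (col j xi - col j Delta)).
by rewrite dot_proj// dotvDr dotvNr mulrC.
Qed.

Lemma cone_condition : 0 < lambda -> (1 - c) * S_Oc <= (1 + c) * S_O.
Proof.
move=> l0.
have H1 : \sum_j (b j - a j) <= 1 * (c * lambda) * (S_O + S_Oc).
  apply: le_trans (weighted_dot (w := fun=> 1) _ _) => //.
  by apply: ler_sum => j _; rewrite mul1r residual_gap.
  by move=> j; rewrite ler01 lexx.
have := le_trans objective_gap H1; rewrite mul1r (mulrC c) -mulrA ler_pM2l// => H.
by lra.
Qed.

Lemma curvature_bound :
  \sum_j z j ^+ 2 / (2 * b j + z j) <=
  lambda * ((1 + 2 * c) * S_O - (1 - 2 * c) * S_Oc).
Proof.
have a_ge0 j : 0 <= a j := vnorm2_ge0 _.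
have z_ge0 j : 0 <= z j := vnorm2_ge0 _.
have ab0 j : 0 < a j + b j by rewrite ltr_wpDl.
pose w j := 2 * b j / (a j + b j).
have w02 j : 0 <= w j <= 2.
  rewrite /w divr_ge0 ?mulr_ge0 ?(ltW (b_gt0 _)) ?(ltW (ab0 _))//=.
  by rewrite ler_pdivrMr// ler_pM2l// lerDr.
have step j : z j ^+ 2 / (2 * b j + z j) <= (a j - b j) + w j * (dotb j / b j).
  have aE : a j ^+ 2 = b j ^+ 2 - 2 * dotb j + z j ^+ 2.
    rewrite /a /b /z /dotb mulmxBr -!dotvv !(dotvDl, dotvDr, dotvNl, dotvNr).
    rewrite (dotvC (Zs j *m col j Delta) (Zs j *m col j xi)).
    by rewrite (dot_proj (Zsym j) (Zid j) (col j xi) (col j Delta)); ring.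
  have ale : a j <= b j + z j.
    by rewrite /a mulmxBr; apply: le_trans (vnorm2D _ _) _; rewrite vnorm2N.
  have -> : a j - b j + w j * (dotb j / b j) = z j ^+ 2 / (a j + b j).
    have bn0 : b j != 0 by rewrite gt_eqF.
    have abn0 : a j + b j != 0 by rewrite gt_eqF.
    apply: (mulIf abn0); rewrite divfK// /w.
    rewrite (_ : z j ^+ 2 = a j ^+ 2 - b j ^+ 2 + 2 * dotb j); last by rewrite aE; ring.
    by field; apply/andP.
  rewrite ler_wpM2l ?sqr_ge0// lef_pV2; [|by rewrite posrE ltr_wpDr// mulr_gt0|by rewrite posrE].
  by rewrite addrC mulr_natl mulr2n -addrA lerD2l.
apply: le_trans (ler_sum _ (fun j _ => step j)) _.
rewrite big_split/=; have H := weighted_dot (ler0n R 2) w02.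
have := objective_gap; rewrite !sumrB => H2; rewrite -/(w _).
move: H H2; set A := \sum_j w j * _; set sa := \sum_j a j; set sb := \sum_j b j.
by move=> H H2; rewrite -[X in X + _]opprK opprB; lra.
Qed.

End optimality.

Section restricted_eigenvalue.
Context {R : realType}.

Lemma frobenius_product n p q (W : 'M[R]_(n, q)) (D : 'M[R]_(n, p)) (rho : R) :
  0 <= rho -> (forall i, l2 (W i) <= rho) ->
  \sum_j vnorm2 (W^T *m col j D) ^+ 2 <= (rho * \sum_i l2 (D i)) ^+ 2.
Proof.
move=> rho0 Wrho.
pose M := W^T *m D.
have colM j : W^T *m col j D = col j M by apply/matrixP => r s; rewrite !mxE; apply: eq_bigr => l _; rewrite !mxE.
pose F := Num.sqrt (\sum_j vnorm2 (W^T *m col j D) ^+ 2).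
have F0 : 0 <= F := sqrtr_ge0 _.
have F2 : F ^+ 2 = \sum_j vnorm2 (W^T *m col j D) ^+ 2.
  by rewrite sqr_sqrtr// sumr_ge0// => j _; exact: sqr_ge0.
have rowle i : l2 (fun j => \sum_k W i k * M k j) <= l2 (W i) * F.
  apply: ler_sqr2; first by rewrite mulr_ge0// l2_ge0.
  rewrite exprMn F2 !l2_sqr mulr_sumr; apply: ler_sum => j _.
  have -> : vnorm2 (W^T *m col j D) ^+ 2 = \sum_k M k j ^+ 2.
    by rewrite colM vnorm2_l2 l2_sqr; apply: eq_bigr => k _; rewrite mxE.
  exact: CS_sqr.
have key : F ^+ 2 <= (rho * \sum_i l2 (D i)) * F.
  have -> : F ^+ 2 = \sum_i \sum_j (\sum_k W i k * M k j) * D i j.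
    rewrite F2 exchange_big/=; apply: eq_bigr => j _.
    rewrite -dotvv {1}colM dotvC dotv_mulmx trmxK dotvC; apply: eq_bigr => i _.
    by rewrite !mxE; congr (_ * _); apply: eq_bigr => k _; rewrite !mxE.
  rewrite mulrAC mulr_sumr; apply: ler_sum => i _; apply: le_trans (CS _ _) _.
  rewrite ler_wpM2r ?l2_ge0//; apply: le_trans (rowle i) _.
  by rewrite ler_wpM2r.
rewrite -F2; have [->|Fn0] := eqVneq F 0.
  by rewrite expr0n sqr_ge0.
have Fgt : 0 < F by rewrite lt_def Fn0.
have FS : F <= rho * \sum_i l2 (D i) by move: key; rewrite expr2 ler_pM2r.
by rewrite lerXn2r// nnegrE (le_trans F0 FS).
Qed.

Lemma span_projection n q (Z : 'M[R]_n) (W : 'M[R]_(n, q)) (v : 'cV[R]_n)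
    (g : 'cV[R]_q) (tau : R) :
  Z^T = Z -> Z *m Z = Z -> 0 < tau ->
  (1%:M - Z) *m v = W *m g ->
  tau * vnorm2 g ^+ 2 <= vnorm2 (W *m g) ^+ 2 ->
  tau * vnorm2 ((1%:M - Z) *m v) ^+ 2 <= vnorm2 (W^T *m v) ^+ 2.
Proof.
move=> Zs ZZ tau0 vE tauW; set u := (1%:M - Z) *m v.
have Q1 : (1%:M - Z)^T = 1%:M - Z by rewrite linearB/= trmx1 Zs.
have Q2 : (1%:M - Z) *m (1%:M - Z) = 1%:M - Z.
  by rewrite mulmxBl mul1mx mulmxBr mulmx1 ZZ subrr subr0.
have uu : vnorm2 u ^+ 2 <= vnorm2 g * vnorm2 (W^T *m v).
  by rewrite -dotvv dot_proj// vE dotv_mulmx dotv_CS.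
have u0 := vnorm2_ge0 u; have g0 := vnorm2_ge0 g; have w0 := vnorm2_ge0 (W^T *m v).
move: tauW; rewrite -vE -/u => tauW.
have [u_eq0|un0] := eqVneq (vnorm2 u) 0; first by rewrite u_eq0 expr0n mulr0 sqr_ge0.
have up : 0 < vnorm2 u ^+ 2 by rewrite exprn_gt0// lt_def un0.
rewrite -(ler_pM2l up).
have : (vnorm2 u ^+ 2) ^+ 2 <= vnorm2 g ^+ 2 * vnorm2 (W^T *m v) ^+ 2.
  by rewrite -exprMn lerXn2r// nnegrE ?mulr_ge0// ltW.
have := sqr_ge0 (vnorm2 (W^T *m v)); move: tauW.
set G := vnorm2 g ^+ 2; set U := vnorm2 u ^+ 2; set V := _ ^+ 2 => H1 V0 H2.
apply: (@le_trans _ _ (tau * (G * V))).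
  by rewrite (_ : U * (tau * U) = tau * U ^+ 2); [rewrite ler_pM2l|ring].
by rewrite mulrA ler_wpM2r.
Qed.

End restricted_eigenvalue.

Section error_bound.
Context {R : realType}.

(* z^2/(2b+z) is increasing in z and decreasing in b, so all the z_j may be
   replaced by their common l2 norm in the denominator. *)
Lemma sum_curvature_ge (I : finType) (z b : I -> R) (beta : R) : 0 < beta ->
  (forall j, 0 <= z j) -> (forall j, 0 < b j <= beta) ->
  l2 z ^+ 2 / (2 * beta + l2 z) <= \sum_j z j ^+ 2 / (2 * b j + z j).
Proof.
move=> b0 z0 bb; rewrite {1}l2_sqr mulr_suml; apply: ler_sum => j _.
have /andP[bj0 bjb] := bb j.
have zl : z j <= l2 z.
  apply: ler_sqr2; rewrite ?l2_ge0// l2_sqr (bigD1 j)//= lerDl.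
  by apply: sumr_ge0 => i _; exact: sqr_ge0.
rewrite ler_wpM2l ?sqr_ge0// lef_pV2 ?posrE ?ltr_wpDr ?mulr_gt0 ?l2_ge0//.
by rewrite lerD// ler_pM2l.
Qed.

Lemma error_arith (N Q beta t : R) : 0 <= N -> 0 <= Q -> 0 < beta -> 0 <= t ->
  520 * t ^+ 2 <= 1 -> N ^+ 2 <= 2 * Q ^+ 2 ->
  Q ^+ 2 / (2 * beta + Q) <= 54 / 5 * t * N ->
  N <= 150 * beta * t.
Proof.
move=> N0 Q0 b0 t0 t2 NQ H.
have tle : t <= 22^-1.
  by apply: ler_sqr2; [rewrite invr_ge0|move: t2; clear; set u := t ^+ 2; lra].
have NQ' : N <= 17 / 12 * Q.
  apply: ler_sqr2; first by rewrite mulr_ge0// divr_ge0.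
  by rewrite exprMn; apply: le_trans NQ _; rewrite ler_wpM2r ?sqr_ge0//; clear; lra.
have d0 : 0 < 2 * beta + Q by rewrite ltr_wpDr// mulr_gt0.
move: H; rewrite ler_pdivrMr// => H.
have bt : 0 <= beta * t by rewrite mulr_ge0// ltW.
have -> : 150 * beta * t = 150 * (beta * t) by ring.
have [Qz|Qn0] := eqVneq Q 0.
  by move: NQ'; rewrite Qz mulr0 => /le_trans; apply; rewrite mulr_ge0.
have Qp : 0 < Q by rewrite lt_def Qn0.
have H1 : Q * Q <= Q * (54 / 5 * t * (17 / 12) * (2 * beta + Q)).
  rewrite -expr2; apply: le_trans H _.
  rewrite (_ : Q * _ = 54 / 5 * t * (17 / 12 * Q) * (2 * beta + Q)); last by ring.
  by rewrite ler_wpM2r ?(ltW d0)// ler_wpM2l// mulr_ge0//; clear; lra.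
move: H1; rewrite ler_pM2l// => H1.
have tQ : t * Q <= 22^-1 * Q by rewrite ler_wpM2r.
have E : 54 / 5 * t * (17 / 12) * (2 * beta + Q) =
  54 / 5 * (17 / 12) * 2 * (beta * t) + 54 / 5 * (17 / 12) * (t * Q) by ring.
rewrite {}E in H1; move: H1 tQ bt NQ'; clear.
by set x := beta * t; set y := t * Q; lra.
Qed.

End error_bound.

(** * Gram-Schmidt projectors and whitening *)

Section gram_schmidt.
Context {R : realType}.
Variable n : nat.
Implicit Types (s : seq 'cV[R]_n) (a u v x : 'cV[R]_n).

(* When a already lies in the span, v = 0 and the junk value 0^-1 = 0 makes the
   update trivial. *)
Fixpoint gsproj s : 'M[R]_n :=
  if s is a :: s' then
    let P := gsproj s' in let v := a - P *m a in
    P + (dotv v v)^-1 *: (v *m v^T)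
  else 0.

Lemma dotvv_eq0 (v : 'cV[R]_n) : dotv v v = 0 -> v = 0.
Proof.
rewrite dotvv => /eqP; rewrite sqrf_eq0 => /eqP v0.
by apply/matrixP => i j; rewrite !ord1 mxE; exact: (l2_eq0 v0).
Qed.

Lemma outer_mul u x : u *m u^T *m x = dotv u x *: u.
Proof.
rewrite -mulmxA dotvE (mx11_scalar (u^T *m x)) mul_mx_scalar.
by rewrite [in RHS]mxE eqxx mulr1n.
Qed.

Lemma gsproj_cons a s : (gsproj s)^T = gsproj s ->
  gsproj s *m gsproj s = gsproj s ->
  exists u, [/\ gsproj (a :: s) = gsproj s + u *m u^T,
    gsproj s *m u = 0, u = 0 \/ dotv u u = 1 &
    exists c, u = c *: (a - gsproj s *m a) /\ a - gsproj s *m a = dotv u a *: u].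
Proof.
move=> Ps PP; set P := gsproj s; set v := a - P *m a.
have Pv : P *m v = 0 by rewrite mulmxBr mulmxA PP subrr.
have [v0|vn0] := eqVneq (dotv v v) 0.
  exists 0; split; [|by rewrite mulmx0|by left|].
    by rewrite /= -/P -/v v0 invr0 scale0r mul0mx.
  exists 0; split; first by rewrite scale0r.
  by rewrite scaler0 -/v; exact: dotvv_eq0.
have vp : 0 < dotv v v by rewrite lt_def vn0 dotvv sqr_ge0.
have vE : vnorm2 v ^+ 2 = dotv v v by rewrite dotvv.
have nv0 : vnorm2 v != 0 by rewrite -sqrf_eq0 vE.
exists ((vnorm2 v)^-1 *: v); split.
- rewrite /= -/P -/v -vE linearZ/= -scalemxAr -scalemxAl scalerA.
  by rewrite -invfM -expr2.
- by rewrite -scalemxAr Pv scaler0.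
- by right; rewrite dotvZl dotvZr -vE mulrA -invfM -expr2 mulVf// sqrf_eq0.
- exists (vnorm2 v)^-1; split => //; rewrite -/P -/v.
  have va : dotv v a = dotv v v.
    rewrite /v; set w := P *m a.
    rewrite !(dotvDl, dotvDr, dotvNl, dotvNr) /w.
    rewrite (dotvC a (P *m a)) (dot_proj Ps PP); ring.
  by rewrite dotvZl va -vE scalerA expr2 mulrA mulVf// mul1r divff// scale1r.
Qed.

Lemma gsproj_sym_idem s :
  (gsproj s)^T = gsproj s /\ gsproj s *m gsproj s = gsproj s.
Proof.
elim: s => [|a s [Ps PP]]; first by rewrite /= trmx0 mul0mx.
have [u [-> Pu uu _]] := gsproj_cons a Ps PP.
split; first by rewrite linearD/= Ps trmx_mul trmxK.
have uP : u *m u^T *m gsproj s = 0.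
  by rewrite -mulmxA -[u^T *m _]trmxK trmx_mul trmxK Ps Pu trmx0 mulmx0.
rewrite mulmxDl !mulmxDr PP mulmxA Pu mul0mx addr0 uP add0r.
rewrite mulmxA outer_mul; case: uu => [->|->]; last by rewrite scale1r.
by rewrite !(mul0mx, scaler0).
Qed.

Lemma gsproj_sym s : (gsproj s)^T = gsproj s.
Proof. by have [] := gsproj_sym_idem s. Qed.

Lemma gsproj_idem s : gsproj s *m gsproj s = gsproj s.
Proof. by have [] := gsproj_sym_idem s. Qed.

Lemma gsproj_fix s a : a \in s -> gsproj s *m a = a.
Proof.
elim: s => // b s IH; rewrite inE.
have [u [-> Pu uu [c [uE bE]]]] := gsproj_cons b (gsproj_sym s) (gsproj_idem s).
rewrite mulmxDl outer_mul => /orP[/eqP ->|/IH as_].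
  by rewrite -bE addrC subrK.
suff -> : dotv u a = 0 by rewrite scale0r addr0 as_.
by rewrite -as_ dotvC dotv_mulmx gsproj_sym Pu /dotv big1// => i _; rewrite mxE mulr0.
Qed.

Lemma gsproj_span k (A : 'M[R]_(n, k)) (ks : seq 'I_k) :
  exists D, gsproj [seq col l A | l <- ks] = A *m D.
Proof.
elim: ks => [|l ks [D DE]]; first by exists 0; rewrite mulmx0.
set s := [seq col l A | l <- ks].
have [u [-> _ _ [c [uE _]]]] := gsproj_cons (col l A) (gsproj_sym s) (gsproj_idem s).
have [e eE] : exists e, u = A *m e.
  exists (c *: (delta_mx l 0 - D *m col l A)).
  by rewrite uE -scalemxAr mulmxBr -colE mulmxA /s DE.
by exists (D + e *m u^T); rewrite mulmxDr mulmxA -eE DE.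
Qed.

Lemma gsproj_orth_proj k (A : 'M[R]_(n, k)) (Z : 'M[R]_n) :
  orth_proj_compl Z A -> 1%:M - Z = gsproj [seq col l A | l <- enum 'I_k].
Proof.
move=> ZA; have ZA0 := orth_proj_compl0 ZA; have [D DE] := orth_proj_compl_span ZA.
have [Zs [ZZ _]] := ZA.
set P := gsproj _; have [C CE] := gsproj_span A (enum 'I_k); rewrite -/P in CE.
have PA : P *m A = A.
  apply/matrixP => i l.
  have : P *m col l A = col l A.
    by apply: gsproj_fix; apply/mapP; exists l => //; rewrite mem_enum.
  move/matrixP/(_ i 0); rewrite !mxE => <-; apply: eq_bigr => r _.
  by rewrite mxE.
have P1 : P *m (1%:M - Z) = 1%:M - Z by rewrite DE mulmxA PA.
have Z1 : (1%:M - Z) *m P = P.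
  by rewrite {1}CE mulmxA mulmxBl ZA0 mul1mx subr0 -CE.
have := congr1 trmx P1; rewrite trmx_mul /P gsproj_sym linearB/= trmx1 Zs -/P => P2.
by rewrite -P2 Z1.
Qed.

End gram_schmidt.

Section whitening.
Context {R : realType}.

Lemma whitening p (S : 'M[R]_p) : symmetric_pd S -> exists M : 'M[R]_p, M *m S *m M^T = 1%:M.
Proof.
elim: p S => [|p IH] S [Ssym Spd]; first by exists 0; apply/matrixP => -[].
change ('M[R]_(1 + p)) in S.
pose al := S (lshift p 0) (lshift p 0).
have al0 : 0 < al.
  have /Spd : (delta_mx 0 (lshift p 0) : 'rV[R]_(1 + p)) != 0.
    apply/eqP => /matrixP/(_ 0 (lshift p 0)); rewrite !mxE !eqxx/= => /eqP.
    by rewrite oner_eq0.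
  by rewrite -rowE trmx_delta -colE !mxE.
pose c := dlsubmx S : 'M[R]_(p, 1).
pose D := drsubmx S : 'M[R]_p.
have SE : S = block_mx al%:M c^T c D.
  rewrite -[LHS]submxK; congr block_mx.
    by rewrite [LHS]mx11_scalar; congr _%:M; rewrite !mxE.
  by rewrite /c trmx_dlsub Ssym.
have Dsym : D^T = D by rewrite /D trmx_drsub Ssym.
pose K : 'M[R]_(1 + p) := block_mx 1%:M 0 (- al^-1 *: c) 1%:M.
pose S' := D - al^-1 *: (c *m c^T).
have KSK : K *m S *m K^T = block_mx al%:M 0 0 S'.
  rewrite SE /K tr_block_mx trmx1 trmx0 !mulmx_block trmx1.
  rewrite !(mul1mx, mul0mx, mulmx1, mulmx0, addr0, add0r).
  rewrite mul_mx_scalar scalerA mulrN divff ?gt_eqF// scaleN1r addNr mul0mx add0r.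
  rewrite linearZ/= -!scalemxAr mul_scalar_mx scalerA mulNr mulVf ?gt_eqF// scaleN1r.
  rewrite addNr -scalemxAl; congr block_mx.
  by rewrite /S' addrC scaleNr.
have S'pd : symmetric_pd S'.
  split.
    by rewrite /S' linearB/= Dsym linearZ/= trmx_mul trmxK.
  move=> x xn0.
  have yn0 : row_mx 0 x *m K != 0.
    apply/eqP; rewrite /K mul_row_block !mul0mx mulmx1 !add0r.
    move/(congr1 rsubmx); rewrite row_mxKr linear0 => x0.
    by rewrite x0 eqxx in xn0.
  have := Spd _ yn0; rewrite trmx_mul !mulmxA -(mulmxA _ K S) -(mulmxA _ (K *m S)).
  rewrite KSK mul_row_block !mul0mx !mulmx0 !add0r ?addr0.
  by rewrite tr_row_mx mul_row_col mul0mx add0r.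
have [M' M'E] := IH _ S'pd.
pose N : 'M[R]_(1 + p) := block_mx (Num.sqrt al)^-1%:M 0 0 M'.
exists (N *m K); rewrite trmx_mul !mulmxA -(mulmxA N K S) -(mulmxA N (K *m S)) KSK.
have -> : N^T = block_mx (Num.sqrt al)^-1%:M 0 0 M'^T.
  by rewrite /N (@tr_block_mx _ 1 p 1 p) !trmx0 tr_scalar_mx.
rewrite /N !(@mulmx_block _ 1 p 1 p 1 p) !(mul0mx, mulmx0, addr0, add0r) M'E.
rewrite -!scalar_mxM.
rewrite (_ : _ * _ * _ = 1); first by rewrite -scalar_mx_block.
have sal : Num.sqrt al != 0 by rewrite gt_eqF// sqrtr_gt0.
rewrite -{2}[al]sqr_sqrtr ?(ltW al0)//; by field.
Qed.

End whitening.

(** * Independence and freezing *)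

Section density_measure.
Context d (T : measurableType d) (R : realType).
Variables (mu : {measure set T -> \bar R}) (h : T -> R).
Hypotheses (h0 : forall x, 0 <= h x) (mh : measurable_fun setT h).

Definition dens of (forall x, 0 <= h x) & measurable_fun setT h :=
  fun A : set T => (\int[mu]_(x in A) (h x)%:E)%E.

Let dens0 : dens h0 mh set0 = 0%E.
Proof. by rewrite /dens integral_set0. Qed.

Let dens_ge0 A : (0 <= dens h0 mh A)%E.
Proof. by apply: integral_ge0 => x _; rewrite lee_fin. Qed.

Let dens_sigma_additive : semi_sigma_additive (dens h0 mh).
Proof.
move=> /= A mA tA mUA; rewrite /dens/= ge0_integral_bigcup//=; last 2 first.
  by apply: measurable_funTS; exact/measurable_EFinP.
  by move=> x _; rewrite lee_fin.
apply: is_cvg_ereal_nneg_natsum_cond => n _ _.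
by apply: integral_ge0 => x _; rewrite lee_fin.
Qed.

HB.instance Definition _ := isMeasure.Build _ _ _
  (dens h0 mh) dens0 dens_ge0 dens_sigma_additive.

End density_measure.

Section density_integral.
Context d (T : measurableType d) (R : realType).
Variables (mu nu : {measure set T -> \bar R}) (h : T -> R).
Hypotheses (h0 : forall x, 0 <= h x) (mh : measurable_fun setT h).
Hypothesis nuE : forall A, measurable A -> nu A = (\int[mu]_(x in A) (h x)%:E)%E.

Import HBNNSimple.
Local Open Scope ereal_scope.

Lemma ge0_integral_density (f : T -> \bar R) : (forall x, 0 <= f x) ->
  measurable_fun setT f -> \int[nu]_x f x = \int[mu]_x (f x * (h x)%:E).
Proof.
move=> f0 mf; pose g := nnsfun_approx measurableT mf.
have gf x : (EFin \o g n) x @[n --> \oo] --> f x by exact: cvg_nnsfun_approx.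
have step n : \int[nu]_x (g n x)%:E = \int[mu]_x ((g n x)%:E * (h x)%:E).
  have gE x : (g n x)%:E * (h x)%:E =
      \sum_(k \in range (g n)) (k%:E * (\1_(g n @^-1` [set k]) x)%:E * (h x)%:E).
    rewrite {1}fimfunE -fsumEFin// ge0_mule_fsuml; last first.
      by move=> k; exact: nnfun_muleindic_ge0.
    by apply: eq_fsbigr => k _; rewrite EFinM.
  under [RHS]eq_integral do rewrite gE.
  rewrite ge0_integral_fsum//; last 2 first.
  - move=> k; apply: emeasurable_funM => //.
      apply: emeasurable_funM => //.
      by apply/measurable_EFinP; exact: measurable_indic.
    exact/measurable_EFinP.
  - move=> k x _; apply: mule_ge0; rewrite ?lee_fin//.
    by rewrite -lee_fin; exact: nnfun_muleindic_ge0.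
  rewrite integral_nnsfun// patch_setT sintegralE.
  apply: eq_fsbigr => k; rewrite inE => -[x _ gx].
  have k0 : (0 <= k)%R by rewrite -gx; exact: fun_ge0.
  under [RHS]eq_integral do rewrite -muleA.
  rewrite ge0_integralZl//; last 2 first.
  - apply: emeasurable_funM; last exact/measurable_EFinP.
    by apply/measurable_EFinP; exact: measurable_indic.
  - by move=> y _; rewrite mule_ge0// lee_fin.
  congr (_ * _); rewrite nuE// integral_mkcond/=; apply: eq_integral => y _.
  by rewrite patchE indicE; case: ifPn => [_|_]; rewrite ?mul1e ?mul0e.
transitivity (limn (fun n => \int[nu]_x (g n x)%:E)).
  rewrite -monotone_convergence//.
  - by apply: eq_integral => x _; apply/esym/cvg_lim => //; exact: gf.
  - by move=> n; exact/measurable_EFinP/measurable_funP.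
  - by move=> n y _; rewrite lee_fin.
  - by move=> y _ a b ab; rewrite lee_fin; exact/lefP/nd_nnsfun_approx.
transitivity (limn (fun n => \int[mu]_x ((g n x)%:E * (h x)%:E))).
  by congr (limn _); apply/funext => n; exact: step.
rewrite -monotone_convergence//.
- apply: eq_integral => x _; apply/cvg_lim => //.
  by apply: cvgeZr => //; exact: gf.
- move=> n; apply: emeasurable_funM; last exact/measurable_EFinP.
  exact/measurable_EFinP/measurable_funP.
- by move=> n y _; rewrite mule_ge0// lee_fin.
- move=> y _ a b ab; rewrite lee_wpmul2r// lee_fin//.
  exact/lefP/nd_nnsfun_approx.
Qed.

End density_integral.

Lemma integral_prob_cst d (T : measurableType d) (R : realType)
    (P : probability T R) (r : R) : (\int[P]__ r%:E = r%:E)%E.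
Proof.
transitivity (r%:E * P setT)%E; first exact: integral_cst.
by rewrite probability_setT mule1.
Qed.

Section freezing.
Context d (T : measurableType d) (R : realType) (P : probability T R).
Local Open Scope ereal_scope.

Lemma indep_extend (G : set (set T)) (B : set T) :
  G `<=` measurable -> setI_closed G -> G setT -> measurable B ->
  (forall A, G A -> P (A `&` B) = P A * P B) ->
  forall A, <<s G >> A -> P (A `&` B) = P A * P B.
Proof.
move=> Gm GI GT mB GB A sA.
have PBf : P B \is a fin_num by exact: fin_num_measure.
have PB0 : (0 <= fine (P B))%R by rewrite fine_ge0.
have := @g_sigma_algebra_measure_unique _ R T G Gm (fun=> setT) (fun=> GT).
move=> /(_ _ (mrestr P mB) (mscale (NngNum PB0) P) GI).
have muE C : mscale (NngNum PB0) P C = P C * P B.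
  by rewrite /mscale/= fineK// muleC.
move=> U; rewrite -muE -U//.
- by rewrite bigcup_const//; exists 0%N.
- by move=> C GC; exact: etrans (GB C GC) (esym (muE C)).
- move=> _; rewrite /mrestr; apply: le_lt_trans (probability_le1 P _) (ltry 1).
  by rewrite setTI.
Qed.

Variables (G1 G2 : set (set T)).
Hypotheses (G1m : G1 `<=` measurable) (G2m : G2 `<=` measurable).
Hypotheses (G1I : setI_closed G1) (G2I : setI_closed G2).
Hypotheses (G1T : G1 setT) (G2T : G2 setT).
Hypothesis G12 : forall A B, G1 A -> G2 B -> P (A `&` B) = P A * P B.

Let sG1m : <<s G1 >> `<=` measurable.
Proof. by apply: smallest_sub => //; exact: sigma_algebra_measurable. Qed.

Let sG2m : <<s G2 >> `<=` measurable.
Proof. by apply: smallest_sub => //; exact: sigma_algebra_measurable. Qed.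

Lemma indep_sigma A B : <<s G1 >> A -> <<s G2 >> B -> P (A `&` B) = P A * P B.
Proof.
move=> sA sB.
have step1 A' B' : <<s G1 >> A' -> G2 B' -> P (A' `&` B') = P A' * P B'.
  by move=> sA' GB'; apply: (@indep_extend G1) => // [|C GC]; [exact: G2m|exact: G12].
rewrite setIC muleC; apply: (@indep_extend G2) => // [|C GC]; first exact: sG1m.
by rewrite setIC muleC; exact: step1.
Qed.

Let T1 := g_sigma_algebraType G1.
Let T2 := g_sigma_algebraType G2.

Let id1 : T -> T1 := id.
Let id2 : T -> T2 := id.

Let mid1 : measurable_fun setT id1.
Proof. by move=> _ A mA; rewrite setTI; exact: sG1m. Qed.

Let mid2 : measurable_fun setT id2.
Proof. by move=> _ A mA; rewrite setTI; exact: sG2m. Qed.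

Let f1 : {mfun T >-> T1} := HB.pack id1 (isMeasurableFun.Build _ _ _ _ _ mid1).
Let f2 : {mfun T >-> T2} := HB.pack id2 (isMeasurableFun.Build _ _ _ _ _ mid2).
Let diag : T -> T1 * T2 := fun w => (w, w).

Let mdiag : measurable_fun setT diag.
Proof. exact: measurable_fun_pair mid1 mid2. Qed.

Let fdiag : {mfun T >-> (T1 * T2)%type} :=
  HB.pack diag (isMeasurableFun.Build _ _ _ _ _ mdiag).

Lemma ge0_freezing (F : T1 * T2 -> \bar R) :
  measurable_fun setT F -> (forall z, 0 <= F z) ->
  \int[P]_w F (w, w) = \int[P]_w' \int[P]_w F (w, w').
Proof.
move=> mF F0.
pose P1 : probability T1 R := distribution P f1.
pose P2 : probability T2 R := distribution P f2.
have E0 : \int[P]_w F (w, w) = \int[pushforward P fdiag]_z F z.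
  by rewrite ge0_integral_pushforward.
rewrite E0 (eq_measure_integral (P1 \x P2)); last first.
  move=> A mA _; rewrite -(@product_measure_unique _ _ _ _ _ P1 P2 (pushforward P fdiag))//.
  move=> B C mB mC; rewrite /P1 /P2 /distribution /pushforward/=.
  rewrite -(indep_sigma (A := B) (B := C))//.
rewrite fubini_tonelli2//.
rewrite /fubini_G ge0_integral_pushforward//; last 2 first.
- exact: measurable_fun_fubini_tonelli_G.
- by move=> y _; exact: integral_ge0.
apply: eq_integral => w' _ /=.
rewrite ge0_integral_pushforward//.
exact: measurableT_comp.
Qed.

Lemma ge0_freezing_le (F : T1 * T2 -> \bar R) (M : R) :
  measurable_fun setT F -> (forall z, 0 <= F z) ->
  (forall w', \int[P]_w F (w, w') <= M%:E) -> \int[P]_w F (w, w) <= M%:E.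
Proof.
move=> mF F0 FM; rewrite (ge0_freezing mF F0).
apply: (@le_trans _ _ (\int[P]_(w' in setT) M%:E)); last first.
  by rewrite integral_prob_cst.
have M0 : 0 <= M%:E by apply: le_trans (FM point); exact: integral_ge0.
have mG : measurable_fun setT (fun w' : T2 => \int[P]_w F (w, w')).
  pose P1 : probability T1 R := distribution P f1.
  rewrite (_ : (fun _ => _) = (fun y => \int[P1]_x F (x, y))).
    exact: (measurable_fun_fubini_tonelli_G (m1 := P1) F mF F0).
  apply/funext => y; rewrite /P1 /distribution ge0_integral_pushforward//.
  exact: measurableT_comp.
apply: ge0_le_integral => //.
- by move=> w _; exact: integral_ge0.
- exact: (measurableT_comp mG mid2).
Qed.

End freezing.

Section product_expectation.
Context d (T : measurableType d) (R : realType) (P : probability T R).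
Variables (n : nat) (X : 'I_n -> T -> R).
Hypothesis mX : forall i, measurable_fun setT (X i).
Hypothesis indepX : forall B : 'I_n -> set R, (forall i, measurable (B i)) ->
  P (\bigcap_(i in [set: 'I_n]) (X i @^-1` B i)) = (\prod_(i < n) P (X i @^-1` B i))%E.
Local Open Scope ereal_scope.

Let indep_sub (s : seq 'I_n) (B : 'I_n -> set R) : uniq s ->
  (forall i, measurable (B i)) ->
  P (\bigcap_(i in [set` s]) (X i @^-1` B i)) = \prod_(i <- s) P (X i @^-1` B i).
Proof.
move=> us mB; pose B' i := if i \in s then B i else setT.
have mB' i : measurable (B' i) by rewrite /B'; case: ifP.
have -> : \bigcap_(i in [set` s]) (X i @^-1` B i) =
          \bigcap_(i in [set: 'I_n]) (X i @^-1` B' i).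
  apply/seteqP; split => w H i /=.
    by move=> _; rewrite /B'; case: ifPn => // si; exact: H.
  by move=> si; have := H i I; rewrite /B' /= si.
rewrite indepX// [RHS]big_uniq// [RHS]big_mkcond/=; apply: eq_bigr => i _.
by rewrite /B'; case: ifPn => // _; rewrite preimage_setT probability_setT.
Qed.

Lemma indep_prod_integral (f : 'I_n -> R -> R) :
  (forall i x, (0 <= f i x)%R) -> (forall i, measurable_fun setT (f i)) ->
  \int[P]_w (\prod_(i < n) f i (X i w))%:E = \prod_(i < n) \int[P]_w (f i (X i w))%:E.
Proof.
move=> f0 mf.
suff H (s : seq 'I_n) : uniq s ->
    \int[P]_w (\prod_(i <- s) f i (X i w))%:E =
    \prod_(i <- s) \int[P]_w (f i (X i w))%:E.
  by have := H (index_enum _) (index_enum_uniq _).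
elim: s => [|i s IH] us.
  under eq_integral do rewrite big_nil.
  by rewrite big_nil integral_cst//= probability_setT mule1.
move: us => /= /andP[si us].
pose G1 := [set A | exists B, measurable B /\ A = X i @^-1` B].
pose G2 := [set A | exists B : 'I_n -> set R, (forall j, measurable (B j)) /\
  A = \bigcap_(j in [set` s]) (X j @^-1` B j)].
have mXB j B : measurable B -> measurable (X j @^-1` B).
  by move=> mB; rewrite -[X in measurable X]setTI; exact: mX.
have G1m : G1 `<=` measurable by move=> _ [B [mB ->]]; exact: mXB.
have G2m : G2 `<=` measurable.
  move=> _ [B [mB ->]]; apply: fin_bigcap_measurable => // j _; exact: mXB.
have G1I : setI_closed G1.
  move=> _ _ [B [mB ->]] [C [mC ->]]; exists (B `&` C).
  by split; [exact: measurableI|rewrite preimage_setI].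
have G2I : setI_closed G2.
  move=> _ _ [B [mB ->]] [C [mC ->]]; exists (fun j => B j `&` C j).
  split=> [j|]; first exact: measurableI.
  apply/seteqP; split => [w [H1 H2] j js|w H].
    by split; [exact: H1|exact: H2].
  by split => j js; have [] := H j js.
have G1T : G1 setT by exists setT; split => //; rewrite preimage_setT.
have G2T : G2 setT.
  exists (fun=> setT); split => //.
  by apply/seteqP; split => // w _ j _.
have G12 A B : G1 A -> G2 B -> P (A `&` B) = P A * P B.
  move=> [C [mC ->]] [D [mD ->]].
  pose B' j := if j == i then C else D j.
  have mB' j : measurable (B' j) by rewrite /B'; case: ifP.
  have E : X i @^-1` C `&` \bigcap_(j in [set` s]) (X j @^-1` D j) =
           \bigcap_(j in [set` i :: s]) (X j @^-1` B' j).
    apply/seteqP; split => [w [H1 H2] j /=|w H].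
      rewrite inE /B'; case: eqVneq => [->//|ji /= js]; exact: H2.
    split; first by have := H i; rewrite /= inE eqxx /B' eqxx; apply.
    move=> j /= js; have := H j; rewrite /= inE js orbT /B' => /(_ isT).
    by case: eqVneq => // ji; rewrite ji (negbTE si) in js.
  rewrite E indep_sub//= ?si// big_cons; congr (_ * _).
    by rewrite /B' eqxx.
  rewrite indep_sub//; apply: eq_big_seq => j js.
  by rewrite /B'; case: eqVneq => // ji; rewrite ji (negbTE si) in js.
pose F (z : g_sigma_algebraType G1 * g_sigma_algebraType G2) : \bar R :=
  (f i (X i z.1))%:E * (\prod_(j <- s) f j (X j z.2))%:E.
have prod_ge0 w : (0 <= \prod_(j <- s) f j (X j w))%R by apply: prodr_ge0.
have mXi1 : measurable_fun setT (X i : g_sigma_algebraType G1 -> R).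
  by move=> _ B mB; rewrite setTI; apply: sub_sigma_algebra; exists B.
have mXj2 j : j \in s -> measurable_fun setT (X j : g_sigma_algebraType G2 -> R).
  move=> js _ B mB; rewrite setTI; apply: sub_sigma_algebra.
  exists (fun k => if k == j then B else setT); split => [k|]; first by case: ifP.
  apply/seteqP; split => [w H k ks /=|w H]; first by case: eqVneq => // ->.
  by have := H j js; rewrite /= eqxx.
have mprod2 : measurable_fun setT
    (fun w : g_sigma_algebraType G2 => \prod_(j <- s) f j (X j w))%R.
  apply: measurable_prod => j js; exact: measurableT_comp (mXj2 j js).
have mF : measurable_fun setT F.
  apply: emeasurable_funM; apply/measurable_EFinP.
    exact: (measurableT_comp (mf i) (measurableT_comp mXi1 measurable_fst)).
  exact: (measurableT_comp mprod2 measurable_snd).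
have := ge0_freezing G1m G2m G1I G2I G1T G2T G12 mF.
have F0 z : 0 <= F z by rewrite mule_ge0// lee_fin.
move=> /(_ F0); rewrite /F/= => fr.
under eq_integral do rewrite big_cons EFinM.
rewrite fr big_cons -IH//.
have mfX : measurable_fun setT (fun w => (f i (X i w))%:E).
  by apply/measurable_EFinP; exact: measurableT_comp.
transitivity (\int[P]_w' (\int[P]_w (f i (X i w))%:E *
    (\prod_(j <- s) f j (X j w'))%:E)).
  apply: eq_integral => w' _; rewrite ge0_integralZr// ?lee_fin//.
  by move=> w _; rewrite lee_fin.
have I0 : 0 <= \int[P]_x (f i (X i x))%:E by apply: integral_ge0 => x _; rewrite lee_fin.
rewrite ge0_integralZl//; last by move=> w _; rewrite lee_fin.
apply/measurable_EFinP; apply: measurable_prod => j _; exact: measurableT_comp.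
Qed.

End product_expectation.

(** * Gaussian integrals *)

Section agreement.
Context d d' (T : measurableType d) (T' : measurableType d') (R : realType).
Variables (mu : {measure set T -> \bar R}) (nu : {measure set T' -> \bar R}).
Hypotheses (mufin : (mu setT < +oo)%E) (nufin : (nu setT < +oo)%E).

Definition agree (F : T -> R) (F' : T' -> R) :=
  [/\ measurable_fun setT F, measurable_fun setT F',
      exists M, (forall x, `|F x| <= M) /\ (forall x, `|F' x| <= M) &
      (\int[mu]_x (F x)%:E = \int[nu]_x (F' x)%:E)%E].

Lemma integrable_bounded d0 (T0 : measurableType d0)
    (m : {measure set T0 -> \bar R}) (F : T0 -> R) M :
  (m setT < +oo)%E -> measurable_fun setT F -> (forall x, `|F x| <= M) ->
  m.-integrable setT (EFin \o F).
Proof.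
move=> mfin mF FM; apply/integrableP; split; first exact/measurable_EFinP.
apply: (@le_lt_trans _ _ (\int[m]_x (`|M|)%:E)%E).
  apply: ge0_le_integral => //.
  - by apply/measurable_EFinP; exact: measurableT_comp.
  - by move=> x _; rewrite lee_fin (le_trans (FM x))// ler_norm.
rewrite integral_cst// lte_mul_pinfty// lee_fin//.
Qed.

Lemma agree_add F G F' G' : agree F F' -> agree G G' ->
  agree (fun x => F x + G x) (fun x => F' x + G' x).
Proof.
move=> [mF mF' [M [FM FM']] E] [mG mG' [N [GN GN']] E2]; split.
- exact: measurable_funD.
- exact: measurable_funD.
- by exists (M + N); split=> x; rewrite (le_trans (ler_normD _ _))// lerD.
- have iF := integrable_bounded mufin mF FM.
  have iG := integrable_bounded mufin mG GN.
  have iF' := integrable_bounded nufin mF' FM'.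
  have iG' := integrable_bounded nufin mG' GN'.
  have := integralD measurableT iF iG; have := integralD measurableT iF' iG'.
  by rewrite /= => EE' EE; rewrite [LHS]EE [RHS]EE' E E2.
Qed.

Lemma agree_scale c F F' : agree F F' ->
  agree (fun x => c * F x) (fun x => c * F' x).
Proof.
move=> [mF mF' [M [FM FM']] E]; split.
- exact: measurable_funM.
- exact: measurable_funM.
- by exists (`|c| * M); split=> x; rewrite normrM ler_wpM2l.
- have iF := integrable_bounded mufin mF FM.
  have iF' := integrable_bounded nufin mF' FM'.
  have := integralZl measurableT iF c; have := integralZl measurableT iF' c.
  by rewrite /= => EE' EE; rewrite [LHS]EE [RHS]EE' E.
Qed.

Lemma eq_agree F G F' G' : F =1 G -> F' =1 G' -> agree F F' -> agree G G'.
Proof. by move=> /funext -> /funext ->. Qed.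

Lemma agree_lim (F : nat -> T -> R) (F' : nat -> T' -> R)
    (G : T -> R) (G' : T' -> R) (M : R) :
  (forall n, agree (F n) (F' n)) ->
  (forall n x, `|F n x| <= M) -> (forall n x, `|F' n x| <= M) ->
  (forall x, F n x @[n --> \oo] --> G x) ->
  (forall x, F' n x @[n --> \oo] --> G' x) -> agree G G'.
Proof.
move=> FF' FM FM' FG FG'.
have mF n : measurable_fun setT (F n) by have [] := FF' n.
have mF' n : measurable_fun setT (F' n) by have [] := FF' n.
have mG : measurable_fun setT G by apply: (measurable_fun_cvg mF) => x _; exact: FG.
have mG' : measurable_fun setT G' by apply: (measurable_fun_cvg mF') => x _; exact: FG'.
have bnd (f : nat -> R) (l : R) : (forall n, `|f n| <= M) -> f n @[n --> \oo] --> l -> `|l| <= M.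
  move=> fM fl; have nl : `|f n| @[n --> \oo] --> `|l| by exact: cvg_norm fl.
  rewrite -(cvg_lim (@Rhausdorff R) nl); apply: limr_le; last exact: nearW.
  by apply/cvg_ex; eexists; exact: nl.
split=> //.
  by exists M; split=> x; [exact: (bnd (F ^~ x))|exact: (bnd (F' ^~ x))].
have iM (d0 : measure_display) (T0 : measurableType d0) (m : {measure set T0 -> \bar R}) :
    (m setT < +oo)%E -> m.-integrable setT (EFin \o cst `|M|).
  by move=> mf; apply: (@integrable_bounded _ _ _ _ `|M|) => // x /=; rewrite normr_id.
have cv (d0 : measure_display) (T0 : measurableType d0)
    (m : {measure set T0 -> \bar R}) (f : nat -> T0 -> R) (g : T0 -> R) :
    (m setT < +oo)%E -> (forall n, measurable_fun setT (f n)) ->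
    measurable_fun setT g -> (forall n x, `|f n x| <= M) ->
    (forall x, f n x @[n --> \oo] --> g x) ->
    ((\int[m]_x (f n x)%:E) @[n --> \oo] --> \int[m]_x (g x)%:E)%E.
  move=> mfin mf mg fM fg.
  have [|||||_ _] := @dominated_convergence _ _ _ m setT measurableT
    (fun n => EFin \o f n) (EFin \o g) (EFin \o cst `|M|); last exact.
  - by move=> n; exact/measurable_EFinP.
  - exact/measurable_EFinP.
  - by apply: aeW => x _; apply: cvg_EFin; [exact: nearW|exact: fg].
  - exact: iM.
  - by apply: aeW => x n _ /=; rewrite lee_fin (le_trans (fM n x))// ler_norm.
have C1 := cv _ _ _ _ _ mufin mF mG FM FG.
have C2 := cv _ _ _ _ _ nufin mF' mG' FM' FG'.
have E : (fun n => \int[mu]_x (F n x)%:E)%E = (fun n => \int[nu]_x (F' n x)%:E)%E.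
  by apply/funext => n; have [] := FF' n.
rewrite E in C1; exact: (cvg_unique _ C1 C2).
Qed.

End agreement.

Section normal_integrals.
Context {R : realType}.
Notation mu := (@lebesgue_measure R).

Lemma ge0_integral_normal_prob (m s : R) (f : R -> \bar R) :
  (forall x, 0 <= f x)%E -> measurable_fun setT f ->
  (\int[normal_prob m s]_x f x = \int[mu]_x (f x * (normal_pdf m s x)%:E))%E.
Proof.
move=> f0 mf; rewrite (@ge0_integral_density _ _ _ mu _ (normal_pdf m s))//.
- exact: normal_pdf_ge0.
- exact: measurable_normal_pdf.
Qed.

Lemma integral_normal_prob (m s : R) (f : R -> R) : (forall x, 0 <= f x) ->
  measurable_fun setT f ->
  (\int[normal_prob m s]_x (f x)%:E = \int[mu]_x (f x * normal_pdf m s x)%:E)%E.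
Proof.
by move=> f0 mf; rewrite ge0_integral_normal_prob//; exact/measurable_EFinP.
Qed.

Lemma normal_pdf_exp (m s t x : R) : s != 0 ->
  expR (t * (x - m)) * normal_pdf m s x =
  expR (t ^+ 2 * s ^+ 2 / 2) * normal_pdf (m + t * s ^+ 2) s x.
Proof.
move=> s0; rewrite !normal_pdfE// !(mulrCA (expR _)); congr (_ * _).
rewrite /normal_fun -!expRD; congr expR.
by rewrite -(mulr_natl (s ^+ 2)); field.
Qed.

Lemma integral_normal_exp (m s t : R) : s != 0 ->
  (\int[mu]_x (expR (t * (x - m)) * normal_pdf m s x)%:E =
  (expR (t ^+ 2 * s ^+ 2 / 2))%:E)%E.
Proof.
move=> s0; under eq_integral do rewrite normal_pdf_exp// EFinM.
rewrite integralZl//; last exact: integrable_normal_pdf.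
by rewrite integral_normal_pdf mule1.
Qed.

Lemma integral_normal_sqr (c : R) : 2 * c < 1 ->
  (\int[mu]_x (expR (c * x ^+ 2) * normal_pdf 0 1 x)%:E =
  ((Num.sqrt (1 - 2 * c))^-1)%:E)%E.
Proof.
move=> c1; set r := Num.sqrt (1 - 2 * c).
have r0 : 0 < r by rewrite sqrtr_gt0 subr_gt0.
have r2 : r ^+ 2 = 1 - 2 * c by rewrite sqr_sqrtr// subr_ge0 ltW.
have rn0 : r != 0 by rewrite gt_eqF.
have E x : expR (c * x ^+ 2) * normal_pdf 0 1 x = r^-1 * normal_pdf 0 r^-1 x.
  rewrite !normal_pdfE ?oner_eq0 ?invr_eq0// mulrCA mulrA.
  have -> : normal_peak 1 = r^-1 * normal_peak r^-1.
    rewrite /normal_peak expr1n mul1r -mulr_natl -[in RHS]mulr_natl mulrCA.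
    rewrite [in RHS]sqrtrM ?sqr_ge0// sqrtr_sqr ger0_norm ?invr_ge0 ?(ltW r0)//.
    by rewrite invfM invrK mulrA mulVf// mul1r.
  rewrite -!mulrA; congr (_ * (_ * _)); rewrite /normal_fun -expRD; congr expR.
  rewrite !subr0 exprVn r2 expr1n -(mulr_natl (1 - 2 * c)^-1).
  have r2n0 : 1 - 2 * c != 0 by rewrite -r2 sqrf_eq0.
  by field.
under eq_integral do rewrite E EFinM.
rewrite integralZl//; last exact: integrable_normal_pdf.
by rewrite integral_normal_pdf mule1.
Qed.

Lemma normal_prob_tail (m s t rho : R) (B : set R) : s != 0 -> measurable B ->
  (forall x, B x -> rho <= t * (x - m)) ->
  (normal_prob m s B <= (expR (t ^+ 2 * s ^+ 2 / 2 - rho))%:E)%E.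
Proof.
move=> s0 mB Brho; rewrite /normal_prob.
have mp : measurable_fun setT (normal_pdf m s) by exact: measurable_normal_pdf.
have me : measurable_fun setT (fun x : R => expR (- rho) * (expR (t * (x - m)) * normal_pdf m s x)).
  apply: measurable_funM => //; apply: measurable_funM => //.
  apply: measurableT_comp => //; apply: measurable_funM => //.
  exact: measurable_funB.
apply: (@le_trans _ _ (\int[mu]_x (expR (- rho) * (expR (t * (x - m)) * normal_pdf m s x))%:E)%E).
  rewrite integral_mkcond; apply: ge0_le_integral => //.
  - move=> x _; rewrite patchE; case: ifPn => // _; exact: normal_pdf_ge0.
  - apply/(measurable_restrictT _ mB); apply: measurable_funTS.
    by apply/measurable_EFinP; exact: mp.
  - exact/measurable_EFinP.
  - move=> x _; rewrite patchE; case: ifPn => [|_]; rewrite lee_fin.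
    rewrite inE => /Brho H; rewrite mulrA -expRD ler_peMl ?normal_pdf_ge0//.
    by rewrite -[leLHS]expR0 ler_expR addrC subr_ge0.
  by rewrite !mulr_ge0 ?expR_ge0 ?normal_pdf_ge0.
under eq_integral do rewrite EFinM.
rewrite ge0_integralZl//.
- by rewrite integral_normal_exp// -EFinM -expRD addrC.
- apply/measurable_EFinP; apply: measurable_funM => //.
  apply: measurableT_comp => //; apply: measurable_funM => //.
  exact: measurable_funB.
- by move=> x _; rewrite lee_fin mulr_ge0 ?expR_ge0 ?normal_pdf_ge0.
Qed.

Lemma integral_shift (G : R -> R) (c : R) : continuous G -> (forall x, 0 <= G x) ->
  (\int[mu]_x (G x)%:E = \int[mu]_x (G (x + c))%:E)%E.
Proof.
move=> cG G0.
have dF : (fun x : R^o => x + c)^`()%classic = cst 1.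
  apply/funext => x; rewrite derive1E deriveD// derive_cst addr0.
  by rewrite derive_id.
rewrite (@increasing_ge0_integration_by_substitutionT R (fun x => x + c) G)//.
- by apply: eq_integral => x _; rewrite dF fctE/= mulr1.
- by move=> x y xy; rewrite ltrD2r.
- by rewrite dF => ?; exact: cvg_cst.
- by rewrite dF; exact: is_cvg_cst.
- by rewrite dF; exact: is_cvg_cst.
- exact: cvg_addrr_Ny.
- exact: cvg_addrr.
Qed.

Lemma normal_pdf_mul (s t x z : R) : s != 0 -> t != 0 ->
  let r := Num.sqrt (s ^+ 2 + t ^+ 2) in
  normal_pdf 0 s x * normal_pdf 0 t (z - x) =
  normal_pdf 0 r z * normal_pdf (z * s ^+ 2 / r ^+ 2) (s * t / r) x.
Proof.
move=> s0 t0 r.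
have s2 : 0 < s ^+ 2 by rewrite exprn_even_gt0.
have t2 : 0 < t ^+ 2 by rewrite exprn_even_gt0.
have r2 : r ^+ 2 = s ^+ 2 + t ^+ 2 by rewrite sqr_sqrtr// addr_ge0// ltW.
have r0 : 0 < r by rewrite sqrtr_gt0 addr_gt0.
have rn0 : r != 0 by rewrite gt_eqF.
have q0 : s * t / r != 0 by rewrite !mulf_neq0 ?invr_eq0.
rewrite !normal_pdfE// mulrACA [RHS]mulrACA; congr (_ * _).
  have peakE u : normal_peak u = `|u|^-1 * (Num.sqrt (pi *+ 2))^-1.
    by rewrite /normal_peak -mulrnAr sqrtrM ?sqr_ge0// sqrtr_sqr invfM.
  rewrite !peakE !normrM normfV mulrACA [RHS]mulrACA; congr (_ * _).
  by field; rewrite !normr_eq0 s0 t0 rn0.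
rewrite /normal_fun -!expRD; congr expR.
rewrite !subr0 !exprMn exprVn r2 -!(mulr_natl (_ ^+ 2)) -!(mulr_natl (_ + _)) -(mulr_natl (_ / _)).
have st0 : s ^+ 2 + t ^+ 2 != 0 by rewrite gt_eqF// addr_gt0.
by field; rewrite st0 s0 t0.
Qed.

Lemma normal_convolution (s t : R) (h : R -> R) : s != 0 -> t != 0 ->
  continuous h -> (forall x, 0 <= h x) ->
  (\int[normal_prob 0 s]_x \int[normal_prob 0 t]_y (h (x + y))%:E =
   \int[normal_prob 0 (Num.sqrt (s ^+ 2 + t ^+ 2))]_z (h z)%:E)%E.
Proof.
move=> s0 t0 ch h0; set r := Num.sqrt _.
have mh : measurable_fun setT h by exact: continuous_measurable_fun.
have r0 : 0 < r by rewrite sqrtr_gt0 addr_gt0// exprn_even_gt0.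
have q0 : s * t / r != 0 by rewrite !mulf_neq0 ?invr_eq0// gt_eqF.
have inner x : (\int[normal_prob 0 t]_y (h (x + y))%:E =
    \int[mu]_z (h z * normal_pdf 0 t (z - x))%:E)%E.
  have mhx : measurable_fun setT (fun y => h (x + y)).
    apply: (measurableT_comp mh); apply: measurable_funD.
      exact: measurable_cst.
    exact: measurable_id.
  rewrite (@integral_normal_prob 0 t _ (fun y => h0 (x + y)) mhx).
  rewrite [RHS](@integral_shift _ x).
  - by apply: eq_integral => y _; rewrite addrK (addrC y).
  - move=> z; apply: cvgM; first exact: ch.
    apply: (cvg_comp (fun z => z - x) (normal_pdf 0 t)); last exact: continuous_normal_pdf.
    by apply: (@cvgB _ R^o) => //; exact: cvg_cst.
  - by move=> z; rewrite mulr_ge0 ?normal_pdf_ge0.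
pose F (z : R * R) : \bar R := (h z.2 * normal_pdf 0 t (z.2 - z.1) * normal_pdf 0 s z.1)%:E.
have mF : measurable_fun setT F.
  apply/measurable_EFinP; apply: measurable_funM; first apply: measurable_funM.
  - exact: measurableT_comp.
  - apply: measurableT_comp; first exact: measurable_normal_pdf.
    exact: measurable_funB.
  - apply: measurableT_comp => //; exact: measurable_normal_pdf.
have F0 z : (0 <= F z)%E by rewrite lee_fin !mulr_ge0 ?normal_pdf_ge0.
transitivity (\int[mu]_x \int[mu]_z F (x, z))%E.
  under eq_integral do rewrite inner.
  pose F1 (z : R * R) : \bar R := (h z.2 * normal_pdf 0 t (z.2 - z.1))%:E.
  have mF1 : measurable_fun setT F1.
    apply/measurable_EFinP; apply: measurable_funM; first exact: measurableT_comp.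
    apply: measurableT_comp; first exact: measurable_normal_pdf.
    exact: measurable_funB.
  have F10 z : (0 <= F1 z)%E by rewrite lee_fin !mulr_ge0 ?normal_pdf_ge0.
  rewrite ge0_integral_normal_prob; last 2 first.
  - by move=> x; apply: integral_ge0 => z _; exact: (F10 (x, z)).
  - exact: (measurable_fun_fubini_tonelli_F (m2 := mu) F1 mF1 F10).
  apply: eq_integral => x _; rewrite -ge0_integralZr//.
  - exact: (measurable_fun_pair2 x mF1).
  - by move=> z _; exact: (F10 (x, z)).
  - by rewrite lee_fin normal_pdf_ge0.
rewrite (@fubini_tonelli _ _ _ _ _ mu mu)// integral_normal_prob//.
apply: eq_integral => z _; rewrite /F/=.
under eq_integral do rewrite -mulrA (mulrC (normal_pdf 0 t _)) normal_pdf_mul// mulrA EFinM.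
rewrite integralZl//; last exact: integrable_normal_pdf.
by rewrite integral_normal_pdf mule1.
Qed.

End normal_integrals.

(** * Uniqueness of measures from cosine integrals *)

Section cos_power.
Context {R : realType}.

Lemma sin_le_id (x : R) : 0 <= x -> sin x <= x.
Proof.
rewrite le_eqVlt => /predU1P[<-|x0]; first by rewrite sin0.
have [c _ /eqP] : exists2 c, c \in `]0, x[ & sin x - sin 0 = cos c * (x - 0).
  apply: (MVT x0) => //.
  by apply: continuous_subspaceT => y; exact: continuous_sin.
by rewrite sin0 !subr0 => /eqP ->; rewrite ler_piMl ?cos_le1// ltW.
Qed.

Lemma cos_half (u : R) : cos u = 1 - 2 * sin (u / 2) ^+ 2.
Proof.
rewrite [in LHS](_ : u = (u / 2) *+ 2); last by rewrite -mulr_natr divfK.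
by rewrite cos_mulr2n -mulr_natl cos2sin2; ring.
Qed.

Lemma cos_ge_quadratic (u : R) : 1 - u ^+ 2 / 2 <= cos u.
Proof.
wlog u0 : u / 0 <= u.
  move=> H; have [u0|u0] := leP 0 u; first exact: H.
  by rewrite -cosN -sqrrN; apply: H; rewrite oppr_ge0 ltW.
rewrite cos_half lerB// (_ : u ^+ 2 / 2 = 2 * (u / 2) ^+ 2); last by field.
rewrite ler_pM2l// -[sin _ ^+ 2]real_normK ?num_real//; have h0 : 0 <= u / 2 by rewrite divr_ge0.
rewrite lerXn2r ?nnegrE//.
rewrite ler_norml sin_le_id// andbT.
rewrite lerNl; have [hp|hp] := leP (u / 2) pi; last first.
  by have := sin_geN1 (u / 2); have := pi_ge2 R; move: hp; set a := u / 2; lra.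
by rewrite (@le_trans _ _ 0)// oppr_le0 sin_ge0_pi// h0.
Qed.

Lemma sin_ge_cubic (x : R) : 0 <= x -> x - x ^+ 3 / 6 <= sin x.
Proof.
rewrite le_eqVlt => /predU1P[<-|x0]; first by rewrite sin0; lra.
pose f (y : R) := sin y - y + y ^+ 3 / 6.
have df (y : R) : is_derive y 1 f (cos y - 1 + y ^+ 2 / 2).
  rewrite /f; apply: is_derive_eq.
  by rewrite /GRing.scale/=; field.
have [c _ /eqP] : exists2 c, c \in `]0, x[ &
    f x - f 0 = (cos c - 1 + c ^+ 2 / 2) * (x - 0).
  apply: (MVT x0 (fun y _ => df y)).
  apply: continuous_subspaceT => y; apply: differentiable_continuous.
  by apply/derivable1_diffP; have [] := df y.
rewrite /f sin0 !subr0 expr0n/= mul0r addr0 subr0 => /eqP E.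
have : 0 <= (cos c - 1 + c ^+ 2 / 2) * x.
  by rewrite mulr_ge0 ?(ltW x0)//; have := cos_ge_quadratic c; lra.
by rewrite -E; lra.
Qed.

Lemma cos_le_quartic (u : R) : cos u <= 1 - u ^+ 2 / 2 + u ^+ 4 / 24.
Proof.
wlog u0 : u / 0 <= u.
  move=> H; have [u0|u0] := leP 0 u; first exact: H.
  rewrite -cosN -(sqrrN u) (_ : u ^+ 4 = (- u) ^+ 4); last by ring.
  by apply: H; rewrite oppr_ge0 ltW.
have [u12|u12] := leP 12 (u ^+ 2).
  apply: le_trans (cos_le1 u) _; rewrite (_ : u ^+ 4 = u ^+ 2 * u ^+ 2); last by ring.
  by move: u12; set v := u ^+ 2 => u12; nra.
rewrite cos_half; set x := u / 2.
have x0 : 0 <= x by rewrite divr_ge0.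
have uE : u = 2 * x by rewrite /x; field.
have x2 : x ^+ 2 < 3 by move: u12; rewrite uE exprMn; lra.
have sx := sin_ge_cubic x0.
have sx2 : (x - x ^+ 3 / 6) ^+ 2 <= sin x ^+ 2.
  have p0 : 0 <= x - x ^+ 3 / 6.
    rewrite (_ : _ - _ = x * (1 - x ^+ 2 / 6)); last by field.
    by rewrite mulr_ge0//; lra.
  by rewrite lerXn2r// nnegrE (le_trans p0).
have E : (x - x ^+ 3 / 6) ^+ 2 = x ^+ 2 - x ^+ 4 / 3 + (x ^+ 3 / 6) ^+ 2 by field.
have e0 := sqr_ge0 (x ^+ 3 / 6); rewrite {}E in sx2.
rewrite (_ : u ^+ 2 = 4 * x ^+ 2); last by rewrite uE; ring.
rewrite (_ : u ^+ 4 = 16 * x ^+ 4); last by rewrite uE; ring.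
move: e0 sx2; clear; set e := (_ / _) ^+ 2; set a := sin x ^+ 2.
by set b := x ^+ 4; set c := x ^+ 2; lra.
Qed.

Lemma expRN_le_quadratic (v : R) : 0 <= v -> expR (- v) <= 1 - v + v ^+ 2.
Proof.
move=> v0; rewrite expRN -[leLHS]div1r ler_pdivrMr ?expR_gt0//.
have h : 1 + v + v ^+ 2 / 4 <= expR v.
  rewrite (_ : 1 + v + v ^+ 2 / 4 = (1 + v / 2) ^+ 2); last by field.
  rewrite [in leRHS](_ : v = v / 2 + v / 2); last by field.
  rewrite expRD -expr2 lerXn2r ?nnegrE ?expR_ge0 ?expR_ge1Dx//; lra.
have p0 : 0 <= 1 - v + v ^+ 2.
  by rewrite (_ : _ + _ = (v - 1 / 2) ^+ 2 + 3 / 4); [have := sqr_ge0 (v - 1 / 2); lra|field].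
apply: le_trans (ler_wpM2l p0 h).
rewrite (_ : (1 - v + v ^+ 2) * _ = 1 + (v ^+ 2 / 4 + 3 / 4 * v ^+ 3 + v ^+ 4 / 4)); last by field.
by rewrite lerDl !addr_ge0// ?mulr_ge0// ?exprn_ge0// ?divr_ge0.
Qed.

Lemma cos_exp_dist (u : R) : `|cos u - expR (- (u ^+ 2 / 2))| <= u ^+ 4 / 4.
Proof.
have v0 : 0 <= u ^+ 2 / 2 by rewrite divr_ge0// sqr_ge0.
have := expRN_le_quadratic v0; have := expR_ge1Dx (- (u ^+ 2 / 2)).
have := cos_ge_quadratic u; have := cos_le_quartic u.
have -> : (u ^+ 2 / 2) ^+ 2 = u ^+ 4 / 4 by field.
have : 0 <= u ^+ 4 by rewrite (_ : u ^+ 4 = (u ^+ 2) ^+ 2) ?sqr_ge0//; ring.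
set a := cos u; set b := expR _; set c := u ^+ 2; set e := u ^+ 4.
move=> h1 h2 h3 h4 h5; rewrite ler_norml; apply/andP; split; lra.
Qed.

Lemma dist_pow_le (a b : R) n : `|a| <= 1 -> `|b| <= 1 ->
  `|a ^+ n - b ^+ n| <= n%:R * `|a - b|.
Proof.
move=> a1 b1; rewrite subrXX normrM mulrC ler_wpM2r//.
apply: le_trans (ler_norm_sum _ _ _) _; rewrite -[leRHS]mulr1 mulr_natl.
have -> : n%:R = \sum_(i < n) 1 :> R by rewrite sumr_const card_ord.
apply: ler_sum => i _.
by rewrite normrM !normrX mulr_ile1// exprn_ile1.
Qed.

Lemma cos_pow_cvg (y : R) :
  cos (y / Num.sqrt n.+1%:R) ^+ n.+1 @[n --> \oo] --> expR (- (y ^+ 2 / 2)).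
Proof.
have C : (y ^+ 4 / 4) * (n.+1%:R)^-1 @[n --> \oo] --> (0 : R).
  rewrite -[X in _ --> X](mulr0 (y ^+ 4 / 4)); apply: cvgM; first exact: cvg_cst.
  exact: cvg_harmonic.
have B n : `|expR (- (y ^+ 2 / 2)) - cos (y / Num.sqrt n.+1%:R) ^+ n.+1| <=
    (y ^+ 4 / 4) * (n.+1%:R)^-1.
  set u := y / Num.sqrt n.+1%:R.
  have n0 : n.+1%:R != 0 :> R by rewrite pnatr_eq0.
  have u2 : u ^+ 2 = y ^+ 2 / n.+1%:R by rewrite exprMn exprVn sqr_sqrtr.
  have -> : expR (- (y ^+ 2 / 2)) = expR (- (u ^+ 2 / 2)) ^+ n.+1.
    by rewrite -expRM_natl u2; congr expR; field.
  rewrite distrC; apply: le_trans (dist_pow_le _ _ _) _.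
  - exact: cos_max.
  - by rewrite ger0_norm ?expR_ge0// expR_le1 oppr_le0 divr_ge0// sqr_ge0.
  apply: le_trans (ler_wpM2l (ler0n _ _) (cos_exp_dist u)) _.
  rewrite (_ : u ^+ 4 = (u ^+ 2) ^+ 2); last by ring.
  by rewrite u2 le_eqVlt; apply/orP; left; apply/eqP; field.
apply/cvgrPdist_le => e e0; move/cvgrPdist_le : C => /(_ e e0).
apply: filterS => n; rewrite sub0r normrN => H.
exact: le_trans (B n) (le_trans (ler_norm _) H).
Qed.

End cos_power.

Section cos_uniqueness.
Context {R : realType}.
Variables mu nu : {finite_measure set R -> \bar R}.
Hypothesis cosE : forall t th : R,
  (\int[mu]_x (1 + cos (t * x + th))%:E = \int[nu]_x (1 + cos (t * x + th))%:E)%E.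

Let mufin : (mu setT < +oo)%E.
Proof. exact: fin_num_fun_lty (fin_num_measure mu). Qed.

Let nufin : (nu setT < +oo)%E.
Proof. exact: fin_num_fun_lty (fin_num_measure nu). Qed.

Let K (F : R -> R) := agree mu nu F F.

Let eq_K F G : F =1 G -> K F -> K G.
Proof. by move=> FG; exact: eq_agree. Qed.

Let measurable_cos_affine (t th : R) : measurable_fun setT (fun x : R => cos (t * x + th)).
Proof.
apply: continuous_measurable_fun => x.
apply: continuous_comp; last exact: continuous_cos.
apply: (@cvgD _ R^o) => //; last exact: cvg_cst.
by apply: cvgM; [exact: cvg_cst|exact: cvg_id].
Qed.

Let K_onecos t th : K (fun x => 1 + cos (t * x + th)).
Proof.
have m1 : measurable_fun setT (fun x : R => 1 + cos (t * x + th)).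
  by apply: measurable_funD => //; exact: measurable_cos_affine.
split => //; exists 2; have b x : `|1 + cos (t * x + th)| <= 2.
  by have := cos_max (t * x + th); rewrite ler_norml => /andP[? ?]; rewrite ler_norml; lra.
by split.
Qed.

Let K_cos t th : K (fun x => cos (t * x + th)).
Proof.
have h1 := agree_scale mufin nufin (- 2^-1) (K_onecos 0 0).
apply: eq_agree (agree_add mufin nufin (K_onecos t th) h1) => x /=;
  by rewrite mul0r addr0 cos0; field.
Qed.

Let K_cos_pow t th N s ph : K (fun x => cos (s * x + ph) * cos (t * x + th) ^+ N).
Proof.
elim: N s ph => [|N IH] s ph.
  by apply: eq_agree (K_cos s ph) => x; rewrite expr0 mulr1.
have h1 := agree_scale mufin nufin 2^-1 (IH (s + t) (ph + th)).
have h2 := agree_scale mufin nufin 2^-1 (IH (s - t) (ph - th)).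
apply: eq_K (agree_add mufin nufin h1 h2) => x /=.
rewrite (_ : (s + t) * x + _ = (s * x + ph) + (t * x + th)); last by ring.
rewrite (_ : (s - t) * x + _ = (s * x + ph) - (t * x + th)); last by ring.
by rewrite cosD cosB exprS; set C := _ ^+ N; field.
Qed.

Let K_pdf (s c : R) : s != 0 -> K (fun x => normal_pdf x s c).
Proof.
move=> s0.
have KE : K (fun x => expR (- (((x - c) / s) ^+ 2 / 2))).
  pose F n x := cos (((x - c) / s) / Num.sqrt n.+1%:R) ^+ n.+1 : R.
  have b n x : `|F n x| <= 1 by rewrite normrX exprn_ile1// cos_max.
  apply: (agree_lim mufin nufin (F := F) (F' := F) (M := 1)) => //.
  - move=> n; pose t := (s * Num.sqrt n.+1%:R)^-1.
    apply: eq_K (K_cos_pow t (- c * t) n.+1 0 0) => x.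
    rewrite mul0r addr0 cos0 mul1r /F /t; congr (cos _ ^+ _).
    by rewrite invfM; ring.
  - by move=> x; exact: cos_pow_cvg.
  - by move=> x; exact: cos_pow_cvg.
have := agree_scale mufin nufin (normal_peak s) KE.
apply: eq_K => x; rewrite normal_pdfE// /normal_fun; congr (_ * expR _).
by rewrite -(mulr_natl (s ^+ 2)); field.
Qed.

Let leb := (@lebesgue_measure R).

Let mpdf (s : R) : s != 0 -> measurable_fun setT (fun z : R * R => normal_pdf z.1 s z.2).
Proof.
move=> s0; rewrite (_ : (fun _ => _) = (fun z => normal_pdf 0 s (z.2 - z.1))).
  apply: measurableT_comp; first exact: measurable_normal_pdf.
  exact: measurable_funB.
by apply/funext => z; rewrite !normal_pdfE// /normal_fun subr0.
Qed.

Let normal_prob_fin (x s : R) B : measurable B -> normal_prob x s B \is a fin_num.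
Proof. by move=> mB; exact: fin_num_measure. Qed.

Let normal_probE (x s : R) (B : set R) : measurable B ->
  (normal_prob x s B = \int[leb]_c (\1_B c * normal_pdf x s c)%:E)%E.
Proof.
move=> mB; rewrite /normal_prob integral_mkcond; apply: eq_integral => c _.
by rewrite patchE indicE; case: ifPn => _; rewrite ?mul1r ?mul0r.
Qed.

Let K_normal_prob (s : R) (B : set R) : s != 0 -> measurable B ->
  K (fun x => fine (normal_prob x s B)).
Proof.
move=> s0 mB.
pose F (z : R * R) : \bar R := (\1_B z.2 * normal_pdf z.1 s z.2)%:E.
have mF : measurable_fun setT F.
  apply/measurable_EFinP; apply: measurable_funM; last exact: mpdf.
  by apply: measurableT_comp => //; exact: measurable_indic.
have F0 z : (0 <= F z)%E by rewrite lee_fin mulr_ge0// normal_pdf_ge0.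
have mP : measurable_fun setT (fun x => normal_prob x s B : \bar R).
  rewrite (_ : (fun _ => _) = (fun x => \int[leb]_c F (x, c))%E).
    exact: (measurable_fun_fubini_tonelli_F (m2 := leb) F mF F0).
  by apply/funext => x; exact: normal_probE.
have mfP : measurable_fun setT (fun x => fine (normal_prob x s B)).
  exact: measurableT_comp.
have b x : `|fine (normal_prob x s B)| <= 1.
  rewrite ger0_norm ?fine_ge0//.
  have := probability_le1 (normal_prob x s) mB.
  by move=> h; rewrite -lee_fin fineK// normal_prob_fin.
split => //; first by exists 1.
have E (m : {finite_measure set R -> \bar R}) :
    (\int[m]_x (fine (normal_prob x s B))%:E =
    \int[leb]_c ((\1_B c)%:E * \int[m]_x (normal_pdf x s c)%:E))%E.
  transitivity (\int[m]_x \int[leb]_c F (x, c))%E.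
    by apply: eq_integral => x _; rewrite fineK ?normal_prob_fin// normal_probE.
  rewrite (fubini_tonelli (m1 := m) (m2 := leb) F)//; apply: eq_integral => c _.
  rewrite -ge0_integralZl//.
  - by apply/measurable_EFinP; exact: (measurable_fun_pair1 c (mpdf s0)).
  - by move=> x _; rewrite lee_fin normal_pdf_ge0.
rewrite !E; apply: eq_integral => c _; congr (_ * _)%E.
by have [] := K_pdf c s0.
Qed.

Let K_ray (a : R) : K (\1_(`[a, +oo[)).
Proof.
pose N (k : nat) : R := k.+1%:R.
have N0 k : 0 < N k by rewrite ltr0n.
pose s k := (N k ^+ 2)^-1.
have s0 k : s k != 0 by rewrite invr_eq0 expf_neq0// gt_eqF.
pose B k : set R := `[a - (N k)^-1, +oo[%classic.
have mB k : measurable (B k) by exact: measurable_itv.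
pose f k x := fine (normal_prob x (s k) (B k)).
have fb k x : 0 <= f k x <= 1.
  rewrite /f fine_ge0//=.
  have := probability_le1 (normal_prob x (s k)) (mB k).
  by move=> h; rewrite -lee_fin fineK//; exact: normal_prob_fin (mB k).
pose e k := expR (2^-1) * expR (- k%:R) : R.
have e0 : e k @[k --> \oo] --> (0 : R).
  rewrite -[X in _ --> X](mulr0 (expR 2^-1)); apply: cvgM; first exact: cvg_cst.
  exact: cvgn_expR.
have tse k : (N k ^+ 2) ^+ 2 * s k ^+ 2 / 2 = 2^-1 :> R.
  by rewrite -exprMn /s divff ?expf_neq0 ?gt_eqF// expr1n mul1r.
have fcvg x : f k x @[k --> \oo] --> (\1_(`[a, +oo[) x : R).
  rewrite indicE; have [ax|xa] := leP a x.
    rewrite mem_set; last by rewrite /= in_itv/= ax.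
    have low k : 1 - e k <= f k x.
      have cE : f k x = 1 - fine (normal_prob x (s k) (~` B k)).
        have -> : normal_prob x (s k) (~` B k) =
            (1 - (fine (normal_prob x (s k) (B k)))%:E)%E.
          rewrite fineK; last exact: normal_prob_fin (mB k).
          exact: (probability_setC (normal_prob x (s k)) (mB k)).
        by rewrite /f/= opprB addrC subrK.
      rewrite cE lerB//.
      have tl : (normal_prob x (s k) (~` B k) <=
          (expR ((- N k ^+ 2) ^+ 2 * s k ^+ 2 / 2 - N k))%:E)%E.
        apply: normal_prob_tail => //; first exact: measurableC.
        move=> c; rewrite /B/= in_itv/= andbT => /negP; rewrite -ltNge => ca.
        have h : (N k)^-1 <= x - c.
          by move: ca ax; generalize ((N k)^-1) => q ? ?; lra.
        have := ler_wpM2l (exprn_ge0 2 (ltW (N0 k))) h.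
        by rewrite expr2 mulfK ?gt_eqF// => /le_trans; apply; rewrite le_eqVlt; apply/orP; left; apply/eqP; ring.
      rewrite -lee_fin fineK; last first.
        exact: (normal_prob_fin x (s k) (measurableC (mB k))).
      apply: le_trans tl _; rewrite lee_fin sqrrN tse /e -expRD ler_expR lerD2l lerN2.
      by rewrite ler_nat.
    apply: (@squeeze_cvgr _ _ _ _ (fun k => 1 - e k) (cst 1)).
    - by apply: nearW => k; rewrite low; have /andP[_ ->] := fb k x.
    - rewrite -[X in _ --> X]subr0; apply: cvgB => //; exact: cvg_cst.
    - exact: cvg_cst.
  rewrite memNset/=; last by rewrite in_itv/= andbT; apply/negP; rewrite -ltNge.
  apply: (@squeeze_cvgr _ _ _ _ (cst 0) e) => //; last exact: cvg_cst.
  have ax0 : 0 < a - x by rewrite subr_gt0.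
  near=> k; have /andP[-> _] := fb k x => /=.
  have kl : 2 / (a - x) <= k%:R.
    by near: k; exact: nbhs_infty_ger.
  have kl2 : 1 <= N k * (a - x) - 1.
    move: kl; rewrite ler_pdivrMr// => kl.
    have -> : N k = k%:R + 1 by rewrite /N -natr1.
    by rewrite mulrDl mul1r; lra.
  have tl : (normal_prob x (s k) (B k) <=
      (expR ((N k ^+ 2) ^+ 2 * s k ^+ 2 / 2 - N k))%:E)%E.
    apply: normal_prob_tail => // c; rewrite /B/= in_itv/= andbT => ca.
    have h : a - x - (N k)^-1 <= c - x.
      by move: ca; generalize ((N k)^-1) => q ?; lra.
    have := ler_wpM2l (exprn_ge0 2 (ltW (N0 k))) h; apply: le_trans.
    have -> : N k ^+ 2 * (a - x - (N k)^-1) = N k * (N k * (a - x) - 1).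
      by rewrite !mulrBr mulr1 expr2 mulfK ?gt_eqF//; ring.
    by rewrite ler_peMr// ltW.
  rewrite -lee_fin fineK; last exact: normal_prob_fin (mB k).
  apply: le_trans tl _; rewrite lee_fin tse /e -expRD ler_expR lerD2l lerN2.
  by rewrite ler_nat.
apply: (agree_lim mufin nufin (F := f) (F' := f) (M := 1)) => //.
- by move=> k; exact: K_normal_prob.
- by move=> k x; have /andP[f0 f1] := fb k x; rewrite ger0_norm.
- by move=> k x; have /andP[f0 f1] := fb k x; rewrite ger0_norm.
Unshelve. all: end_near. Qed.

Lemma cos_uniqueness A : measurable A -> mu A = nu A.
Proof.
have rayE a : mu `[a, +oo[%classic = nu `[a, +oo[%classic.
  have [_ _ _] := K_ray a.
  by rewrite !integral_indic// !setIT.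
have KT : mu setT = nu setT.
  have [_ _ _] := K_cos 0 0.
  under eq_integral do rewrite mul0r addr0 cos0.
  under [in RHS]eq_integral do rewrite mul0r addr0 cos0.
  by rewrite !integral_cst// !mul1e.
pose G := [set A : set R | A = setT \/ exists x, A = `[x, +oo[%classic].
move=> mA; apply: (measure_unique G (fun=> setT)) => //.
- rewrite [LHS](RGenCInfty.measurableE R).
  apply/seteqP; split.
    apply: smallest_sub; first exact: smallest_sigma_algebra.
    by move=> B GB; apply: sub_sigma_algebra; right.
  apply: smallest_sub; first exact: smallest_sigma_algebra.
  move=> B [->|GB]; last by apply: sub_sigma_algebra.
  exact: (@measurableT _ (g_sigma_algebraType (@RGenCInfty.G R))).
- move=> B C [->|[x ->]] [->|[y ->]].
  + by left; rewrite setTI.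
  + by right; exists y; rewrite setTI.
  + by right; exists x; rewrite setIT.
  + right; exists (Num.max x y); apply/seteqP; split => z /=.
      by rewrite !in_itv/= !andbT ge_max => -[-> ->].
    by rewrite !in_itv/= !andbT ge_max => /andP[-> ->].
- by move=> _; left.
- by rewrite bigcup_const//; exists 0%N.
- by move=> B [->|[x ->]]; [exact: KT|exact: rayE].
Qed.

End cos_uniqueness.

Section as_finite.
Context d (T : measurableType d) (R : realType).
Variables (m : {measure set T -> \bar R}) (mfin : fin_num_fun m).

Definition as_finite of fin_num_fun m : set T -> \bar R := m.

HB.instance Definition _ := Measure.on (as_finite mfin).
HB.instance Definition _ := Measure_isFinite.Build _ _ _ (as_finite mfin) mfin.

End as_finite.

Section cramer_wold.
Context d d' (T : measurableType d) (T' : measurableType d') (R : realType).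
Variables (P : probability T R) (P' : probability T' R) (I : finType).
Variables (X : I -> T -> R) (X' : I -> T' -> R) (B : I -> set R).
Hypothesis mX : forall i, measurable_fun setT (X i).
Hypothesis mX' : forall i, measurable_fun setT (X' i).
Hypothesis mB : forall i, measurable (B i).
Hypothesis cosXE : forall (b : I -> R) (th : R),
  (\int[P]_w (1 + cos (\sum_i b i * X i w + th))%:E =
   \int[P']_w (1 + cos (\sum_i b i * X' i w + th))%:E)%E.

Let Pfin : (P setT < +oo)%E.
Proof. by rewrite probability_setT ltry. Qed.

Let P'fin : (P' setT < +oo)%E.
Proof. by rewrite probability_setT ltry. Qed.

Let lc (S : Type) (Z : I -> S -> R) (b : I -> R) (w : S) := \sum_i b i * Z i w.
Let box (S : Type) (Z : I -> S -> R) (s : seq I) (w : S) : R :=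
  \prod_(i <- s) \1_(B i) (Z i w).

Let box01 S (Z : I -> S -> R) s w : 0 <= box Z s w <= 1.
Proof.
rewrite /box; elim: s => [|i s /andP[h0 h1]]; first by rewrite big_nil ler01 lexx.
by rewrite big_cons mulr_ge0//= mulr_ile1// indicE; case: (_ \in _).
Qed.

Let mlc d0 (S : measurableType d0) (Z : I -> S -> R) b :
  (forall i, measurable_fun setT (Z i)) -> measurable_fun setT (lc Z b).
Proof.
by move=> mZ; apply: measurable_sum => i; apply: measurable_funM.
Qed.

Let mcos d0 (S : measurableType d0) (Z : I -> S -> R) b th :
  (forall i, measurable_fun setT (Z i)) ->
  measurable_fun setT (fun w => cos (lc Z b w + th)).
Proof.
move=> mZ; apply: measurableT_comp.
  by apply: continuous_measurable_fun; exact: continuous_cos.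
by apply: measurable_funD => //; exact: mlc.
Qed.

Let mbox d0 (S : measurableType d0) (Z : I -> S -> R) s :
  (forall i, measurable_fun setT (Z i)) -> measurable_fun setT (box Z s).
Proof.
by move=> mZ; apply: measurable_prod => i _; apply: measurableT_comp.
Qed.

Let lcD S (Z : I -> S -> R) b i t w :
  lc Z (fun l => b l + (l == i)%:R * t) w = lc Z b w + t * Z i w.
Proof.
rewrite /lc; under eq_bigr do rewrite mulrDl.
rewrite big_split/=; congr (_ + _); rewrite (bigD1 i)//= eqxx mul1r big1 ?addr0//.
by move=> l /negbTE ->; rewrite !mul0r.
Qed.

Let lc0 S (Z : I -> S -> R) w : lc Z (fun=> 0) w = 0.
Proof. by rewrite /lc big1// => i _; rewrite mul0r. Qed.

Let A s b th := agree P P' (fun w => box X s w * cos (lc X b w + th))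
                          (fun w => box X' s w * cos (lc X' b w + th)).

Let A_nil b th : A [::] b th.
Proof.
have onecos b0 th0 : agree P P' (fun w => 1 + cos (lc X b0 w + th0))
    (fun w => 1 + cos (lc X' b0 w + th0)).
  split; [by apply: measurable_funD => //; exact: mcos|
          by apply: measurable_funD => //; exact: mcos| |exact: cosXE].
  exists 2; have b2 u : `|1 + cos u| <= 2 :> R.
    by have := cos_max u; rewrite ler_norml => /andP[? ?]; rewrite ler_norml; lra.
  by split.
have h := agree_scale Pfin P'fin (- 2^-1) (onecos (fun=> 0) 0).
apply: eq_agree (agree_add Pfin P'fin (onecos b th) h) => w /=;
  by rewrite /box big_nil lc0 addr0 cos0; field.
Qed.

Let H (S : Type) (Z : I -> S -> R) s b th w : R := box Z s w * (1 + cos (lc Z b w + th)).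

Let H0 S (Z : I -> S -> R) s b th w : 0 <= H Z s b th w.
Proof.
have /andP[h0 _] := box01 Z s w; apply: mulr_ge0; first exact: h0.
by have := cos_geN1 (lc Z b w + th); lra.
Qed.

Let mH d0 (S : measurableType d0) (Z : I -> S -> R) s b th :
  (forall i, measurable_fun setT (Z i)) -> measurable_fun setT (H Z s b th).
Proof.
move=> mZ; apply: measurable_funM; first exact: mbox.
by apply: measurable_funD => //; exact: mcos.
Qed.

Let H2 S (Z : I -> S -> R) s b th w : `|H Z s b th w| <= 2.
Proof.
rewrite ger0_norm//; have /andP[h0 h1] := box01 Z s w.
rewrite /H -[leRHS]mul1r; apply: ler_pM => //.
by have := cos_le1 (lc Z b w + th); lra.
Qed.

Section slice.
Context d0 (S : measurableType d0) (Q : probability S R) (Z : I -> S -> R).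
Hypothesis mZ : forall i, measurable_fun setT (Z i).
Variables (i : I) (s : seq I) (b : I -> R) (th : R).

Let mHZ := mH s b th mZ.
Let HZ0 := H0 Z s b th.

Lemma slice_measure : exists m : {finite_measure set R -> \bar R},
  (forall f : R -> R, (forall x, 0 <= f x) -> measurable_fun setT f ->
   (\int[m]_x (f x)%:E = \int[Q]_w (f (Z i w) * H Z s b th w)%:E)%E) /\
  (forall C, measurable C -> m C = (\int[Q]_w (\1_C (Z i w) * H Z s b th w)%:E)%E).
Proof.
have [m0 m0E] : exists m0 : {measure set R -> \bar R},
    forall f : R -> \bar R, measurable_fun setT f -> (forall x, 0 <= f x)%E ->
      (\int[m0]_x f x = \int[dens Q HZ0 mHZ]_w f (Z i w))%E.
  unshelve refine (ex_intro _
    (pushforward (dens Q HZ0 mHZ) (Z i) : {measure set R -> \bar R}) _).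
    exact: mZ.
  by move=> f mf f0; rewrite ge0_integral_pushforward.
have m0E' (f : R -> R) : (forall x, 0 <= f x) -> measurable_fun setT f ->
    (\int[m0]_x (f x)%:E = \int[Q]_w (f (Z i w) * H Z s b th w)%:E)%E.
  move=> f0 mf; rewrite m0E//; last exact/measurable_EFinP.
  rewrite (@ge0_integral_density _ _ _ Q _ (H Z s b th))//.
    by move=> w; rewrite lee_fin.
  by apply/measurable_EFinP; exact: (measurableT_comp mf (mZ i)).
have m0C C : measurable C -> m0 C = (\int[Q]_w (\1_C (Z i w) * H Z s b th w)%:E)%E.
  move=> mC; rewrite -(m0E' \1_C)//.
  by rewrite integral_indic// setIT.
have fin0 : fin_num_fun m0.
  apply: lty_fin_num_fun; rewrite m0C//.
  have mm : measurable_fun setT (fun w => \1_setT (Z i w) * H Z s b th w).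
    by apply: measurable_funM => //; apply: measurableT_comp.
  have Qfin : (Q setT < +oo)%E by rewrite probability_setT ltry.
  apply: integral_fune_lt_pinfty => //.
  apply: (@integrable_bounded _ _ _ Q _ 2 Qfin mm) => w.
  by rewrite indicT mul1r H2.
by exists (as_finite fin0).
Qed.

End slice.

Let A_cons i s : (forall b th, A s b th) -> forall b th, A (i :: s) b th.
Proof.
move=> As.
have AH b th : agree P P' (H X (i :: s) b th) (H X' (i :: s) b th).
  have [m [mE mC]] := slice_measure P mX i s b th.
  have [m' [m'E m'C]] := slice_measure P' mX' i s b th.
  have U : forall C, measurable C -> m C = m' C.
    apply: cos_uniqueness => t ph.
    have oc0 (x : R) : 0 <= 1 + cos (t * x + ph) by have := cos_geN1 (t * x + ph); lra.
    have moc : measurable_fun setT (fun x : R => 1 + cos (t * x + ph)).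
      apply: measurable_funD => //; apply: measurableT_comp.
        by apply: continuous_measurable_fun; exact: continuous_cos.
      apply: measurable_funD => //; exact: measurable_funM.
    rewrite mE// m'E//.
    pose bt := fun l => b l + (l == i)%:R * t.
    pose bt' := fun l => b l + (l == i)%:R * (- t).
    pose b0 := fun l => 0 + (l == i)%:R * t.
    have h1 := agree_add Pfin P'fin (As (fun=> 0) 0) (As b0 ph).
    have h2 := agree_add Pfin P'fin h1 (As b th).
    have h3 := agree_add Pfin P'fin h2 (agree_scale Pfin P'fin 2^-1 (As bt (th + ph))).
    have [_ _ _] := agree_add Pfin P'fin h3 (agree_scale Pfin P'fin 2^-1 (As bt' (th - ph))).
    have id S (Z : I -> S -> R) w : box Z s w * cos (lc Z (fun=> 0) w + 0) +
        box Z s w * cos (lc Z b0 w + ph) + box Z s w * cos (lc Z b w + th) +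
        2^-1 * (box Z s w * cos (lc Z bt w + (th + ph))) +
        2^-1 * (box Z s w * cos (lc Z bt' w + (th - ph))) =
        (1 + cos (t * Z i w + ph)) * H Z s b th w.
      rewrite /bt /bt' /b0 !lcD lc0 !add0r cos0 /H.
      rewrite (_ : lc Z b w + t * Z i w + _ = (lc Z b w + th) + (t * Z i w + ph)); last by ring.
      rewrite (_ : lc Z b w + - t * Z i w + _ = (lc Z b w + th) - (t * Z i w + ph)); last by ring.
      by rewrite (cosD (lc Z b w + th)) (cosB (lc Z b w + th)); field.
    under eq_integral do rewrite id.
    by under [in X in _ = X -> _]eq_integral do rewrite id.
  split; [exact: mH|exact: mH|by exists 2; split => w; exact: H2|].
  have := U _ (mB i); rewrite mC// m'C//.
  have id S (Z : I -> S -> R) w : \1_(B i) (Z i w) * H Z s b th w = H Z (i :: s) b th w.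
    by rewrite /H /box big_cons mulrA.
  move=> E; transitivity (\int[P]_w (\1_(B i) (X i w) * H X s b th w)%:E)%E.
    by apply: eq_integral => w _; rewrite id.
  by rewrite E; apply: eq_integral => w _; rewrite id.
move=> b th.
have h := agree_scale Pfin P'fin (- 2^-1) (AH (fun=> 0) 0).
apply: eq_agree (agree_add Pfin P'fin (AH b th) h) => w /=;
  by rewrite /H lc0 addr0 cos0; field.
Qed.

Lemma cramer_wold : P (\bigcap_(i in [set: I]) (X i @^-1` B i)) =
  P' (\bigcap_(i in [set: I]) (X' i @^-1` B i)).
Proof.
have As s : forall b th, A s b th by elim: s => [|i s IH]; [exact: A_nil|exact: A_cons].
have [_ _ _] := As (index_enum I) (fun=> 0) 0.
have E d0 (S : measurableType d0) (Q : probability S R) (Z : I -> S -> R) :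
    (forall i, measurable_fun setT (Z i)) ->
    (\int[Q]_w (box Z (index_enum I) w * cos (lc Z (fun=> 0) w + 0))%:E =
    Q (\bigcap_(i in [set: I]) (Z i @^-1` B i)))%E.
  move=> mZ; have mC : measurable (\bigcap_(i in [set: I]) (Z i @^-1` B i)).
    apply: fin_bigcap_measurable => // i _.
    by rewrite -[X in measurable X]setTI; exact: mZ.
  rewrite -[X in _ = Q X]setIT -integral_indic//; apply: eq_integral => w _; congr EFin.
  rewrite lc0 addr0 cos0 mulr1 /box indicE.
  have [wC|wC] := boolP (w \in _).
    rewrite big1// => i _; rewrite indicE mem_set//.
    by move: wC; rewrite inE => /(_ i Logic.I).
  apply/eqP; apply/prodf_eq0.
  have [i Hi] : exists i, ~ B i (Z i w).
    by apply/existsNP => h; move/negP: wC; apply; rewrite inE => i _; exact: h.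
  by exists i => //; rewrite indicE memNset.
by rewrite !E.
Qed.

End cramer_wold.

(** * Moments of the Gaussian rows *)

Section tail_bounds.
Context d (T : measurableType d) (R : realType) (P : probability T R).

Lemma union_bound (I : finType) (A : I -> set T) (c : R) : 0 <= c ->
  (forall i, measurable (A i)) -> (forall i, (P (A i) <= c%:E)%E) ->
  (P (\bigcup_(i in [set: I]) A i) <= (#|I|%:R * c)%:E)%E.
Proof.
move=> c0 mA Ac.
suff H (s : seq I) : (P (\bigcup_(i in [set` s]) A i) <= ((size s)%:R * c)%:E)%E.
  have := H (enum I); rewrite -cardE; apply: le_trans.
  rewrite (_ : [set` enum I] = [set: I])//.
  by apply/seteqP; split => // i _ /=; rewrite mem_enum.
elim: s => [|i s IH].
  by rewrite set_nil bigcup_set0 measure0 mul0r.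
have -> : [set` i :: s] = i |` [set` s].
  apply/seteqP; split => x /=; rewrite in_cons; first by case/orP => [/eqP|]; [left|right].
  by case=> [->|->]; rewrite ?eqxx ?orbT.
rewrite bigcup_setU1; apply: le_trans (measureU2 _ _ _) _ => //.
  exact: fin_bigcup_measurable.
by rewrite /= -natr1 mulrDl mul1r addrC EFinD leeD.
Qed.

Lemma exp_markov (X : T -> R) (c M : R) : measurable_fun setT X ->
  (\int[P]_w (expR (X w))%:E <= M%:E)%E ->
  (P [set w | (c <= X w)%R] <= (expR (- c) * M)%:E)%E.
Proof.
move=> mX XM.
have mA : measurable [set w | (c <= X w)%R].
  rewrite -[X in measurable X]setTI; exact: measurable_fun_le.
have mE : measurable_fun setT (fun w => (expR (X w))%:E).
  by apply/measurable_EFinP; exact: measurableT_comp.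
rewrite -[X in P X]setIT -integral_indic//.
apply: (@le_trans _ _ (\int[P]_w ((expR (- c))%:E * (expR (X w))%:E))%E).
  apply: ge0_le_integral => //.
  - by apply/measurable_EFinP; exact: measurable_indic.
  - exact: emeasurable_funM.
  - move=> w _; rewrite -EFinM lee_fin indicE; have [|_] := boolP (w \in _).
      rewrite inE/= => cX; rewrite -expRD -[leLHS]expR0 ler_expR addrC subr_ge0//.
    by rewrite mulr_ge0 ?expR_ge0.
rewrite ge0_integralZl//; first by rewrite EFinM lee_wpmul2l.
Qed.

Lemma integral_normal_law (X : T -> R) (m s : R) (h : R -> \bar R) :
  measurable_fun setT X ->
  (forall B : set R, measurable B -> P (X @^-1` B) = normal_prob m s B) ->
  measurable_fun setT h -> (forall x, 0 <= h x)%E ->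
  (\int[P]_w h (X w) = \int[normal_prob m s]_x h x)%E.
Proof.
move=> mX PQ mh h0.
have mX' : measurable_fun setT (X : T -> measurableTypeR R) by exact: mX.
have mh' : measurable_fun setT (h : measurableTypeR R -> \bar R) by exact: mh.
rewrite -[LHS](ge0_integral_pushforward mX' P measurableT mh')//.
by apply: eq_measure_integral => B mB _; exact: PQ.
Qed.

End tail_bounds.

Section gsproj_measurable.
Context d (T : measurableType d) (R : realType).

Lemma measurable_invr0 (f : T -> R) : (forall w, 0 <= f w) ->
  measurable_fun setT f -> measurable_fun setT (fun w => (f w)^-1).
Proof.
move=> f0 mf; rewrite (_ : (fun _ => _) = (fun w => f w `^ (-1))).
  apply: (measurableT_comp (f := fun x : R => x `^ (-1))); last exact: mf.
  exact: measurable_powR.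
by apply/funext => w; rewrite powR_inv1.
Qed.

Lemma measurable_gsproj n k (A : T -> 'M[R]_(n, k)) (ks : seq 'I_k) :
  (forall i l, measurable_fun setT (fun w => A w i l)) ->
  forall i r, measurable_fun setT (fun w => gsproj [seq col l (A w) | l <- ks] i r).
Proof.
move=> mA; elim: ks => [|l ks IH] i r /=.
  by under eq_fun do rewrite mxE; exact: measurable_cst.
pose v w := col l (A w) - gsproj [seq col l (A w) | l <- ks] *m col l (A w).
have mv i0 : measurable_fun setT (fun w => v w i0 0).
  rewrite (_ : (fun _ => _) = (fun w => A w i0 l -
      \sum_q gsproj [seq col l (A w) | l <- ks] i0 q * A w q l)).
    apply: measurable_funB => //; apply: measurable_sum => q.
    exact: measurable_funM.
  apply/funext => w; rewrite !mxE; congr (_ - _).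
  by apply: eq_bigr => q _; rewrite mxE.
rewrite (_ : (fun _ => _) = (fun w => gsproj [seq col l (A w) | l <- ks] i r +
    (dotv (v w) (v w))^-1 * (v w i 0 * v w r 0))).
  apply: measurable_funD => //; apply: measurable_funM; last exact: measurable_funM.
  apply: measurable_invr0; first by move=> w; rewrite dotvv sqr_ge0.
  by apply: measurable_sum => q; exact: measurable_funM.
apply/funext => w; rewrite [LHS]mxE; congr (_ + _).
rewrite [LHS]mxE -/(v w); congr (_ * _).
by rewrite [LHS]mxE big_ord1 [_^T _ _]mxE.
Qed.

End gsproj_measurable.

Section model.
Context d (T : measurableType d) (R : realType) (P : probability T R).
Variables (n p : nat) (Y : T -> 'M[R]_(n, p)) (Sigma : 'M[R]_p).
Hypothesis mY : forall i j, measurable_fun setT (fun w => Y w i j).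
Hypothesis Spd : symmetric_pd Sigma.
Hypothesis Yindep : rows_independent P Y.
Hypothesis Ygauss : forall i, row_gaussian P Y i Sigma.

Definition lf (a : 'rV[R]_p) (i : 'I_n) (w : T) := \sum_k a 0 k * Y w i k.
Definition covf (a b : 'rV[R]_p) := (a *m Sigma *m b^T) 0 0.

Lemma lfE a i w : lf a i w = (a *m (row i (Y w))^T) 0 0.
Proof. by rewrite mxE; apply: eq_bigr => k _; rewrite !mxE. Qed.

Lemma lfD a b i w : lf (a + b) i w = lf a i w + lf b i w.
Proof. by rewrite !lfE mulmxDl mxE. Qed.

Lemma lfZ c a i w : lf (c *: a) i w = c * lf a i w.
Proof. by rewrite !lfE -scalemxAl mxE. Qed.

Lemma lf0 i w : lf 0 i w = 0.
Proof. by rewrite lfE mul0mx mxE. Qed.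

Lemma covfC a b : covf a b = covf b a.
Proof.
rewrite /covf; have -> : b *m Sigma *m a^T = (a *m Sigma *m b^T)^T.
  by rewrite !trmx_mul trmxK Spd.1 mulmxA.
by rewrite [RHS]mxE.
Qed.

Lemma covfDl a b c : covf (a + b) c = covf a c + covf b c.
Proof. by rewrite /covf !mulmxDl mxE. Qed.

Lemma covfZl t a b : covf (t *: a) b = t * covf a b.
Proof. by rewrite /covf -!scalemxAl mxE. Qed.

Lemma covf0l b : covf 0 b = 0.
Proof. by rewrite /covf !mul0mx mxE. Qed.

Lemma covf_gt0 a : a != 0 -> 0 < covf a a.
Proof. exact: Spd.2. Qed.

Lemma measurable_lf a i : measurable_fun setT (lf a i).
Proof. by apply: measurable_sum => k; exact: measurable_funM. Qed.

Lemma integral_lf a i (h : R -> \bar R) : a != 0 ->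
  measurable_fun setT h -> (forall x, 0 <= h x)%E ->
  (\int[P]_w h (lf a i w) = \int[normal_prob 0 (Num.sqrt (covf a a))]_x h x)%E.
Proof.
move=> a0 mh h0; apply: (@integral_normal_law _ _ _ P (lf a i)) => //.
  exact: measurable_lf.
move=> B mB; rewrite -(Ygauss i a0 mB); congr (P _).
by apply/seteqP; split => w /=; rewrite lfE.
Qed.

Lemma unit_neq0 a : covf a a = 1 -> a != 0.
Proof.
by move=> a1; apply/eqP => a0; move: a1; rewrite a0 covf0l => /eqP; rewrite eq_sym oner_eq0.
Qed.

Lemma integral_expR_lf a i t : covf a a = 1 ->
  (\int[P]_w (expR (t * lf a i w))%:E = (expR (t ^+ 2 / 2))%:E)%E.
Proof.
move=> a1; have mexp : measurable_fun setT (fun x : R => expR (t * x)).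
  by apply: measurableT_comp => //; exact: measurable_funM.
rewrite (@integral_lf a i (fun x => (expR (t * x))%:E)) ?unit_neq0//; last exact/measurable_EFinP.
rewrite a1 sqrtr1 integral_normal_prob//.
have := @integral_normal_exp R 0 1 t (oner_neq0 _).
rewrite expr1n mulr1 => <-; apply: eq_integral => x _.
by rewrite subr0.
Qed.

Lemma integral_expR_sqr_lf a i c : covf a a = 1 -> 2 * c < 1 ->
  (\int[P]_w (expR (c * lf a i w ^+ 2))%:E = ((Num.sqrt (1 - 2 * c))^-1)%:E)%E.
Proof.
move=> a1 c1; have mexp : measurable_fun setT (fun x : R => expR (c * x ^+ 2)).
  apply: measurableT_comp => //; apply: measurable_funM => //.
rewrite (@integral_lf a i (fun x => (expR (c * x ^+ 2))%:E)) ?unit_neq0//; last exact/measurable_EFinP.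
rewrite a1 sqrtr1 integral_normal_prob//.
exact: integral_normal_sqr.
Qed.

Let rowG (i : 'I_n) : set (set T) := [set A | exists (j : 'I_p) (B : set R),
  measurable B /\ A = (fun w => Y w i j) @^-1` B].

Lemma row_sigma_lf a i B : measurable B -> row_sigma Y i (lf a i @^-1` B).
Proof.
move=> mB.
have mYi k : measurable_fun setT ((fun w => Y w i k) : g_sigma_algebraType (rowG i) -> R).
  by move=> _ C mC; rewrite setTI; apply: sub_sigma_algebra; exists k, C.
have ml : measurable_fun setT (lf a i : g_sigma_algebraType (rowG i) -> R).
  by apply: measurable_sum => k; exact: measurable_funM.
by have := ml measurableT B mB; rewrite setTI.
Qed.

Lemma lf_indep (a : 'I_n -> 'rV[R]_p) (B : 'I_n -> set R) :
  (forall i, measurable (B i)) ->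
  P (\bigcap_(i in [set: 'I_n]) (lf (a i) i @^-1` B i)) =
  (\prod_(i < n) P (lf (a i) i @^-1` B i))%E.
Proof. by move=> mB; apply: Yindep => i; exact: row_sigma_lf. Qed.

Lemma integral_expR_dot (a : 'rV[R]_p) (u : 'I_n -> R) : covf a a = 1 ->
  (\int[P]_w (expR (\sum_i u i * lf a i w))%:E = (expR ((\sum_i u i ^+ 2) / 2))%:E)%E.
Proof.
move=> a1.
have mexp i : measurable_fun setT (fun x : R => expR (u i * x)).
  by apply: measurableT_comp => //; exact: measurable_funM.
have := indep_prod_integral (measurable_lf a) (lf_indep (fun=> a))
  (fun i x => expR_ge0 (u i * x)) mexp.
under eq_integral do rewrite -expR_sum.
move=> ->; under eq_bigr do rewrite integral_expR_lf//.
by rewrite prodEFin -expR_sum mulr_suml.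
Qed.

Lemma integral_expR_sumsq (a : 'rV[R]_p) (K : {set 'I_n}) c : covf a a = 1 -> 2 * c < 1 ->
  (\int[P]_w (expR (c * \sum_(i in K) lf a i w ^+ 2))%:E =
   ((Num.sqrt (1 - 2 * c))^-1 ^+ #|K|)%:E)%E.
Proof.
move=> a1 c1; pose ck i := if i \in K then c else 0.
have mexp i : measurable_fun setT (fun x : R => expR (ck i * x ^+ 2)).
  apply: measurableT_comp => //; apply: measurable_funM => //.
have := indep_prod_integral (measurable_lf a) (lf_indep (fun=> a))
  (fun i x => expR_ge0 (ck i * x ^+ 2)) mexp.
under eq_integral do rewrite -expR_sum.
have E w : \sum_i ck i * lf a i w ^+ 2 = c * \sum_(i in K) lf a i w ^+ 2.
  rewrite mulr_sumr [RHS]big_mkcond/=; apply: eq_bigr => i _.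
  by rewrite /ck; case: ifP; rewrite ?mul0r.
under eq_integral do rewrite E.
move=> ->; transitivity (\prod_(i < n) (if i \in K then (Num.sqrt (1 - 2 * c))^-1 else 1)%:E)%E.
  apply: eq_bigr => i _; rewrite integral_expR_sqr_lf// /ck; case: ifP => // _.
  by rewrite mulr0 subr0 sqrtr1 invr1.
by rewrite prodEFin -big_mkcond/= prodr_const.
Qed.

End model.

(** * Residuals conditionally on the design *)

Section residual_independence.
Context d (T : measurableType d) (R : realType) (P : probability T R).
Variables (n p : nat) (Y : T -> 'M[R]_(n, p)) (Sigma : 'M[R]_p).
Hypothesis mY : forall i j, measurable_fun setT (fun w => Y w i j).
Hypothesis Spd : symmetric_pd Sigma.
Hypothesis Yindep : rows_independent P Y.
Hypothesis Ygauss : forall i, row_gaussian P Y i Sigma.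
Variables (j : 'I_p) (a : 'rV[R]_p).
Hypothesis a1 : covf Sigma a a = 1.
Hypothesis aorth : forall b : 'rV[R]_p, b 0 j = 0 -> covf Sigma a b = 0.
Local Notation lf := (lf Y).
Local Notation covf := (covf Sigma).

Let mlf b i : measurable_fun setT (lf b i). Proof. exact: measurable_lf. Qed.

Let Xr i k w := if k == j then lf a i w else Y w i k.
Let Xr' i k (z : T * T) := if k == j then lf a i z.1 else Y z.2 i k.
Let off (c : 'I_p -> R) : 'rV[R]_p := \row_k (if k == j then 0 else c k).

Let mXr i k : measurable_fun setT (Xr i k).
Proof. by rewrite /Xr; case: eqP => _. Qed.

Let mXr' i k : measurable_fun setT (Xr' i k).
Proof.
rewrite /Xr'; case: eqP => _.
  exact: (measurableT_comp (mlf a i) measurable_fst).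
exact: (measurableT_comp (mY i k) measurable_snd).
Qed.

Let lin_split (c : 'I_p -> R) (u : R) (y : 'I_p -> R) :
  \sum_k c k * (if k == j then u else y k) = c j * u + \sum_k off c 0 k * y k.
Proof.
rewrite (bigD1 j)//= eqxx; congr (_ + _); rewrite [RHS](bigD1 j)//=.
rewrite mxE eqxx mul0r add0r; apply: eq_bigr => k kj.
by rewrite mxE (negbTE kj).
Qed.

Let sumXr i c w : \sum_k c k * Xr i k w = c j * lf a i w + lf (off c) i w.
Proof. exact: lin_split. Qed.

Let sumXr' i c z : \sum_k c k * Xr' i k z = c j * lf a i z.1 + lf (off c) i z.2.
Proof. exact: lin_split. Qed.

Let cosXrE i (c : 'I_p -> R) th :
  (\int[P]_w (1 + cos (\sum_k c k * Xr i k w + th))%:E =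
   \int[P \x P]_z (1 + cos (\sum_k c k * Xr' i k z + th))%:E)%E.
Proof.
pose h x : R := 1 + cos (x + th).
have h0 x : 0 <= h x by rewrite /h; have := cos_geN1 (x + th); lra.
have ch : continuous h.
  move=> x; apply: (@cvgD _ R^o); first exact: cvg_cst.
  apply: continuous_comp; last exact: continuous_cos.
  by apply: (@cvgD _ R^o); [exact: cvg_id|exact: cvg_cst].
have mh : measurable_fun setT h by exact: continuous_measurable_fun.
pose F (z : T * T) : \bar R := (h (c j * lf a i z.1 + lf (off c) i z.2))%:E.
have mF : measurable_fun setT F.
  apply/measurable_EFinP; apply: measurableT_comp => //; apply: measurable_funD.
    by apply: measurable_funM => //; exact: measurableT_comp.
  exact: measurableT_comp.
have F0 z : (0 <= F z)%E by rewrite lee_fin.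
transitivity (\int[P]_w \int[P]_w' F (w, w'))%E; last first.
  rewrite -(fubini_tonelli1 (m1 := P) (m2 := P) F mF F0).
  by apply: eq_integral => z _; rewrite /F /h sumXr'.
have [cj0|cj0] := eqVneq (c j) 0.
  rewrite (fubini_tonelli (m1 := P) (m2 := P) F mF F0); apply: eq_integral => w' _.
  have -> : (\int[P]_w F (w, w') = \int[P]_w (h (lf (off c) i w'))%:E)%E.
    by apply: eq_integral => w _; rewrite /F cj0 mul0r add0r.
  by rewrite integral_prob_cst sumXr cj0 mul0r add0r.
have [oc0|oc0] := eqVneq (off c) 0.
  apply: eq_integral => w _.
  have -> : (\int[P]_w' F (w, w') = \int[P]_w' (h (c j * lf a i w))%:E)%E.
    by apply: eq_integral => w' _; rewrite /F oc0 lf0 addr0.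
  by rewrite integral_prob_cst sumXr oc0 lf0 addr0.
have ca0 : c j *: a != 0 by rewrite scaler_eq0 negb_or cj0 (unit_neq0 a1).
have offj : off c 0 j = 0 by rewrite mxE eqxx.
have cov1 : covf (c j *: a) (c j *: a) = c j ^+ 2.
  by rewrite covfZl (covfC Spd) covfZl a1 mulr1 expr2.
have covS : covf (c j *: a + off c) (c j *: a + off c) = c j ^+ 2 + covf (off c) (off c).
  rewrite covfDl !(covfC Spd _ (c j *: a + off c)) !covfDl cov1.
  rewrite covfZl (covfC Spd (off c) (c j *: a)) covfZl aorth//; ring.
have vo : 0 < covf (off c) (off c) by exact: covf_gt0.
have vS : 0 < covf (c j *: a + off c) (c j *: a + off c).
  by rewrite covS ltr_wpDl// sqr_ge0.
have S0 : c j *: a + off c != 0.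
  by by apply/eqP => e; move: vS; rewrite e covf0l ltxx.
pose t := Num.sqrt (covf (off c) (off c)).
pose s := Num.sqrt (covf (c j *: a) (c j *: a)).
have t0 : t != 0 by rewrite gt_eqF// sqrtr_gt0.
have s0 : s != 0 by rewrite gt_eqF// sqrtr_gt0 cov1 exprn_even_gt0.
have mhx (x : R) : measurable_fun setT (fun y : R => h (x + y)).
  apply: (measurableT_comp mh); apply: measurable_funD.
    exact: measurable_cst.
  exact: measurable_id.
have mhE : measurable_fun setT (fun x => (h x)%:E) by exact/measurable_EFinP.
have mhxE (x : R) : measurable_fun setT (fun y : R => (h (x + y))%:E).
  exact/measurable_EFinP.
have hE0 x : (0 <= (h x)%:E)%E by rewrite lee_fin.
transitivity (\int[normal_prob 0 (Num.sqrt (s ^+ 2 + t ^+ 2))]_x (h x)%:E)%E.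
  transitivity (\int[P]_w (h (lf (c j *: a + off c) i w))%:E)%E.
    by apply: eq_integral => w _; rewrite sumXr lfD lfZ.
  have -> : s ^+ 2 + t ^+ 2 = covf (c j *: a + off c) (c j *: a + off c).
    by rewrite covS /s /t !sqr_sqrtr ?(ltW vo)// cov1 ?sqr_ge0.
  exact: (@integral_lf _ _ _ P n p Y Sigma mY Ygauss _ i (fun x => (h x)%:E) S0 mhE hE0).
rewrite -normal_convolution//.
pose G (z : R * R) : \bar R := (h (z.1 + z.2))%:E.
have mG : measurable_fun setT G.
  by apply/measurable_EFinP; apply: (measurableT_comp mh); exact: measurable_funD.
have G0 z : (0 <= G z)%E by rewrite lee_fin.
have mI := measurable_fun_fubini_tonelli_F (m2 := normal_prob 0 t) G mG G0.
rewrite -(@integral_lf _ _ _ P n p Y Sigma mY Ygauss _ i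
  (fun x => \int[normal_prob 0 t]_y (h (x + y))%:E)%E ca0 mI); last first.
  by move=> x; apply: integral_ge0 => y _; rewrite lee_fin.
apply: eq_integral => w _; rewrite lfZ.
exact: esym (@integral_lf _ _ _ P n p Y Sigma mY Ygauss _ i
  (fun y => (h (c j * lf a i w + y))%:E) oc0 (mhxE _) (fun=> hE0 _)).
Qed.

Let rect i (B : 'I_p -> set R) : set T :=
  \bigcap_(k in [set k | k != j]) ((fun w => Y w i k) @^-1` B k).

Let mpre (X : T -> R) B : measurable_fun setT X -> measurable B -> measurable (X @^-1` B).
Proof. by move=> mX mB; rewrite -[X in measurable X]setTI; exact: mX. Qed.

Let mrect i B : (forall k, measurable (B k)) -> measurable (rect i B).
Proof.
move=> mB; apply: fin_bigcap_measurable; first exact: finite_finset.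
by move=> k _; exact: mpre.
Qed.

Lemma residual_row_indep i (B0 : set R) (B : 'I_p -> set R) : measurable B0 ->
  (forall k, measurable (B k)) ->
  P (lf a i @^-1` B0 `&` rect i B) = (P (lf a i @^-1` B0) * P (rect i B))%E.
Proof.
move=> mB0 mB; pose B' k := if k == j then B0 else B k.
have mB' k : measurable (B' k) by rewrite /B'; case: ifP.
have := cramer_wold (mXr i) (mXr' i) mB' (cosXrE i).
have -> : \bigcap_(k in [set: 'I_p]) (Xr i k @^-1` B' k) = lf a i @^-1` B0 `&` rect i B.
  apply/seteqP; split => w.
    move=> H; split; first by have := H j I; rewrite /= /Xr /B' eqxx.
    by move=> k /= kj; have := H k I; rewrite /= /Xr /B' (negbTE kj).
  move=> [H1 H2] k _ /=; rewrite /Xr /B'; have [_|kj] := eqVneq k j; [exact: H1|exact: H2].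
have -> : \bigcap_(k in [set: 'I_p]) (Xr' i k @^-1` B' k) = (lf a i @^-1` B0) `*` rect i B.
  apply/seteqP; split => z.
    move=> H; split; first by have := H j I; rewrite /= /Xr' /B' eqxx.
    by move=> k /= kj; have := H k I; rewrite /= /Xr' /B' (negbTE kj).
  move=> [H1 H2] k _ /=; rewrite /Xr' /B'; have [_|kj] := eqVneq k j; [exact: H1|exact: H2].
move=> ->; rewrite /= product_measure1E//; [exact: mpre|exact: mrect].
Qed.

Definition residG : set (set T) := [set A | exists B : 'I_n -> set R,
  (forall i, measurable (B i)) /\ A = \bigcap_(i in [set: 'I_n]) (lf a i @^-1` B i)].

Definition designG : set (set T) := [set A | exists B : 'I_n -> 'I_p -> set R,
  (forall i k, measurable (B i k)) /\ A = \bigcap_(i in [set: 'I_n]) rect i (B i)].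

Let rowG (i : 'I_n) : set (set T) := [set A | exists (j : 'I_p) (B : set R),
  measurable B /\ A = (fun w => Y w i j) @^-1` B].

Let row_sigma_rect i B : (forall k, measurable (B k)) -> row_sigma Y i (rect i B).
Proof.
move=> mB; have : @measurable _ (g_sigma_algebraType (rowG i)) (rect i B).
  apply: fin_bigcap_measurable; first exact: finite_finset.
  by move=> k _; apply: sub_sigma_algebra; exists k, (B k).
by [].
Qed.

Let row_sigmaI i A B : row_sigma Y i A -> row_sigma Y i B -> row_sigma Y i (A `&` B).
Proof.
move=> mA mB; have : @measurable _ (g_sigma_algebraType (rowG i)) (A `&` B).
  exact: measurableI.
by [].
Qed.

Let indepG A B : residG A -> designG B -> P (A `&` B) = (P A * P B)%E.
Proof.
move=> [C [mC ->]] [D [mD ->]].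
rewrite (_ : _ `&` _ = \bigcap_(i in [set: 'I_n]) (lf a i @^-1` C i `&` rect i (D i))); last first.
  apply/seteqP; split => [w [H1 H2] i _|w H]; first by split; [exact: H1|exact: H2].
  by split => i _; have [] := H i I.
rewrite !Yindep.
- rewrite -big_split/=; apply: eq_bigr => i _; exact: residual_row_indep.
- by move=> i; exact: row_sigma_rect.
- by move=> i; exact: row_sigma_lf.
- by move=> i; apply: row_sigmaI; [exact: row_sigma_lf|exact: row_sigma_rect].
Qed.

Let residGm : residG `<=` measurable.
Proof.
by move=> _ [B [mB ->]]; apply: fin_bigcap_measurable => // i _; exact: mpre.
Qed.

Let designGm : designG `<=` measurable.
Proof.
by move=> _ [B [mB ->]]; apply: fin_bigcap_measurable => // i _; exact: mrect.
Qed.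

Let residGI : setI_closed residG.
Proof.
move=> _ _ [B [mB ->]] [C [mC ->]]; exists (fun i => B i `&` C i).
split=> [i|]; first exact: measurableI.
apply/seteqP; split => [w [H1 H2] i _|w H]; first by split; [exact: H1|exact: H2].
by split => i _; have [] := H i I.
Qed.

Let designGI : setI_closed designG.
Proof.
move=> _ _ [B [mB ->]] [C [mC ->]]; exists (fun i k => B i k `&` C i k).
split=> [i k|]; first exact: measurableI.
apply/seteqP; split => [w [H1 H2] i _ k kj|w H].
  by split; [exact: H1|exact: H2].
by split => i _ k kj; have [] := H i I k kj.
Qed.

Let residGT : residG setT.
Proof. by exists (fun=> setT); split => //; apply/seteqP; split. Qed.

Let designGT : designG setT.
Proof. by exists (fun _ _ => setT); split => //; apply/seteqP; split. Qed.

Lemma residual_freezing_le (F : g_sigma_algebraType residG * g_sigma_algebraType designG -> \bar R)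
    (M : R) :
  measurable_fun setT F -> (forall z, 0 <= F z)%E ->
  (forall w', \int[P]_w F (w, w') <= M%:E)%E -> (\int[P]_w F (w, w) <= M%:E)%E.
Proof. exact: ge0_freezing_le. Qed.

Lemma measurable_resid i :
  measurable_fun setT (lf a i : g_sigma_algebraType residG -> R).
Proof.
move=> _ B mB; rewrite setTI; apply: sub_sigma_algebra.
exists (fun k => if k == i then B else setT); split => [k|]; first by case: ifP.
apply/seteqP; split => [w H k _ /=|w H]; first by case: eqVneq => // ->.
by have := H i I; rewrite /= eqxx.
Qed.

Lemma measurable_design i k : k != j ->
  measurable_fun setT ((fun w => Y w i k) : g_sigma_algebraType designG -> R).
Proof.
move=> kj _ B mB; rewrite setTI; apply: sub_sigma_algebra.
exists (fun i0 k0 => if (i0 == i) && (k0 == k) then B else setT).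
split => [i0 k0|]; first by case: ifP.
apply/seteqP; split => [w H i0 _ k0 _ /=|w H].
  by case: ifP => // /andP[/eqP -> /eqP ->].
by have := H i I k kj; rewrite /= !eqxx.
Qed.

(* The weights [u] may depend on the design columns: conditionally on them the
   residual is still standard Gaussian. *)
Lemma residual_dot_tail (u : T -> 'I_n -> R) (t : R) : 0 < t ->
  (forall i, measurable_fun setT ((fun w => u w i) : g_sigma_algebraType designG -> R)) ->
  (forall w, \sum_i u w i ^+ 2 <= 1) ->
  (P [set w | (t <= \sum_i u w i * lf a i w)%R] <= (expR (- (t ^+ 2 / 2)))%:E)%E.
Proof.
move=> t0 mu u1.
have mu' i : measurable_fun setT (fun w => u w i).
  move=> _ B mB; have := mu i measurableT B mB; rewrite !setTI.
  by apply: smallest_sub => //; exact: sigma_algebra_measurable.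
have mX : measurable_fun setT (fun w => t * \sum_i u w i * lf a i w).
  apply: measurable_funM => //; apply: measurable_sum => i.
  by apply: measurable_funM.
have -> : [set w | (t <= \sum_i u w i * lf a i w)%R] =
          [set w | (t ^+ 2 <= t * \sum_i u w i * lf a i w)%R].
  by apply/seteqP; split => w /=; rewrite expr2 ler_pM2l.
apply: le_trans (@exp_markov _ _ _ P _ (t ^+ 2) (expR (t ^+ 2 / 2)) mX _) _; last first.
  by rewrite lee_fin -expRD ler_expR; lra.
pose F (z : g_sigma_algebraType residG * g_sigma_algebraType designG) : \bar R :=
  (expR (t * \sum_i u z.2 i * lf a i z.1))%:E.
have mF : measurable_fun setT F.
  apply/measurable_EFinP; apply: measurableT_comp => //.
  apply: measurable_funM => //; apply: measurable_sum => i; apply: measurable_funM.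
    exact: (measurableT_comp (mu i) measurable_snd).
  exact: (measurableT_comp (measurable_resid i) measurable_fst).
have F0 z : (0 <= F z)%E by rewrite lee_fin expR_ge0.
apply: (residual_freezing_le mF F0) => w'.
apply: (@le_trans _ _ (expR ((\sum_i (t * u w' i) ^+ 2) / 2))%:E).
  rewrite -(@integral_expR_dot _ _ _ P n p Y Sigma mY Yindep Ygauss a (fun i => t * u w' i) a1).
  rewrite le_eqVlt; apply/orP; left; apply/eqP.
  apply: eq_integral => w _; rewrite /F/= mulr_sumr; congr (expR _)%:E.
  by apply: eq_bigr => i _; rewrite mulrA.
rewrite lee_fin ler_expR ler_pM2r//.
under eq_bigr do rewrite exprMn.
by rewrite -mulr_sumr ler_piMr ?sqr_ge0.
Qed.

Let xv w : 'cV[R]_n := \col_i lf a i w.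

Let mdot u : measurable_fun setT (fun w => dotv u (xv w)).
Proof.
rewrite (_ : (fun _ => _) = (fun w => \sum_i u i 0 * lf a i w)).
  by apply: measurable_sum => i; exact: measurable_funM.
by apply/funext => w; apply: eq_bigr => i _; rewrite mxE.
Qed.

Let mquad (Q : 'M[R]_n) : measurable_fun setT (fun w => dotv (Q *m xv w) (xv w)).
Proof.
rewrite (_ : (fun _ => _) = (fun w => \sum_i (\sum_l Q i l * lf a l w) * lf a i w)).
  apply: measurable_sum => i; apply: measurable_funM => //.
  by apply: measurable_sum => l; exact: measurable_funM.
apply/funext => w; apply: eq_bigr => i _; rewrite !mxE; congr (_ * _).
by apply: eq_bigr => l _; rewrite mxE.
Qed.

(* One orthonormal direction v is removed at a time by writing
   exp(c r^2) = E exp(sqrt(2c) g r) for a standard Gaussian g. *)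
Lemma gsproj_moment (s : seq 'cV[R]_n) (c : R) (u : 'cV[R]_n) :
  0 <= c -> 2 * c < 1 -> gsproj s *m u = 0 ->
  (\int[P]_w (expR (dotv u (xv w) + c * dotv (gsproj s *m xv w) (xv w)))%:E <=
   ((Num.sqrt (1 - 2 * c))^-1 ^+ size s * expR (dotv u u / 2))%:E)%E.
Proof.
move=> c0 c1; set C := (Num.sqrt (1 - 2 * c))^-1.
have C0 : 0 <= C by rewrite invr_ge0 sqrtr_ge0.
elim: s u => [|b s IH] u Pu.
  rewrite /= expr0 mul1r.
  rewrite le_eqVlt; apply/orP; left; apply/eqP.
  have E : dotv u u = \sum_i u i 0 ^+ 2 by apply: eq_bigr => i _; rewrite expr2.
  rewrite E -(@integral_expR_dot _ _ _ P n p Y Sigma mY Yindep Ygauss a (fun i => u i 0) a1).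
  apply: eq_integral => w _; congr (expR _)%:E.
  rewrite mul0mx {2}/dotv big1 ?mulr0 ?addr0; last by move=> i _; rewrite mxE mul0r.
  by apply: eq_bigr => i _; rewrite mxE.
have [v [PE Pv vv _]] := gsproj_cons b (gsproj_sym s) (gsproj_idem s).
have PPu : gsproj s *m u = 0.
  have : gsproj s *m (gsproj (b :: s) *m u) = 0 by rewrite Pu mulmx0.
  by rewrite PE mulmxDl mulmxDr (mulmxA (gsproj s) (gsproj s)) gsproj_idem outer_mul -scalemxAr Pv scaler0 addr0.
have vu : dotv v u = 0.
  move: Pu; rewrite PE mulmxDl PPu add0r outer_mul => vu0.
  case: vv => [->|vv]; first by rewrite /dotv big1// => i _; rewrite mxE mul0r.
  have := congr1 (dotv v) vu0; rewrite dotvZr vv mulr1 => ->.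
  by rewrite /dotv big1// => i _; rewrite mxE mulr0.
have vv1 : dotv v v <= 1.
  by case: vv => [->|->//]; rewrite /dotv big1 ?ler01// => i _; rewrite mxE mul0r.
pose r w := dotv v (xv w); pose q := Num.sqrt (2 * c).
have q2 : q ^+ 2 = 2 * c by rewrite sqr_sqrtr// mulr_ge0.
pose leb := @lebesgue_measure R.
pose F (z : T * R) : \bar R := (expR (dotv u (xv z.1) +
  c * dotv (gsproj s *m xv z.1) (xv z.1) + q * z.2 * r z.1) * normal_pdf 0 1 z.2)%:E.
have mF : measurable_fun setT F.
  apply/measurable_EFinP; apply: measurable_funM; last first.
    by apply: measurableT_comp => //; exact: measurable_normal_pdf.
  apply: measurableT_comp => //; apply: measurable_funD; first apply: measurable_funD.
  - exact: (measurableT_comp (mdot u) measurable_fst).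
  - apply: measurable_funM => //.
    exact: (measurableT_comp (mquad (gsproj s)) measurable_fst).
  - apply: measurable_funM; first by apply: measurable_funM.
    exact: (measurableT_comp (mdot v) measurable_fst).
have F0 z : (0 <= F z)%E by rewrite lee_fin mulr_ge0 ?expR_ge0 ?normal_pdf_ge0.
have E1 w : (\int[leb]_g F (w, g) = (expR (dotv u (xv w) +
    c * dotv (gsproj (b :: s) *m xv w) (xv w)))%:E)%E.
  have -> : dotv (gsproj (b :: s) *m xv w) (xv w) =
      dotv (gsproj s *m xv w) (xv w) + r w ^+ 2.
    by rewrite PE mulmxDl dotvDl outer_mul dotvZl expr2.
  rewrite mulrDr addrA expRD EFinM.
  have := @integral_normal_exp R 0 1 (q * r w) (oner_neq0 _).
  rewrite expr1n mulr1 (_ : (q * r w) ^+ 2 / 2 = c * r w ^+ 2); last by rewrite exprMn q2; field.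
  move=> <-; rewrite -ge0_integralZl//.
  - apply: eq_integral => g _; rewrite /F/= -EFinM; congr EFin.
    by rewrite mulrA -expRD subr0; congr (expR _ * _); ring.
  - apply/measurable_EFinP; apply: measurable_funM; last exact: measurable_normal_pdf.
    apply: measurableT_comp => //; apply: measurable_funM => //.
    exact: measurable_funB.
  - by move=> g _; rewrite lee_fin mulr_ge0 ?expR_ge0 ?normal_pdf_ge0.
under eq_integral do rewrite -E1.
rewrite (fubini_tonelli (m1 := P) (m2 := leb) F mF F0).
pose K := C ^+ size s * expR (dotv u u / 2).
have K0 : 0 <= K by rewrite mulr_ge0 ?expR_ge0 ?exprn_ge0.
have mc : measurable_fun setT (fun g : R => expR (c * g ^+ 2) * normal_pdf 0 1 g).
  apply: measurable_funM; last exact: measurable_normal_pdf.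
  by apply: measurableT_comp => //; apply: measurable_funM.
apply: (@le_trans _ _ (\int[leb]_g (K%:E * (expR (c * g ^+ 2) * normal_pdf 0 1 g)%:E))%E).
  apply: ge0_le_integral => //.
  - by move=> g _; apply: integral_ge0 => w _; exact: F0.
  - exact: (measurable_fun_fubini_tonelli_G (m1 := P) F mF F0).
  - by apply/measurable_EFinP; exact: measurable_funM.
  - move=> g _.
    have mI : measurable_fun setT (fun w => (expR (dotv (u + (q * g) *: v) (xv w) +
        c * dotv (gsproj s *m xv w) (xv w)))%:E).
      apply/measurable_EFinP; apply: measurableT_comp => //.
      apply: measurable_funD; first exact: mdot.
      by apply: measurable_funM => //; exact: mquad.
    have -> : (\int[P]_w F (w, g) = (\int[P]_w (expR (dotv (u + (q * g) *: v) (xv w) +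
        c * dotv (gsproj s *m xv w) (xv w)))%:E) * (normal_pdf 0 1 g)%:E)%E.
      rewrite -ge0_integralZr; [|by []|exact: mI| |].
      - apply: eq_integral => w _; rewrite -EFinM; congr (_ * _)%:E.
        congr expR; rewrite dotvDl dotvZl -/(r w) /=; move: (dotv _ _) (dotv _ _) => x y.
        ring.
      - by move=> w _; rewrite lee_fin expR_ge0.
      - by rewrite lee_fin normal_pdf_ge0.
    rewrite [(expR (c * _) * _)%:E]EFinM muleA; apply: lee_wpmul2r; first by rewrite lee_fin normal_pdf_ge0.
    have Pg : gsproj s *m (u + (q * g) *: v) = 0.
      by rewrite mulmxDr PPu -scalemxAr Pv scaler0 addr0.
    apply: le_trans (IH _ Pg) _; rewrite -EFinM lee_fin /K -mulrA ler_wpM2l ?exprn_ge0//.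
    rewrite -expRD ler_expR.
    rewrite !(dotvDl, dotvDr, dotvZl, dotvZr) vu (dotvC u v) vu !mulr0 addr0 add0r.
    rewrite mulrDl lerD2l mulrA -expr2 exprMn q2.
    rewrite (_ : _ / 2 = c * g ^+ 2 * dotv v v); last by field.
    by rewrite ler_piMr// mulr_ge0 ?sqr_ge0.
rewrite ge0_integralZl//; last 2 first.
- exact/measurable_EFinP.
- by move=> g _; rewrite lee_fin mulr_ge0 ?expR_ge0 ?normal_pdf_ge0.
rewrite integral_normal_sqr// -EFinM lee_fin /K -/C exprS.
by rewrite mulrC mulrA.
Qed.

Lemma residual_quad_tail (A : T -> 'M[R]_(n, p.-1)) (ell : R) :
  (forall i l, measurable_fun setT ((fun w => A w i l) : g_sigma_algebraType designG -> R)) ->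
  (P [set w | (4 * ell <= dotv (gsproj [seq col l (A w) | l <- enum 'I_p.-1] *m xv w) (xv w))%R]
   <= (expR (- ell) * (Num.sqrt 2) ^+ p)%:E)%E.
Proof.
move=> mA; pose Q w := gsproj [seq col l (A w) | l <- enum 'I_p.-1].
have mQ := measurable_gsproj (enum 'I_p.-1) mA.
have mQ' i r : measurable_fun setT (fun w => Q w i r).
  move=> _ B mB; have := mQ i r measurableT B mB; rewrite !setTI.
  by apply: smallest_sub => //; exact: sigma_algebra_measurable.
have qE w w' : dotv (Q w' *m xv w) (xv w) = \sum_i (\sum_l Q w' i l * lf a l w) * lf a i w.
  apply: eq_bigr => i _; rewrite !mxE; congr (_ * _).
  by apply: eq_bigr => l _; rewrite mxE.
have mX : measurable_fun setT (fun w => 4^-1 * dotv (Q w *m xv w) (xv w)).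
  apply: measurable_funM => //; under eq_fun do rewrite qE.
  apply: measurable_sum => i; apply: measurable_funM => //.
  by apply: measurable_sum => l; exact: measurable_funM.
have -> : [set w | (4 * ell <= dotv (gsproj [seq col l (A w) | l <- enum 'I_p.-1] *m xv w) (xv w))%R]
  = [set w | (ell <= 4^-1 * dotv (Q w *m xv w) (xv w))%R].
  by apply/seteqP; split => w /=; rewrite -/(Q w) => h; lra.
apply: exp_markov => //.
pose F (z : g_sigma_algebraType residG * g_sigma_algebraType designG) : \bar R :=
  (expR (4^-1 * dotv (Q z.2 *m xv z.1) (xv z.1)))%:E.
have mF : measurable_fun setT F.
  apply/measurable_EFinP; apply: measurableT_comp => //; apply: measurable_funM => //.
  under eq_fun do rewrite qE.
  apply: measurable_sum => i; apply: measurable_funM; last first.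
    exact: (measurableT_comp (measurable_resid i) measurable_fst).
  apply: measurable_sum => l; apply: measurable_funM.
    exact: (measurableT_comp (mQ i l) measurable_snd).
  exact: (measurableT_comp (measurable_resid l) measurable_fst).
have F0 z : (0 <= F z)%E by rewrite lee_fin expR_ge0.
have s2 : 1 <= Num.sqrt 2 :> R by rewrite -[leLHS]sqrtr1 ler_wsqrtr// ler1n.
have c14 : 2 * 4^-1 < 1 :> R by lra.
apply: (residual_freezing_le mF F0) => w'.
have := @gsproj_moment [seq col l (A w') | l <- enum 'I_p.-1] 4^-1 0 _ c14 (mulmx0 _ _).
rewrite invr_ge0 ler0n => /(_ isT).
have d0 x : dotv 0 x = 0 :> R by rewrite /dotv big1// => i _; rewrite mxE mul0r.
move=> H; apply: (le_trans (le_trans _ H)).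
  rewrite le_eqVlt; apply/orP; left; apply/eqP.
  by apply: eq_integral => w _; rewrite d0 add0r.
rewrite d0 mul0r expR0 mulr1 size_map size_enum_ord lee_fin.
have -> : (Num.sqrt (1 - 2 * 4^-1))^-1 = Num.sqrt 2 :> R.
  rewrite -sqrtrV; last lra.
  by congr Num.sqrt; field.
exact: ler_weXn2l (leq_pred p).
Qed.

End residual_independence.

(** * The favourable event *)

Section numeric.
Context {R : realType}.

Lemma expR_double_ge (x a b : R) : 0 <= a -> a <= expR (x / 2) -> b <= a * a ->
  b <= expR x.
Proof.
move=> a0 ax ba; rewrite (_ : x = x / 2 + x / 2); last by field.
by rewrite expRD; apply: le_trans ba _; rewrite ler_pM.
Qed.

Lemma expR_68_le2 : expR (17 / 25) <= 2 :> R.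
Proof.
suff : 2^-1 <= expR (- (17 / 25)) :> R by rewrite expRN lef_pV2 ?posrE ?expR_gt0.
apply: (@expR_double_ge _ (7086 / 10000)); [lra| |lra].
apply: (@expR_double_ge _ (8418 / 10000)); [lra| |lra].
apply: (@expR_double_ge _ (9175 / 10000)); [lra| |lra].
apply: (@expR_double_ge _ (9579 / 10000)); [lra| |lra].
apply: (@expR_double_ge _ (783 / 800)); [lra| |lra].
apply: le_trans (expR_ge1Dx _); lra.
Qed.

Lemma expR_75_ge2 : 2 <= expR (3 / 4) :> R.
Proof.
apply: (@expR_double_ge _ (143 / 100)); [lra| |lra].
apply: (@expR_double_ge _ (299 / 250)); [lra| |lra].
apply: (@expR_double_ge _ (35 / 32)); [lra| |lra].
apply: le_trans (expR_ge1Dx _); lra.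
Qed.

Lemma natr_le_expR_half (p : nat) : p%:R <= expR (p%:R / 2) :> R.
Proof.
have -> : p%:R / 2 = p%:R / 4 + p%:R / 4 :> R by field.
rewrite expRD; have H := expR_ge1Dx (p%:R / 4 : R).
have p0 : 0 <= p%:R :> R by [].
apply: (@le_trans _ _ ((1 + p%:R / 4) * (1 + p%:R / 4))); last by apply: ler_pM => //; lra.
have := sqr_ge0 (1 - p%:R / 4 : R); nra.
Qed.

End numeric.

Section event_bounds.
Context d (T : measurableType d) (R : realType) (P : probability T R).
Variables (n p : nat) (Y : T -> 'M[R]_(n, p)) (Sigma : 'M[R]_p).
Hypothesis mY : forall i j, measurable_fun setT (fun w => Y w i j).
Hypothesis Spd : symmetric_pd Sigma.
Hypothesis Yindep : rows_independent P Y.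
Hypothesis Ygauss : forall i, row_gaussian P Y i Sigma.
Local Notation lf := (lf Y).
Local Notation covf := (covf Sigma).

Lemma measurable_geset (f : T -> R) (c : R) : measurable_fun setT f ->
  measurable [set w | c <= f w].
Proof.
move=> mf; rewrite -[X in measurable X]setTI.
by apply: measurable_fun_le => //; exact: measurable_cst.
Qed.

Lemma measurable_leset (f : T -> R) (c : R) : measurable_fun setT f ->
  measurable [set w | f w <= c].
Proof.
move=> mf; rewrite -[X in measurable X]setTI.
by apply: measurable_fun_le => //; exact: measurable_cst.
Qed.

Lemma measurable_sumsq_lf a (K : {set 'I_n}) :
  measurable_fun setT (fun w => \sum_(i in K) lf a i w ^+ 2).
Proof.
rewrite (_ : (fun _ => _) = (fun w => \sum_i (i \in K)%:R * lf a i w ^+ 2)).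
  apply: measurable_sum => i; apply: measurable_funM => //.
  by apply: measurable_funX; exact: measurable_lf.
apply/funext => w; rewrite big_mkcond/=; apply: eq_bigr => i _.
by case: (i \in K); rewrite ?mul1r ?mul0r.
Qed.

Lemma lf_tail a i t : covf a a = 1 -> 0 < t ->
  (P [set w | (t <= lf a i w)%R] <= (expR (- (t ^+ 2 / 2)))%:E)%E.
Proof.
move=> a1 t0.
have mX : measurable_fun setT (fun w => t * lf a i w).
  by apply: measurable_funM => //; exact: measurable_lf.
have -> : [set w | (t <= lf a i w)%R] = [set w | (t ^+ 2 <= t * lf a i w)%R].
  by apply/seteqP; split => w /=; rewrite expr2 ler_pM2l.
apply: le_trans (@exp_markov _ _ _ P _ (t ^+ 2) (expR (t ^+ 2 / 2)) mX _) _; last first.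
  by rewrite lee_fin -expRD ler_expR; lra.
by rewrite (integral_expR_lf mY Ygauss i t a1).
Qed.

Lemma sumsq_lower_tail a (K : {set 'I_n}) c x : covf a a = 1 -> 0 < c ->
  (P [set w | (\sum_(i in K) lf a i w ^+ 2 <= x)%R] <=
   (expR (c * x) * (Num.sqrt (1 + 2 * c))^-1 ^+ #|K|)%:E)%E.
Proof.
move=> a1 c0; have mX : measurable_fun setT (fun w => - c * \sum_(i in K) lf a i w ^+ 2).
  by apply: measurable_funM => //; exact: measurable_sumsq_lf.
have -> : [set w | (\sum_(i in K) lf a i w ^+ 2 <= x)%R] =
    [set w | (- (c * x) <= - c * \sum_(i in K) lf a i w ^+ 2)%R].
  by apply/seteqP; split => w /=; rewrite mulNr lerN2 ler_pM2l.
rewrite -[X in expR X]opprK; apply: exp_markov => //.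
rewrite (integral_expR_sumsq mY Yindep Ygauss K a1); last lra.
by rewrite mulrN opprK.
Qed.

Lemma sumsq_upper_tail a (K : {set 'I_n}) c x : covf a a = 1 -> 0 < c -> 2 * c < 1 ->
  (P [set w | (x <= \sum_(i in K) lf a i w ^+ 2)%R] <=
   (expR (- (c * x)) * (Num.sqrt (1 - 2 * c))^-1 ^+ #|K|)%:E)%E.
Proof.
move=> a1 c0 c1; have mX : measurable_fun setT (fun w => c * \sum_(i in K) lf a i w ^+ 2).
  by apply: measurable_funM => //; exact: measurable_sumsq_lf.
have -> : [set w | (x <= \sum_(i in K) lf a i w ^+ 2)%R] =
    [set w | (c * x <= c * \sum_(i in K) lf a i w ^+ 2)%R].
  by apply/seteqP; split => w /=; rewrite ler_pM2l.
apply: exp_markov => //.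
by rewrite (integral_expR_sumsq mY Yindep Ygauss K a1).
Qed.

End event_bounds.

Lemma gsproj_compl_row (R : realType) n (s : seq 'cV[R]_n) i :
  \sum_l ((1%:M - gsproj s) i l) ^+ 2 <= 1.
Proof.
set Q := gsproj s.
have E (A : 'M[R]_n) : A^T = A -> A *m A = A -> \sum_l A i l ^+ 2 = A i i.
  move=> As AA; rewrite -[in RHS]AA mxE; apply: eq_bigr => l _.
  by rewrite -{3}As mxE expr2.
have Qs : Q^T = Q := gsproj_sym s; have QQ : Q *m Q = Q := gsproj_idem s.
rewrite E; last 2 first.
- by rewrite linearB/= trmx1 Qs.
- by rewrite mulmxBl mul1mx mulmxBr mulmx1 QQ subrr subr0.
rewrite !mxE eqxx lerBlDr lerDl -(E Q)//; exact: sumsq_ge0.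
Qed.

Section good_event.
Context d (T : measurableType d) (R : realType) (P : probability T R).
Variables (n p : nat) (Y : T -> 'M[R]_(n, p)) (Sigma M : 'M[R]_p) (E : 'M[R]_(n, p)).
Variables (O : {set 'I_n}) (delta : R).
Hypotheses (n_gt0 : (0 < n)%N) (p_gt0 : (0 < p)%N).
Hypothesis mY : forall i j, measurable_fun setT (fun w => Y w i j).
Hypothesis Spd : symmetric_pd Sigma.
Hypothesis Yindep : rows_independent P Y.
Hypothesis Ygauss : forall i, row_gaussian P Y i Sigma.
Hypothesis Mwhite : M *m Sigma *m M^T = 1%:M.
Hypothesis delta01 : 0 < delta < 1.
Local Notation lf := (lf Y).
Local Notation covf := (covf Sigma).
Local Notation Omega := (invmx Sigma).
Let L := ln (2 * n%:R * p%:R / delta).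
Let ell := ln (4 / delta).
Let P0 := fun j w => gsproj [seq col l (col' j (Y w + E)) | l <- enum 'I_p.-1].

Definition resid_dir (j : 'I_p) : 'rV[R]_p :=
  (Num.sqrt (Omega j j))^-1 *: row j Omega.
Definition resid (j : 'I_p) (w : T) : 'cV[R]_n := \col_i lf (resid_dir j) i w.

Lemma Sigma_unit : Sigma \in unitmx.
Proof.
have M1 : M \in unitmx.
  by have /mulmx1_unit[] : M *m (Sigma *m M^T) = 1%:M by rewrite mulmxA.
have := unitmx1 R p; rewrite -Mwhite !unitmx_mul.
by case/andP=> /andP[].
Qed.

Lemma whitening_gram : M^T *m M = Omega.
Proof.
have M1 : M \in unitmx.
  by have /mulmx1_unit[] : M *m (Sigma *m M^T) = 1%:M by rewrite mulmxA.
have H : Sigma *m M^T *m M = 1%:M.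
  by apply: mulmx1C; rewrite mulmxA.
by rewrite -[LHS](mulKmx Sigma_unit) (mulmxA Sigma) H mulmx1.
Qed.

Lemma Omega_diag_gt0 j : 0 < Omega j j.
Proof.
have e0 : row j Omega != 0.
  apply/eqP => r0; have := congr1 (mulmx^~ Sigma) r0.
  rewrite -row_mul mulVmx ?Sigma_unit// mul0mx => /rowP/(_ j)/eqP.
  by rewrite !mxE eqxx oner_eq0.
have := Spd.2 _ e0; rewrite -row_mul mulVmx ?Sigma_unit//.
by rewrite mxE (bigD1 j)//= big1 ?addr0 => [|k kj]; rewrite !mxE ?eqxx ?mul1r// eq_sym (negbTE kj) mul0r.
Qed.

Lemma covf_resid_dir j b : covf (resid_dir j) b = (Num.sqrt (Omega j j))^-1 * b 0 j.
Proof.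
rewrite covfZl /covf -row_mul mulVmx ?Sigma_unit//; congr (_ * _).
rewrite mxE (bigD1 j)//= big1 ?addr0 => [|k kj]; rewrite !mxE ?eqxx ?mul1r//.
by rewrite eq_sym (negbTE kj) mul0r.
Qed.

Let a1 j : covf (resid_dir j) (resid_dir j) = 1.
Proof.
rewrite covf_resid_dir !mxE mulrA -invfM -expr2 sqr_sqrtr ?(ltW (Omega_diag_gt0 j))//.
by rewrite mulVf// gt_eqF// Omega_diag_gt0.
Qed.

Let aorth j (b : 'rV[R]_p) : b 0 j = 0 -> covf (resid_dir j) b = 0.
Proof. by move=> bj; rewrite covf_resid_dir bj mulr0. Qed.

Lemma covf_white (g : 'rV[R]_p) : covf (g *m M) (g *m M) = \sum_k g 0 k ^+ 2.
Proof.
rewrite /covf trmx_mul mulmxA -(mulmxA g) -(mulmxA g) Mwhite mulmx1 mxE.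
by apply: eq_bigr => k _; rewrite !mxE expr2.
Qed.

Let mdesign j i l : measurable_fun setT
  ((fun w => col' j (Y w + E) i l) : g_sigma_algebraType (designG Y j) -> R).
Proof.
rewrite (_ : (fun _ => _) = (fun w => Y w i (lift j l) + E i (lift j l))); last first.
  by apply/funext => w; rewrite !mxE.
apply: measurable_funD => //; apply: measurable_design.
by rewrite eq_sym neq_lift.
Qed.

Let mdesign' j i l : measurable_fun setT (fun w => col' j (Y w + E) i l).
Proof.
rewrite (_ : (fun _ => _) = (fun w => Y w i (lift j l) + E i (lift j l))); last first.
  by apply/funext => w; rewrite !mxE.
exact: measurable_funD.
Qed.

Let mP0 j i l : measurable_fun setT (fun w => P0 j w i l).
Proof. exact: measurable_gsproj. Qed.

Let delta0 : 0 < delta. Proof. by case/andP: delta01. Qed.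
Let n1 : 1 <= n%:R :> R. Proof. by rewrite ler1n. Qed.
Let p1 : 1 <= p%:R :> R. Proof. by rewrite ler1n. Qed.

Let arg_gt0 : 0 < 2 * n%:R * p%:R / delta.
Proof. by rewrite divr_gt0// !mulr_gt0// ltr0n. Qed.

Let L_gt0 : 0 < L.
Proof.
apply: ln_gt0; rewrite ltr_pdivlMr// mul1r.
case/andP: delta01 => _ d1; apply: lt_le_trans d1 _.
by rewrite -mulrA; have := ler_pM ler01 ler01 n1 p1; rewrite mulr1; lra.
Qed.

Let expNL : expR (- L) = delta / (2 * n%:R * p%:R).
Proof. by rewrite expRN lnK ?posrE// invf_div. Qed.

Let expNell : expR (- ell) = delta / 4.
Proof. by rewrite expRN lnK ?posrE ?divr_gt0// invf_div. Qed.

Let t := Num.sqrt (2 * L).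
Let t0 : 0 < t. Proof. by rewrite sqrtr_gt0 mulr_gt0. Qed.
Let t2 : t ^+ 2 / 2 = L.
Proof. by rewrite sqr_sqrtr ?mulr_ge0 ?(ltW L_gt0)//; field. Qed.

Let neqs := ('I_n * 'I_p * bool)%type.
Let card_neqs : #|{: neqs}|%:R * expR (- L) = delta :> R.
Proof.
rewrite /neqs !card_prod !card_ord card_bool expNL !natrM.
have n0 : n%:R != 0 :> R by rewrite pnatr_eq0 -lt0n.
have p0 : p%:R != 0 :> R by rewrite pnatr_eq0 -lt0n.
by field; rewrite n0 p0.
Qed.

Let sg (b : bool) : R := if b then 1 else -1.
Let sg2 b : sg b ^+ 2 = 1. Proof. by case: b; rewrite /sg ?sqrrN expr1n. Qed.

Let bigcupm (I : finType) (A : I -> set T) : (forall i, measurable (A i)) ->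
  measurable (\bigcup_(i in [set: I]) A i).
Proof. by move=> mA; apply: fin_bigcup_measurable => // i _; exact: mA. Qed.

Lemma numerator_event : exists B, [/\ measurable B, (P B <= delta%:E)%E &
  forall w, ~ B w -> forall i j, `|((1%:M - P0 j w) *m resid j w) i 0| <= t].
Proof.
pose A (q : neqs) : set T := [set w | t <= \sum_l (sg q.2 *
  (1%:M - P0 q.1.2 w) q.1.1 l) * lf (resid_dir q.1.2) l w].
have mA q : measurable (A q).
  apply: measurable_geset; apply: measurable_sum => l; apply: measurable_funM; last exact: measurable_lf.
  apply: measurable_funM => //; under eq_fun do rewrite 3!mxE.
  by apply: measurable_funB => //; exact: mP0.
exists (\bigcup_(q in [set: neqs]) A q); split; first exact: bigcupm.
  rewrite -[X in (_ <= X%:E)%E]card_neqs; apply: union_bound => //.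
  move=> [[i j] b]; rewrite -t2; apply: (@residual_dot_tail _ _ _ P n p Y Sigma mY Spd Yindep Ygauss j
    (resid_dir j) (a1 j) (@aorth j)  (fun w l => sg b * (1%:M - P0 j w) i l) t t0).
    move=> l; apply: measurable_funM => //; under eq_fun do rewrite 3!mxE.
    apply: measurable_funB => //; apply: measurable_gsproj; exact: mdesign.
  move=> w; under eq_bigr do rewrite exprMn sg2 mul1r.
  exact: gsproj_compl_row.
move=> w nB i j; rewrite ler_norml; apply/andP; split; rewrite leNgt; apply/negP => h; apply: nB.
  exists (i, j, false) => //=; rewrite /A/= /sg.
  move: h; rewrite mxE ltrNr => /ltW/le_trans; apply; rewrite -sumrN le_eqVlt; apply/orP; left.
  by apply/eqP/eq_bigr => l _; rewrite mulN1r mulNr; congr (- (_ * _)); rewrite mxE.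
exists (i, j, true) => //=; rewrite /A/= /sg.
move: h; rewrite mxE => /ltW/le_trans; apply; rewrite le_eqVlt; apply/orP; left.
by apply/eqP/eq_bigr => l _; rewrite mul1r; congr (_ * _); rewrite mxE.
Qed.

Lemma row_event : exists B, [/\ measurable B, (P B <= delta%:E)%E &
  forall w, ~ B w -> forall i k, `|lf (row k M) i w| <= t].
Proof.
pose A (q : neqs) : set T := [set w | t <= lf (sg q.2 *: row q.1.2 M) q.1.1 w].
have mA q : measurable (A q) by apply: measurable_geset; exact: measurable_lf.
exists (\bigcup_(q in [set: neqs]) A q); split; first exact: bigcupm.
  rewrite -[X in (_ <= X%:E)%E]card_neqs; apply: union_bound => //.
  move=> [[i k] b]; rewrite -t2; apply: (lf_tail mY Ygauss) => //=.
  rewrite covfZl (covfC Spd) covfZl mulrA -expr2 sg2 mul1r rowE covf_white.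
  rewrite (bigD1 k)//= big1 ?addr0 => [|l lk]; rewrite !mxE ?eqxx ?expr1n//.
  by rewrite (negbTE lk) expr0n.
move=> w nB i k; rewrite ler_norml; apply/andP; split; rewrite leNgt; apply/negP => h; apply: nB.
  by exists (i, k, false) => //=; rewrite /A/= /sg lfZ mulN1r lerNr ltW// ltrNr.
by exists (i, k, true) => //=; rewrite /A/= /sg lfZ mul1r ltW.
Qed.

Lemma proj_event : exists B, [/\ measurable B, (P B <= (delta / 4)%:E)%E &
  forall w, ~ B w -> forall j,
    dotv (P0 j w *m resid j w) (resid j w) <= 4 * (ell + ln p%:R + p%:R * (3 / 8))].
Proof.
pose c := ell + ln p%:R + p%:R * (3 / 8).
pose A (j : 'I_p) : set T := [set w | 4 * c <= dotv (P0 j w *m resid j w) (resid j w)].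
have mA j : measurable (A j).
  apply: measurable_geset.
  rewrite (_ : (fun _ => _) = (fun w => \sum_i (\sum_l P0 j w i l * lf (resid_dir j) l w) *
      lf (resid_dir j) i w)).
    apply: measurable_sum => i; apply: measurable_funM; last exact: measurable_lf.
    apply: measurable_sum => l; apply: measurable_funM; last exact: measurable_lf.
    exact: mP0.
  apply/funext => w; apply: eq_bigr => i _; rewrite !mxE; congr (_ * _).
  by apply: eq_bigr => l _; rewrite mxE.
exists (\bigcup_(q in [set: 'I_p]) A q); split; first exact: bigcupm.
  have p0 : 0 < p%:R :> R by rewrite ltr0n.
  have -> : delta / 4 = #|'I_p|%:R * (delta / 4 / p%:R).
    by rewrite card_ord; field; rewrite gt_eqF.
  apply: union_bound => //; first by rewrite !divr_ge0// ltW.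
  move=> j; apply: le_trans (residual_quad_tail mY Spd Yindep Ygauss (a1 j) (@aorth j) c (mdesign (j := j))) _.
  rewrite lee_fin /c !opprD !expRD expNell expRN lnK ?posrE//.
  rewrite -mulrA ler_piMr ?divr_ge0 ?(ltW delta0)//.
  have s2 : Num.sqrt 2 <= expR (3 / 8) :> R.
    apply: ler_sqr2; first exact: expR_ge0.
    rewrite sqr_sqrtr// expr2 -expRD (_ : _ + _ = 3 / 4); last by field.
    exact: expR_75_ge2.
  rewrite (_ : - (p%:R * (3 / 8)) = - (3 / 8) * p%:R :> R); last by ring.
  rewrite expRM_natr expRN exprVn mulrC ler_pdivrMr ?exprn_gt0 ?expR_gt0// mul1r.
  by rewrite lerXn2r ?nnegrE ?sqrtr_ge0 ?expR_ge0.
move=> w nB j; rewrite leNgt; apply/negP => h; apply: nB; exists j => //.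
exact: ltW.
Qed.

Let residE j w : vnorm2 (resid j w) ^+ 2 = \sum_(i in [set: 'I_n]%SET) lf (resid_dir j) i w ^+ 2.
Proof.
rewrite vnorm2_l2 l2_sqr [RHS]big_mkcond/=; apply: eq_bigr => i _.
by rewrite inE mxE.
Qed.

Let tail_arith (x : R) : p%:R / 2 + ell <= x -> expR (- x) <= delta / 4 / p%:R.
Proof.
have p0 : 0 < p%:R :> R by rewrite ltr0n.
move=> hx; rewrite ler_pdivlMr// -expNell.
apply: le_trans (_ : expR (- x) * expR (p%:R / 2) <= _).
  by rewrite ler_pM2l ?expR_gt0// natr_le_expR_half.
by rewrite -expRD ler_expR; lra.
Qed.

Let union_p (A : 'I_p -> set T) : (forall j, measurable (A j)) ->
  (forall j, (P (A j) <= (delta / 4 / p%:R)%:E)%E) ->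
  (P (\bigcup_(j in [set: 'I_p]) A j) <= (delta / 4)%:E)%E.
Proof.
have p0 : 0 < p%:R :> R by rewrite ltr0n.
move=> mA PA; rewrite (_ : delta / 4 = #|'I_p|%:R * (delta / 4 / p%:R)); last first.
  by rewrite card_ord; field; rewrite gt_eqF.
by apply: union_bound => //; rewrite !divr_ge0// ltW.
Qed.

Let ell_ge1 : 1 <= ell.
Proof.
rewrite -[leLHS](expRK 1) ler_ln ?posrE ?expR_gt0 ?divr_gt0//.
case/andP: delta01 => d0 d1.
apply: (@le_trans _ _ 4); last by rewrite ler_pdivlMr//; lra.
have h : expR 1 <= 2 ^+ 2 :> R.
  apply: (@le_trans _ _ (expR (17 / 25) ^+ 2)).
    by rewrite expr2 -expRD ler_expR; lra.
  by rewrite lerXn2r ?nnegrE ?expR_ge0// expR_68_le2.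
by apply: le_trans h _; rewrite expr2; lra.
Qed.

Lemma norm_lower_event : 8 * p%:R + 16 * ell <= n%:R ->
  exists B, [/\ measurable B, (P B <= (delta / 4)%:E)%E &
  forall w, ~ B w -> forall j, 41 / 100 * n%:R <= vnorm2 (resid j w) ^+ 2].
Proof.
move=> hn; pose A (j : 'I_p) : set T :=
  [set w | \sum_(i in [set: 'I_n]%SET) lf (resid_dir j) i w ^+ 2 <= 41 / 100 * n%:R].
have mA j : measurable (A j) by apply: measurable_leset; exact: measurable_sumsq_lf.
exists (\bigcup_(j in [set: 'I_p]) A j); split; first exact: bigcupm; last first.
  move=> w nB j; rewrite leNgt; apply/negP => h; apply: nB; exists j => //.
  by move: h => /ltW; rewrite residE.
apply: union_p => // j.
have c0 : 0 < 3 / 2 :> R by lra.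
apply: le_trans (sumsq_lower_tail mY Yindep Ygauss _ _ (a1 j) c0) _.
rewrite lee_fin cardsT card_ord.
have -> : 1 + 2 * (3 / 2) = 2 ^+ 2 :> R by rewrite expr2; field.
rewrite sqrtr_sqr ger0_norm//.
apply: (@le_trans _ _ (expR (3 / 2 * (41 / 100 * n%:R)) * expR (- (17 / 25)) ^+ n)).
  rewrite ler_pM2l ?expR_gt0// lerXn2r ?nnegrE ?expR_ge0 ?invr_ge0//.
  by rewrite expRN lef_pV2 ?posrE ?expR_gt0// expR_68_le2.
rewrite -expRM_natl -expRD.
rewrite (_ : _ + _ = - (13 / 200 * n%:R)); last by field.
apply: tail_arith; move: hn ell_ge1 p1; lra.
Qed.

Lemma norm_upper_event : 8 * p%:R + 16 * ell <= n%:R ->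
  exists B, [/\ measurable B, (P B <= (delta / 4)%:E)%E &
  forall w, ~ B w -> forall j, vnorm2 (resid j w) ^+ 2 <= 4 * n%:R].
Proof.
move=> hn; pose A (j : 'I_p) : set T :=
  [set w | 4 * n%:R <= \sum_(i in [set: 'I_n]%SET) lf (resid_dir j) i w ^+ 2].
have mA j : measurable (A j) by apply: measurable_geset; exact: measurable_sumsq_lf.
exists (\bigcup_(j in [set: 'I_p]) A j); split; first exact: bigcupm; last first.
  move=> w nB j; rewrite leNgt; apply/negP => h; apply: nB; exists j => //.
  by move: h => /ltW; rewrite residE.
apply: union_p => // j.
have c0 : 0 < 4^-1 :> R by [].
have c1 : 2 * 4^-1 < 1 :> R by lra.
apply: le_trans (sumsq_upper_tail mY Yindep Ygauss _ _ (a1 j) c0 c1) _.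
rewrite lee_fin cardsT card_ord.
have h : (Num.sqrt (1 - 2 * 4^-1))^-1 <= expR (3 / 8) :> R.
  rewrite -sqrtrV; last lra.
  apply: ler_sqr2; first exact: expR_ge0.
  rewrite sqr_sqrtr; last by rewrite invr_ge0; lra.
  rewrite expr2 -expRD (_ : 3 / 8 + _ = 3 / 4); last by field.
  by apply: le_trans expR_75_ge2; rewrite (_ : (1 - _)^-1 = 2)//; field.
apply: (@le_trans _ _ (expR (- (4^-1 * (4 * n%:R))) * expR (3 / 8) ^+ n)).
  by rewrite ler_pM2l ?expR_gt0// lerXn2r ?nnegrE ?expR_ge0 ?invr_ge0 ?sqrtr_ge0.
rewrite -expRM_natl -expRD.
rewrite (_ : _ + _ = - (5 / 8 * n%:R)); last by field.
apply: tail_arith; move: hn ell_ge1 p1; lra.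
Qed.

Let H := (100 * p * n)%N.
Let m := #|~: O|.
Let zrow (z : {ffun 'I_p -> 'I_(2 * H).+1}) : 'rV[R]_p := \row_k ((z k)%:R - H%:R).

Lemma net_event : 8 * p%:R + 16 * ell <= n%:R -> 520 * p%:R * L <= m%:R ->
  exists B, [/\ measurable B, (P B <= (delta / 4)%:E)%E &
  forall w, ~ B w -> forall z, (39 / 50) ^+ 2 * m%:R * \sum_k zrow z 0 k ^+ 2 <=
     \sum_(i in ~: O) lf (zrow z *m M) i w ^+ 2].
Proof.
move=> hn hm; pose N z := \sum_k zrow z 0 k ^+ 2.
have N0 z : 0 <= N z by exact: sumsq_ge0.
pose az z := (Num.sqrt (N z))^-1 *: (zrow z *m M).
pose A z : set T := if N z == 0 then set0 else
  [set w | \sum_(i in ~: O) lf (az z) i w ^+ 2 <= (39 / 50) ^+ 2 * m%:R].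
have mA z : measurable (A z).
  rewrite /A; case: ifP => _ //; apply: measurable_leset; exact: measurable_sumsq_lf.
exists (\bigcup_(z in [set: {ffun 'I_p -> 'I_(2 * H).+1}]) A z); split.
- exact: bigcupm.
- have c0 : 0 < 2^-1 :> R by [].
  have PA z : (P (A z) <= (expR (- (4 * p%:R * L)))%:E)%E.
    rewrite /A; case: eqVneq => [_|Nz]; first by rewrite measure0 lee_fin expR_ge0.
    have az1 : covf (az z) (az z) = 1.
      rewrite /az covfZl (covfC Spd) covfZl covf_white mulrA -invfM -expr2 sqr_sqrtr//.
      by rewrite mulVf.
    apply: le_trans (sumsq_lower_tail mY Yindep Ygauss _ _ az1 c0) _.
    rewrite lee_fin -/m mulfV// (_ : 1 + 1 = 2)//.
    have h : (Num.sqrt 2)^-1 <= expR (- (17 / 50)) :> R.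
      rewrite expRN lef_pV2 ?posrE ?expR_gt0 ?sqrtr_gt0//.
      apply: ler_sqr2; first exact: sqrtr_ge0.
      rewrite sqr_sqrtr// expr2 -expRD (_ : _ + _ = 17 / 25); last by field.
      exact: expR_68_le2.
    apply: (@le_trans _ _ (expR (2^-1 * ((39 / 50) ^+ 2 * m%:R)) * expR (- (17 / 50)) ^+ m)).
      by rewrite ler_pM2l ?expR_gt0// lerXn2r ?nnegrE ?expR_ge0 ?invr_ge0 ?sqrtr_ge0.
    rewrite -expRM_natl -expRD ler_expR; move: hm; rewrite expr2.
    have : 0 <= p%:R * L by rewrite mulr_ge0// ltW.
    rewrite -!mulrA; move: (p%:R * L) => q; move: (m%:R : R) => x; lra.
  apply: le_trans (union_bound _ mA PA) _; first exact: expR_ge0.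
  rewrite lee_fin card_ffun !card_ord natrX.
  have np8 : 8 <= n%:R * p%:R :> R.
    have : 8 <= n%:R :> R by move: hn p1 ell_ge1; lra.
    by move=> n8; rewrite -[leLHS]mulr1 ler_pM.
  have hH : (2 * H).+1%:R <= expR (3 * L) :> R.
    rewrite (expRM_natl 3 L) lnK ?posrE// -natr1 /H !natrM.
    rewrite -(mulrA 2 n%:R) -(mulrA 2 _ delta^-1) (_ : 2 * _ = 200 * (n%:R * p%:R)); last by ring.
    set x := n%:R * p%:R in np8 *.
    have hx : 2 * x <= 2 * (x / delta).
      rewrite ler_pM2l// ler_pdivlMr//; case/andP: delta01 => _ d1.
      by rewrite ler_piMr ?ltW//; lra.
    apply: (@le_trans _ _ ((2 * x) ^+ 3)); last first.
      by rewrite lerXn2r ?nnegrE//; lra.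
    rewrite !exprS expr0 mulr1; nra.
  apply: (@le_trans _ _ (expR (3 * L) ^+ p * expR (- (4 * p%:R * L)))).
    by rewrite ler_pM2r ?expR_gt0// lerXn2r ?nnegrE ?expR_ge0.
  rewrite -expRM_natl -expRD; apply: (@le_trans _ _ (expR (- L))).
    rewrite ler_expR; have : L <= p%:R * L by rewrite ler_peMl// ltW.
    lra.
  rewrite expNL ler_pM2l// lef_pV2 ?posrE ?mulr_gt0 ?ltr0n//; rewrite -mulrA; lra.
- move=> w nB z; rewrite -/(N z); have [->|Nz] := eqVneq (N z) 0.
    by rewrite mulr0; apply: sumr_ge0 => i _; exact: sqr_ge0.
  have -> : zrow z *m M = Num.sqrt (N z) *: az z.
    by rewrite /az scalerA divff ?scale1r// sqrtr_eq0 -ltNge lt_def Nz N0.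
  under eq_bigr do rewrite lfZ exprMn sqr_sqrtr//.
  rewrite -mulr_sumr mulrC ler_wpM2l// leNgt; apply/negP => h; apply: nB; exists z => //.
  by rewrite /A (negbTE Nz); exact: ltW.
Qed.

Let phi (w : T) (g : 'rV[R]_p) := l2 (fun i => (i \in ~: O)%:R * lf (g *m M) i w).

Let phi_sqr w g : phi w g ^+ 2 = \sum_(i in ~: O) lf (g *m M) i w ^+ 2.
Proof.
rewrite l2_sqr [RHS]big_mkcond/=; apply: eq_bigr => i _.
by case: (i \in _); rewrite ?mul1r// mul0r expr0n.
Qed.

Let phiD w g h : phi w (g + h) <= phi w g + phi w h.
Proof.
apply: le_trans (l2D _ _); rewrite le_eqVlt; apply/orP; left; apply/eqP.
by apply: eq_l2 => i; rewrite mulmxDl lfD mulrDr.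
Qed.

Let phiZ w c g : phi w (c *: g) = `|c| * phi w g.
Proof. by rewrite -l2Z; apply: eq_l2 => i; rewrite -scalemxAl lfZ mulrCA. Qed.

Let lf_mulM w (g : 'rV[R]_p) i : lf (g *m M) i w = \sum_k g 0 k * lf (row k M) i w.
Proof.
under [RHS]eq_bigr do rewrite mulr_sumr; rewrite exchange_big/=.
apply: eq_bigr => l _; rewrite mxE mulr_suml; apply: eq_bigr => k _.
by rewrite mxE mulrA.
Qed.

Let phi_le w (h : 'rV[R]_p) : (forall i k, `|lf (row k M) i w| <= t) ->
  (forall k, `|h 0 k| <= 1) -> phi w h <= Num.sqrt m%:R * (t * p%:R).
Proof.
move=> hr hh; apply: ler_sqr2.
  by rewrite !mulr_ge0 ?sqrtr_ge0 ?(ltW t0).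
rewrite phi_sqr exprMn sqr_sqrtr// /m.
apply: (@le_trans _ _ (\sum_(i in ~: O) (t * p%:R) ^+ 2)); last first.
  by rewrite sumr_const mulr_natl.
apply: ler_sum => i _; rewrite -real_normK ?num_real// lerXn2r ?nnegrE ?mulr_ge0 ?(ltW t0)//.
rewrite lf_mulM; apply: le_trans (ler_norm_sum _ _ _) _.
apply: (@le_trans _ _ (\sum_(k < p) t)); last by rewrite sumr_const card_ord mulr_natr.
by apply: ler_sum => k _; rewrite normrM -[leRHS]mul1r ler_pM.
Qed.

(* Every direction is within l-infinity distance 1 of a grid point once rescaled
   to length H, and the row bounds control the rounding error. *)
Lemma net_extension w : L <= n%:R -> (forall i k, `|lf (row k M) i w| <= t) ->
  (forall z, (39 / 50) ^+ 2 * m%:R * \sum_k zrow z 0 k ^+ 2 <=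
     \sum_(i in ~: O) lf (zrow z *m M) i w ^+ 2) ->
  forall g : 'rV[R]_p, (3 / 4) ^+ 2 * m%:R * \sum_k g 0 k ^+ 2 <=
     \sum_(i in ~: O) lf (g *m M) i w ^+ 2.
Proof.
move=> Ln hr hz g; rewrite -phi_sqr; set N := l2 (fun k => g 0 k).
have [N0|N0] := eqVneq N 0.
  by rewrite -l2_sqr -/N N0 expr0n mulr0 sqr_ge0.
have Ngt : 0 < N by rewrite lt_def N0 l2_ge0.
have Hp : 0 < H%:R :> R by rewrite ltr0n /H !muln_gt0 p_gt0 n_gt0.
have gN k : `|g 0 k| <= N.
  apply: ler_sqr2; first exact: ltW.
  rewrite real_normK ?num_real// /N l2_sqr (bigD1 k)//= lerDl.
  by apply: sumr_ge0 => l _; exact: sqr_ge0.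
have HN0 : 0 <= H%:R / N by rewrite divr_ge0// (ltW Ngt).
pose u := (H%:R / N) *: g.
have uH k : `|u 0 k| <= H%:R.
  rewrite mxE normrM (ger0_norm HN0) -mulrA ler_piMr//.
  by rewrite mulrC ler_pdivrMr// mul1r.
have uk0 k : 0 <= u 0 k + H%:R by move: (uH k); rewrite ler_norml => /andP[]; lra.
have tr k : (Num.trunc (u 0 k + H%:R)%R < (2 * H).+1)%N.
  rewrite truncn_lt_nat// -natr1 natrM.
  by move: (uH k); rewrite ler_norml => /andP[_]; lra.
pose z : {ffun 'I_p -> 'I_(2 * H).+1} := [ffun k => Ordinal (tr k)].
pose h := zrow z - u.
have h1 k : `|h 0 k| <= 1.
  rewrite !mxE ffunE/=; have /andP[] := truncn_itv (uk0 k).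
  rewrite -natr1 ler_norml mxE; set x := (Num.trunc _)%:R => h1 h2.
  by apply/andP; split; lra.
have zuh : zrow z = u + h by rewrite /h addrCA subrr addr0.
have l2u : l2 (fun k => u 0 k) = H%:R.
  rewrite (eq_l2 (g := fun k => (H%:R / N) * g 0 k)); last by move=> k; rewrite mxE.
  by rewrite l2Z -/N (ger0_norm HN0) divfK.
have l2h : l2 (fun k => h 0 k) <= p%:R.
  apply: ler_sqr2 => //; rewrite l2_sqr.
  apply: (@le_trans _ _ (\sum_(k < p) 1)).
    apply: ler_sum => k _; rewrite -real_normK ?num_real// -(expr1n _ 2).
    by rewrite lerXn2r ?nnegrE.
  by rewrite sumr_const card_ord expr2 -[leLHS]mul1r ler_wpM2r.
have l2z : H%:R - p%:R <= l2 (fun k => zrow z 0 k).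
  rewrite lerBlDr -l2u -lerBlDl.
  apply: le_trans l2h.
  rewrite lerBlDr addrC -[l2 (fun k => h 0 k)]l2N; apply: le_trans (l2D _ _).
  by rewrite le_eqVlt; apply/orP; left; apply/eqP/eq_l2 => k; rewrite zuh [in RHS]mxE addrK.
have s0 : 0 <= Num.sqrt m%:R :> R by exact: sqrtr_ge0.
have phiz : 39 / 50 * Num.sqrt m%:R * l2 (fun k => zrow z 0 k) <= phi w (zrow z).
  apply: ler_sqr2; first exact: l2_ge0.
  by rewrite phi_sqr !exprMn sqr_sqrtr// l2_sqr -exprMn.
have tL : t <= 1 + L.
  apply: ler_sqr2; first by rewrite addr_ge0// (ltW L_gt0).
  rewrite sqr_sqrtr ?mulr_ge0 ?(ltW L_gt0)//; have := sqr_ge0 L; rewrite sqrrD; lra.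
have phiu : 3 / 4 * Num.sqrt m%:R * H%:R <= phi w u.
  have H1 := phi_le hr h1; have H2 := phiD w u h; rewrite -zuh in H2.
  have HE : H%:R = 100 * (p%:R * n%:R) :> R by rewrite /H !natrM mulrA.
  have pn : p%:R <= p%:R * n%:R :> R by rewrite ler_peMr.
  have tp : t * p%:R <= 2 * (p%:R * n%:R).
    rewrite mulrC mulrCA ler_pM2l ?ltr0n//.
    apply: le_trans tL _; move: Ln n1; move: (n%:R : R) L => x y; lra.
  have H3 : 3 / 4 * H%:R <= 39 / 50 * (H%:R - p%:R) - t * p%:R by rewrite HE; lra.
  have H4 : Num.sqrt m%:R * (3 / 4 * H%:R) <=
    Num.sqrt m%:R * (39 / 50 * l2 (fun k => zrow z 0 k) - t * p%:R).
    by rewrite ler_wpM2l//; lra.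
  rewrite mulrBr in H4; rewrite -mulrA mulrCA; move: phiz; rewrite -mulrA mulrCA; lra.
have phig : phi w u = H%:R / N * phi w g by rewrite phiZ (ger0_norm HN0).
have : 3 / 4 * Num.sqrt m%:R * N <= phi w g.
  rewrite -(ler_pM2l (_ : 0 < H%:R / N)) ?divr_gt0// -phig; apply: le_trans phiu.
  by rewrite le_eqVlt; apply/orP; left; apply/eqP; field.
rewrite -(@ler_pXn2r _ 2) ?nnegrE ?l2_ge0 ?mulr_ge0 ?(ltW Ngt)//.
by rewrite -l2_sqr -/N !exprMn sqr_sqrtr.
Qed.

Let PU A B (x y : R) : measurable A -> measurable B -> (P A <= x%:E)%E -> (P B <= y%:E)%E ->
  (P (A `|` B) <= (x + y)%:E)%E.
Proof.
move=> mA mB Ax By; apply: le_trans (measureU2 _ mA mB) _.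
by rewrite EFinD; exact: leeD.
Qed.

Lemma good_event : 8 * p%:R + 16 * ell <= n%:R ->
  (O != finset.set0 -> 520 * p%:R * L <= #|~: O|%:R) ->
  exists Ev, [/\ measurable Ev, ((1 - 3 * delta)%:E <= P Ev)%E & forall w, Ev w ->
  [/\ forall i j, `|((1%:M - gsproj [seq col l (col' j (Y w + E)) | l <- enum 'I_p.-1])
                      *m resid j w) i 0| <= Num.sqrt (2 * L),
      forall i k, `|lf (row k M) i w| <= Num.sqrt (2 * L),
      forall j, dotv (gsproj [seq col l (col' j (Y w + E)) | l <- enum 'I_p.-1]
                      *m resid j w) (resid j w) <= 4 * (ell + ln p%:R + p%:R * (3 / 8)),
      forall j, 41 / 100 * n%:R <= vnorm2 (resid j w) ^+ 2 <= 4 * n%:R &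
      O != finset.set0 -> forall g : 'rV[R]_p,
        (3 / 4) ^+ 2 * #|~: O|%:R * \sum_k g 0 k ^+ 2 <=
        \sum_(i in ~: O) lf (g *m M) i w ^+ 2]].
Proof.
move=> hn hO.
have [B1 [mB1 PB1 H1]] := numerator_event.
have [B2 [mB2 PB2 H2]] := row_event.
have [B3 [mB3 PB3 H3]] := proj_event.
have [B4 [mB4 PB4 H4]] := norm_lower_event hn.
have [B5 [mB5 PB5 H5]] := norm_upper_event hn.
have [B6 [mB6 PB6 H6]] : exists B, [/\ measurable B, (P B <= (delta / 4)%:E)%E &
    forall w, ~ B w -> (forall i k, `|lf (row k M) i w| <= t) ->
    O != finset.set0 -> forall g : 'rV[R]_p,
        (3 / 4) ^+ 2 * #|~: O|%:R * \sum_k g 0 k ^+ 2 <=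
        \sum_(i in ~: O) lf (g *m M) i w ^+ 2].
  have [empO|empO] := eqVneq O finset.set0.
    by exists set0; split => //; rewrite measure0 lee_fin divr_ge0// ltW.
  have [B [mB PB HB]] := net_event hn (hO empO).
  exists B; split => // w nB hr _; apply: net_extension => //; last exact: HB.
  have mn : m%:R <= n%:R :> R.
    by rewrite ler_nat /m -[n in (_ <= n)%N]card_ord max_card.
  apply: le_trans mn; apply: le_trans (hO empO).
  by rewrite ler_peMl ?(ltW L_gt0)//; move: p1; lra.
pose B := B1 `|` (B2 `|` (B3 `|` (B4 `|` (B5 `|` B6)))).
have mB : measurable B by do ![apply: measurableU => //].
have PB : (P B <= (3 * delta)%:E)%E.
  rewrite (_ : 3 * delta = delta + (delta + (delta / 4 + (delta / 4 + (delta / 4 + delta / 4))))).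
    do 4![apply: PU => //; first by do ![apply: measurableU => //]].
    exact: PU.
  by field.
exists (~` B); split.
- exact: measurableC.
- by rewrite probability_setC// EFinB leeB.
move=> w nB.
have n1B : ~ B1 w by move=> h; apply: nB; left.
have n2B : ~ B2 w by move=> h; apply: nB; right; left.
have n3B : ~ B3 w by move=> h; apply: nB; do 2!right; left.
have n4B : ~ B4 w by move=> h; apply: nB; do 3!right; left.
have n5B : ~ B5 w by move=> h; apply: nB; do 4!right; left.
have n6B : ~ B6 w by move=> h; apply: nB; do 5!right.
split.
- exact: H1.
- exact: H2.
- exact: H3.
- by move=> j; rewrite H4//= H5.
- exact: H6 n6B (H2 _ n2B).
Qed.

End good_event.

(** * Error bounds on the favourable event *)

Lemma BstarE (R : realType) p (Om : 'M[R]_p) i j : (forall k, Om k k != 0) ->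
  Bstar Om i j = Om i j / Om j j.
Proof.
move=> Om0; rewrite /Bstar; set D := diag_mx _.
pose D' : 'M[R]_p := diag_mx (\row_k (Om k k)^-1).
have DD : D *m D' = 1%:M.
  rewrite mulmx_diag -diag_const_mx; congr diag_mx.
  by apply/rowP => k; rewrite !mxE divff.
have [uD _] := mulmx1_unit DD.
have -> : invmx D = D' by rewrite -[LHS]mulmx1 -DD mulKmx.
by rewrite mul_mx_diag !mxE.
Qed.

Lemma projection_budget (R : realType) (o m n p L ell lnp pL opL : R) :
  0 < L -> 520 * opL <= m -> o + m = n -> 1 <= o -> ell <= L -> lnp <= L -> L <= pL -> p <= pL ->
  pL <= opL -> 4 * (ell + lnp + p * (3 / 8)) <= (41 / 100 - 35 / 100) * n.
Proof. lra. Qed.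

Section deterministic.
Context (R : realType).
Variables (n p : nat) (Y : 'M[R]_(n, p)) (Sigma M : 'M[R]_p) (E : 'M[R]_(n, p)).
Variables (O : {set 'I_n}) (ME delta : R).
Hypotheses (n_gt0 : (0 < n)%N) (p_gt0 : (0 < p)%N).
Hypothesis Spd : symmetric_pd Sigma.
Hypothesis Mwhite : M *m Sigma *m M^T = 1%:M.
Hypothesis EO : forall i, i \notin O -> forall j, E i j = 0.
Local Notation Omega := (invmx Sigma).
Hypothesis Esize : forall i,
  Num.sqrt ((row i E *m Omega *m (row i E)^T) 0 0) <= ME * Num.sqrt p%:R.
Hypothesis delta01 : 0 < delta < 1.
Let L := ln (2 * n%:R * p%:R / delta).
Let ell := ln (4 / delta).
Hypothesis hn : #|O|%:R + 8 * p%:R + 16 * ell <= n%:R.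
Hypothesis hbig : 40 * #|O|%:R * p%:R * (13 * L + 2 * (1 + ME) ^+ 2) <= n%:R - #|O|%:R.
Let X := Y + E.
Variable Zs : 'I_p -> 'M[R]_n.
Hypothesis hZ : forall j, orth_proj_compl (Zs j) (col' j X).
Let s := (Num.sqrt n%:R)^-1 : R.
Let Xn := s *: X.
Let Ths := s *: (E *m Bstar Omega).
Let lambda := 6 * Num.sqrt (p%:R * L / n%:R).
Variable Thhat : 'M[R]_(n, p).
Hypothesis hopt : forall Th, robust_obj Zs Xn lambda Thhat <= robust_obj Zs Xn lambda Th.
Let x j : 'cV[R]_n := \col_i \sum_k resid_dir Sigma j 0 k * Y i k.
Hypothesis hnum : forall i j, `|(Zs j *m x j) i 0| <= Num.sqrt (2 * L).
Hypothesis hrow : forall i k, `|\sum_l row k M 0 l * Y i l| <= Num.sqrt (2 * L).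
Hypothesis hproj : forall j,
  dotv ((1%:M - Zs j) *m x j) (x j) <= 4 * (ell + ln p%:R + p%:R * (3 / 8)).
Hypothesis hnorm : forall j, 41 / 100 * n%:R <= vnorm2 (x j) ^+ 2 <= 4 * n%:R.
Hypothesis hnet : O != finset.set0 -> forall g : 'rV[R]_p,
  (3 / 4) ^+ 2 * #|~: O|%:R * \sum_k g 0 k ^+ 2 <=
  \sum_(i in ~: O) (\sum_l (g *m M) 0 l * Y i l) ^+ 2.

Let Omdiag j : 0 < Omega j j. Proof. exact: Omega_diag_gt0 Spd Mwhite j. Qed.
Let sig j := (Num.sqrt (Omega j j))^-1.
Let sig_gt0 j : 0 < sig j. Proof. by rewrite invr_gt0 sqrtr_gt0. Qed.
Let n0 : 0 < n%:R :> R. Proof. by rewrite ltr0n. Qed.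
Let p0 : 0 < p%:R :> R. Proof. by rewrite ltr0n. Qed.
Let p1 : 1 <= p%:R :> R. Proof. by rewrite ler1n. Qed.
Let s_gt0 : 0 < s. Proof. by rewrite invr_gt0 sqrtr_gt0. Qed.

Let OmegaT : Omega^T = Omega. Proof. by rewrite trmx_inv Spd.1. Qed.

Let Bjj j : Bstar Omega j j = 1.
Proof. by rewrite BstarE ?divff ?gt_eqF// => k; rewrite gt_eqF. Qed.

Let ell_ge : 34 / 25 <= ell.
Proof.
case/andP: delta01 => d0 d1.
rewrite -[leLHS]expRK ler_ln ?posrE ?expR_gt0 ?divr_gt0//.
apply: (@le_trans _ _ 4); last by rewrite ler_pdivlMr//; lra.
have h := @expR_68_le2 R.
rewrite (_ : 34 / 25 = 17 / 25 + 17 / 25); last by field.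
by rewrite expRD (_ : 4 = 2 * 2) ?ler_pM ?expR_ge0//; lra.
Qed.

Let n8 : 8 <= n%:R :> R.
Proof. move: hn ell_ge p1 (ler0n R #|O|); lra. Qed.

Let np2 : 2 <= n%:R * p%:R :> R.
Proof. by rewrite -[leLHS]mulr1 ler_pM//; move: n8; lra. Qed.

Let ell_le_L : ell <= L.
Proof.
case/andP: delta01 => d0 d1.
rewrite ler_ln ?posrE ?divr_gt0 ?mulr_gt0// ler_pM2r ?invr_gt0//.
by move: np2; rewrite -mulrA; lra.
Qed.

Let lnp_le_L : ln p%:R <= L.
Proof.
case/andP: delta01 => d0 d1.
rewrite ler_ln ?posrE ?divr_gt0 ?mulr_gt0// ler_pdivlMr//.
apply: (@le_trans _ _ p%:R); first by rewrite ler_piMr// ltW.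
by rewrite ler_peMl ?ltW//; move: n8; lra.
Qed.

Let lnp_le : ln p%:R <= p%:R / 4 + 1 / 2 :> R.
Proof.
rewrite -[leRHS]expRK ler_ln ?posrE ?expR_gt0//.
rewrite (_ : _ + _ = (p%:R / 4 - 1) + (3 / 4 + 3 / 4)); last by field.
rewrite expRD [expR (3 / 4 + _)]expRD; have h2 := @expR_75_ge2 R.
have h1 : p%:R / 4 <= expR (p%:R / 4 - 1) :> R.
  by apply: le_trans (expR_ge1Dx _); lra.
have h4 : 4 <= expR (3 / 4) * expR (3 / 4) :> R.
  by apply: (@le_trans _ _ (2 * 2)); [lra|rewrite ler_pM].
apply: (@le_trans _ _ (p%:R / 4 * 4)); first lra.
by rewrite ler_pM// divr_ge0// ltW.
Qed.

Let L_gt0 : 0 < L. Proof. by apply: lt_le_trans ell_le_L; move: ell_ge; lra. Qed.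

Let lambda_gt0 : 0 < lambda.
Proof. by rewrite mulr_gt0// sqrtr_gt0 divr_gt0// mulr_gt0. Qed.

Let lambda2 : lambda ^+ 2 = 36 * (p%:R * L / n%:R).
Proof.
rewrite exprMn sqr_sqrtr; first by congr (_ * _); rewrite expr2; ring.
by rewrite divr_ge0 ?mulr_ge0 ?ltW.
Qed.

Let Zsym j : (Zs j)^T = Zs j. Proof. by case: (hZ j). Qed.
Let Zid j : Zs j *m Zs j = Zs j. Proof. by case: (hZ j) => _ []. Qed.

Let ZX j k : k != j -> Zs j *m col k Xn = 0.
Proof.
move=> kj; case: (unliftP j k) => [l ->|kE]; last by rewrite kE eqxx in kj.
have -> : col (lift j l) Xn = s *: col l (col' j X).
  by apply/colP => i; rewrite !mxE.
by rewrite -scalemxAr colE mulmxA (orth_proj_compl0 (hZ j)) mul0mx scaler0.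
Qed.

Let ThsO i : i \notin O -> forall j, Ths i j = 0.
Proof.
by move=> iO j; rewrite !mxE big1 ?mulr0// => k _; rewrite EO// mul0r.
Qed.

Let xi := Xn *m Bstar Omega - Ths.

Let xiE j : col j xi = (s * sig j) *: x j.
Proof.
have -> : xi = s *: (Y *m Bstar Omega).
  by rewrite /xi /Xn /Ths -scalemxAl mulmxDl -scalerBr addrK.
apply/colP => i; rewrite !mxE -mulrA; congr (_ * _); rewrite mulr_sumr; apply: eq_bigr => k _.
rewrite BstarE; last by move=> l; rewrite gt_eqF.
have Okj : Omega k j = Omega j k by rewrite -{1}OmegaT mxE.
rewrite !mxE -/(sig j) Okj.
have -> : (Omega j j)^-1 = sig j * sig j.
  by rewrite /sig -invfM -expr2 sqr_sqrtr// ltW.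
ring.
Qed.

Let b j := vnorm2 (Zs j *m col j xi).

Let bE j : b j = s * sig j * vnorm2 (Zs j *m x j).
Proof.
by rewrite /b xiE -scalemxAr vnorm2Z ger0_norm// mulr_ge0 ?ltW.
Qed.

Let Zx_ge kappa : 4 * (ell + ln p%:R + p%:R * (3 / 8)) <= (41 / 100 - kappa) * n%:R ->
  forall j, kappa * n%:R <= vnorm2 (Zs j *m x j) ^+ 2.
Proof.
move=> hk j; have := proj_pythagoras (Zsym j) (Zid j) (x j).
have -> : vnorm2 ((1%:M - Zs j) *m x j) ^+ 2 = dotv ((1%:M - Zs j) *m x j) (x j).
  rewrite -dotvv dot_proj//; first by rewrite linearB/= trmx1 Zsym.
  by rewrite mulmxBl mul1mx mulmxBr mulmx1 Zid subrr subr0.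
have := hproj j; have /andP[] := hnorm j; move: hk; rewrite mulrBl; lra.
Qed.

Let b_gt0 kappa : 0 < kappa ->
  4 * (ell + ln p%:R + p%:R * (3 / 8)) <= (41 / 100 - kappa) * n%:R -> forall j, 0 < b j.
Proof.
move=> k0 hk j; rewrite bE !mulr_gt0// lt_def vnorm2_ge0 andbT.
apply/eqP => h; have := Zx_ge hk j; rewrite h expr0n leNgt mulr_gt0//.
Qed.

Let Vle kappa c : 0 < kappa ->
  4 * (ell + ln p%:R + p%:R * (3 / 8)) <= (41 / 100 - kappa) * n%:R ->
  2 <= 36 * c ^+ 2 * kappa ->
  forall i, \sum_j ((Zs j *m col j xi) i 0 / b j) ^+ 2 <= (c * lambda) ^+ 2.
Proof.
move=> k0 hk hc i; have kn : 0 < kappa * n%:R by rewrite mulr_gt0.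
apply: (@le_trans _ _ (\sum_(j < p) (2 * L / (kappa * n%:R)))).
  apply: ler_sum => j _.
  have Zg := Zx_ge hk j.
  have Zp : 0 < vnorm2 (Zs j *m x j) ^+ 2 by exact: lt_le_trans Zg.
  have -> : (Zs j *m col j xi) i 0 / b j = (Zs j *m x j) i 0 / vnorm2 (Zs j *m x j).
    rewrite bE xiE -scalemxAr [in LHS]mxE.
    have ss : s * sig j != 0 by rewrite mulf_neq0// gt_eqF.
    by rewrite -mulf_div divff// mul1r.
  rewrite exprMn exprVn ler_pM ?sqr_ge0 ?invr_ge0 ?sqr_ge0//.
    rewrite -[leRHS]sqr_sqrtr ?mulr_ge0 ?(ltW L_gt0)//.
    by rewrite -real_normK ?num_real// lerXn2r ?nnegrE ?sqrtr_ge0.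
  by rewrite lef_pV2 ?posrE.
rewrite sumr_const card_ord -[leLHS]mulr_natl exprMn lambda2.
have -> : p%:R * (2 * L / (kappa * n%:R)) = 2 / kappa * (p%:R * L / n%:R).
  by field; rewrite !gt_eqF.
have -> : c ^+ 2 * (36 * (p%:R * L / n%:R)) = 36 * c ^+ 2 * (p%:R * L / n%:R) by ring.
rewrite ler_pM2r ?divr_gt0 ?mulr_gt0// ler_pdivrMr//.
Qed.

Let Delta := Thhat - Ths.
Let S_O := \sum_(i in O) l2 (Delta i).
Let S_Oc := \sum_(i in ~: O) l2 (Delta i).

Let norm21E : norm21 Delta = S_O + S_Oc.
Proof.
rewrite /norm21 (bigID (fun i => i \in O))/=; congr (_ + _).
by apply: eq_bigl => i; rewrite inE.
Qed.

Let norm11_le : norm11 Delta <= Num.sqrt p%:R * norm21 Delta.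
Proof.
rewrite /norm11 /norm21 mulr_sumr; apply: ler_sum => i _.
have := sum_le_sqrt_card [set: 'I_p]%SET (fun j => `|Delta i j|).
rewrite cardsT card_ord; congr (_ <= _ * _); first by apply: eq_bigl => j; rewrite inE.
by congr Num.sqrt; apply: eq_bigr => j _; rewrite real_normK ?num_real.
Qed.

Lemma no_outlier_exact : O = finset.set0 -> Delta = 0.
Proof.
move=> empO; have SO0 : S_O = 0 by rewrite /S_O empO big_set0.
have hk : 4 * (ell + ln p%:R + p%:R * (3 / 8)) <= (41 / 100 - 6 / 100) * n%:R :> R.
  by move: hn lnp_le ell_ge p1; rewrite empO cards0; lra.
have hc : 2 <= 36 * (97 / 100) ^+ 2 * (6 / 100) :> R by rewrite expr2; lra.
have k0 : 0 < 6 / 100 :> R by lra.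
have c0 : 0 <= 97 / 100 :> R by lra.
have := cone_condition Zsym Zid ZX Bjj (ltW lambda_gt0) ThsO hopt (b_gt0 k0 hk) c0
  (Vle k0 hk hc) lambda_gt0.
rewrite -/Delta -/S_O -/S_Oc SO0 mulr0 => h.
have Sc0 : S_Oc = 0.
  apply/eqP; rewrite eq_le; apply/andP; split; first lra.
  by apply: sumr_ge0 => i _; exact: l2_ge0.
apply/matrixP => i j; rewrite [RHS]mxE; move: Sc0 => /eqP; rewrite psumr_eq0; last first.
  by move=> l _; exact: l2_ge0.
move=> /allP/(_ i (mem_index_enum i)); rewrite empO !inE/= => /eqP/l2_eq0; exact.
Qed.

Section outliers.
Hypothesis O_neq0 : O != finset.set0.
Let o : R := #|O|%:R.
Let m : R := #|~: O|%:R.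
Let N := norm22 Delta.
Let z j := vnorm2 (Zs j *m col j Delta).
Let Q := l2 z.
Let tt := Num.sqrt (o * p%:R * L / n%:R).
Let sigmax := max_inv_sqrt_diag Omega.

Let o1 : 1 <= o. Proof. by rewrite ler1n card_gt0. Qed.

Let o0 : 0 < o. Proof. exact: lt_le_trans ltr01 o1. Qed.

Let om : o + m = n%:R.
Proof. by rewrite -natrD cardsC card_ord. Qed.

Let ME_ge0 : 0 <= ME.
Proof.
have := le_trans (sqrtr_ge0 _) (Esize (Ordinal n_gt0)).
by rewrite pmulr_lge0// sqrtr_gt0.
Qed.

Let K := 13 * L + 2 * (1 + ME) ^+ 2.
Let K_ge : 13 * L <= K. Proof. by rewrite lerDl mulr_ge0 ?sqr_ge0. Qed.
Let mK : 40 * (o * p%:R * K) <= m.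
Proof. by move: hbig; rewrite -/o -/K -om addrAC subrr add0r !mulrA. Qed.

Let op_ge1 : p%:R <= o * p%:R :> R. Proof. by rewrite ler_peMl ?(ltW p0). Qed.

Lemma inlier_count_ge : 520 * (o * p%:R * L) <= m.
Proof.
apply: le_trans mK; rewrite (_ : 520 * _ = 40 * (o * p%:R * (13 * L))); last by ring.
by rewrite ler_pM2l// ler_wpM2l// mulr_ge0// ltW.
Qed.

Let m_gt0 : 0 < m.
Proof. apply: lt_le_trans inlier_count_ge; apply: mulr_gt0; first by rewrite ltr0n.
by rewrite !mulr_gt0. Qed.

Let hk : 4 * (ell + ln p%:R + p%:R * (3 / 8)) <= (41 / 100 - 35 / 100) * n%:R :> R.
Proof.
have h1 : L <= p%:R * L by rewrite ler_peMl// ltW.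
have h2 : p%:R <= p%:R * L.
  by rewrite ler_peMr ?ltW//; move: ell_ge ell_le_L; lra.
have h3 : p%:R * L <= o * p%:R * L by rewrite ler_wpM2r ?(ltW L_gt0).
exact: projection_budget L_gt0 inlier_count_ge om o1 ell_le_L lnp_le_L h1 h2 h3.
Qed.

Let k0 : 0 < 35 / 100 :> R. Proof. lra. Qed.
Let hc : 2 <= 36 * (2 / 5) ^+ 2 * (35 / 100) :> R. Proof. by rewrite expr2; lra. Qed.
Let c0 : 0 <= 2 / 5 :> R. Proof. lra. Qed.
Let bpos := b_gt0 k0 hk.

Let SOc_ge0 : 0 <= S_Oc. Proof. by apply: sumr_ge0 => i _; exact: l2_ge0. Qed.

Let cone : S_Oc <= 7 / 3 * S_O.
Proof.
have := cone_condition Zsym Zid ZX Bjj (ltW lambda_gt0) ThsO hopt bpos c0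
  (Vle k0 hk hc) lambda_gt0.
rewrite -/Delta -/S_O -/S_Oc; lra.
Qed.

Let N_sqr : N ^+ 2 = \sum_i \sum_j Delta i j ^+ 2.
Proof.
rewrite sqr_sqrtr//; apply: sumr_ge0 => i _; exact: sumsq_ge0.
Qed.

Let N_ge0 : 0 <= N. Proof. exact: sqrtr_ge0. Qed.

Let NE : N = l2 (fun i => l2 (Delta i)).
Proof. by congr Num.sqrt; apply: eq_bigr => i _; rewrite l2_sqr. Qed.

Let SO_le : S_O <= Num.sqrt o * N.
Proof. by rewrite NE; exact: sum_le_sqrt_card. Qed.

Let norm21_le : norm21 Delta <= 10 / 3 * (Num.sqrt o * N).
Proof. by rewrite norm21E; move: SO_le cone; lra. Qed.

Let N_col : N ^+ 2 = \sum_j vnorm2 (col j Delta) ^+ 2.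
Proof.
rewrite N_sqr exchange_big/=; apply: eq_bigr => j _.
by rewrite vnorm2_l2 l2_sqr; apply: eq_bigr => i _; rewrite [in RHS]mxE.
Qed.

Let D2 := \sum_j vnorm2 ((1%:M - Zs j) *m col j Delta) ^+ 2.
Let NQD : N ^+ 2 = Q ^+ 2 + D2.
Proof.
rewrite N_col l2_sqr -big_split/=; apply: eq_bigr => j _.
exact: proj_pythagoras.
Qed.

Let W := X *m M^T.
Let rho := Num.sqrt p%:R * (Num.sqrt (2 * L) + ME).

Let W_row i : l2 (W i) <= rho.
Proof.
have -> : l2 (W i) = l2 (fun k => \sum_l row k M 0 l * Y i l + \sum_l row k M 0 l * E i l).
  apply: eq_l2 => k; rewrite mxE -big_split/=; apply: eq_bigr => l _.
  by rewrite !mxE; ring.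
apply: le_trans (l2D _ _) _; rewrite /rho mulrDr; apply: lerD.
  apply: ler_sqr2; first by rewrite mulr_ge0 ?sqrtr_ge0.
  rewrite l2_sqr exprMn (sqr_sqrtr (ltW p0)).
  apply: (@le_trans _ _ (\sum_(k < p) Num.sqrt (2 * L) ^+ 2)); last first.
    by rewrite sumr_const card_ord -[leLHS]mulr_natl.
  apply: ler_sum => k _; rewrite -real_normK ?num_real//.
  by rewrite lerXn2r ?nnegrE ?sqrtr_ge0.
rewrite mulrC; apply: le_trans (Esize i); rewrite /l2 le_eqVlt; apply/orP; left.
apply/eqP; congr Num.sqrt; rewrite -(whitening_gram Mwhite) mulmxA -mulmxA.
rewrite -[_ *m (row i E)^T]trmxK trmx_mul trmxK mxE; apply: eq_bigr => k _.
have e : (row i E *m M^T) 0 k = \sum_l row k M 0 l * E i l.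
  by rewrite mxE; apply: eq_bigr => l _; rewrite !mxE mulrC.
by rewrite [_^T k 0]mxE e expr2.
Qed.

Let rho2 : rho ^+ 2 <= p%:R * K.
Proof.
rewrite exprMn (sqr_sqrtr (ltW p0)) ler_pM2l//.
set r := Num.sqrt (2 * L).
have r2 : r ^+ 2 = 2 * L by rewrite sqr_sqrtr// mulr_ge0// ltW.
have := sqr_ge0 (r - ME); rewrite sqrrB sqrrD r2 /K sqrrD expr1n.
move: ME_ge0 L_gt0; move: (ME ^+ 2) (r * ME) L => q1 q2 q3; lra.
Qed.

Let M_unit : M^T \in unitmx.
Proof.
by have /mulmx1_unit[] : (M *m Sigma) *m M^T = 1%:M by [].
Qed.

Let tau := (3 / 4) ^+ 2 * m.

Let proj_small j : tau * vnorm2 ((1%:M - Zs j) *m col j Delta) ^+ 2 <=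
  vnorm2 (W^T *m col j Delta) ^+ 2.
Proof.
have [D DE] := orth_proj_compl_span (hZ j).
pose g : 'cV[R]_p := invmx M^T *m (col' j 1%:M *m (D *m col j Delta)).
apply: (@span_projection _ _ _ _ _ _ g) => //.
- by rewrite mulr_gt0// exprn_gt0.
- rewrite DE col'_mul -!mulmxA; congr (_ *m _).
  by rewrite /g mulKVmx.
have h := hnet O_neq0 g^T.
rewrite (_ : vnorm2 g ^+ 2 = \sum_k g^T 0 k ^+ 2); last first.
  by rewrite vnorm2_l2 l2_sqr; apply: eq_bigr => k _; rewrite [in RHS]mxE.
apply: le_trans h _; rewrite vnorm2_l2 l2_sqr [leRHS](bigID (fun i => i \in O))/=.
rewrite ler_wpDl//; first by apply: sumr_ge0 => i _; exact: sqr_ge0.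
rewrite le_eqVlt; apply/orP; left; apply/eqP; apply: eq_big => [i|i].
  by rewrite inE.
rewrite inE => iO; congr (_ ^+ 2); rewrite -mulmxA.
rewrite -[g in RHS]trmxK -trmx_mul [RHS]mxE; apply: eq_bigr => l _.
by rewrite [X i l]mxE EO// addr0 mulrC [_^T l 0]mxE.
Qed.

Let NQ : N ^+ 2 <= 2 * Q ^+ 2.
Proof.
have rho0 : 0 <= rho by rewrite mulr_ge0 ?addr_ge0 ?sqrtr_ge0.
have h1 : tau * D2 <= (rho * norm21 Delta) ^+ 2.
  apply: le_trans (frobenius_product Delta rho0 W_row).
  by rewrite /D2 mulr_sumr; apply: ler_sum => j _; exact: proj_small.
have h2 : (rho * norm21 Delta) ^+ 2 <= 100 / 9 * (o * p%:R * K) * N ^+ 2.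
  rewrite exprMn.
  apply: (@le_trans _ _ (p%:R * K * (10 / 3 * (Num.sqrt o * N)) ^+ 2)).
    rewrite ler_pM ?sqr_ge0// lerXn2r ?nnegrE//.
      by apply: sumr_ge0 => i _; exact: l2_ge0.
    by rewrite !mulr_ge0 ?sqrtr_ge0.
  rewrite !exprMn sqr_sqrtr; last exact: ltW.
  by rewrite le_eqVlt; apply/orP; left; apply/eqP; field.
have h3 : 100 / 9 * (o * p%:R * K) * N ^+ 2 <= 100 / 9 * (m / 40) * N ^+ 2.
  by rewrite ler_wpM2r ?sqr_ge0// ler_pM2l//; move: mK; lra.
have h4 : tau * D2 <= 5 / 18 * m * N ^+ 2.
  apply: le_trans h1 _; apply: le_trans h2 _; apply: le_trans h3 _.
  by rewrite le_eqVlt; apply/orP; left; apply/eqP; field.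
have h5 : D2 <= 1 / 2 * N ^+ 2.
  rewrite -(ler_pM2l (_ : 0 < tau)); last by rewrite mulr_gt0// exprn_gt0.
  apply: le_trans h4 _; rewrite /tau (_ : _ * (1 / 2 * _) = 9 / 32 * m * N ^+ 2); last by field.
  by rewrite ler_wpM2r ?sqr_ge0// ler_pM2r//; lra.
by move: NQD h5; lra.
Qed.

Let sigmax_ge j : sig j <= sigmax.
Proof. by rewrite /sigmax /max_inv_sqrt_diag (bigmax_sup j). Qed.

Let sigmax_gt0 : 0 < sigmax.
Proof. exact: lt_le_trans (sig_gt0 (Ordinal p_gt0)) (sigmax_ge _). Qed.

Let b_le j : b j <= 2 * sigmax.
Proof.
have h : vnorm2 (Zs j *m x j) <= 2 * Num.sqrt n%:R.
  apply: le_trans (vnorm2_proj_le (Zsym j) (Zid j) _) _.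
  apply: ler_sqr2; first by rewrite mulr_ge0 ?sqrtr_ge0.
  rewrite exprMn (sqr_sqrtr (ltW n0)); have /andP[_] := hnorm j.
  by rewrite expr2; lra.
rewrite bE; apply: (@le_trans _ _ (s * sig j * (2 * Num.sqrt n%:R))).
  by rewrite ler_pM2l// mulr_gt0.
rewrite (_ : _ * _ = 2 * sig j) ?ler_pM2l// /s; field.
by rewrite gt_eqF// sqrtr_gt0.
Qed.

Let lambda_SO : lambda * S_O <= 6 * (tt * N).
Proof.
have -> : tt = Num.sqrt (p%:R * L / n%:R) * Num.sqrt o.
  rewrite -sqrtrM ?divr_ge0 ?mulr_ge0 ?(ltW L_gt0)//.
  by congr Num.sqrt; ring.
rewrite /lambda -!mulrA ler_pM2l// ler_wpM2l ?sqrtr_ge0//.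
Qed.

Let N_le : N <= 300 * sigmax * tt.
Proof.
have tt0 : 0 <= tt by exact: sqrtr_ge0.
have tt2 : 520 * tt ^+ 2 <= 1.
  rewrite sqr_sqrtr; last by rewrite divr_ge0 ?mulr_ge0 ?(ltW L_gt0).
  rewrite mulrA ler_pdivrMr// mul1r; move: inlier_count_ge om o1; lra.
have cur := curvature_bound Zsym Zid ZX Bjj (ltW lambda_gt0) ThsO hopt bpos c0 (Vle k0 hk hc).
have bt : 0 < 2 * sigmax by rewrite mulr_gt0.
have := @error_arith _ N Q (2 * sigmax) tt N_ge0 (l2_ge0 _) bt tt0 tt2 NQ.
rewrite (_ : 150 * _ * _ = 300 * sigmax * tt); last by ring.
apply; apply: le_trans (@sum_curvature_ge _ _ z b _ bt _ _) _.
- by move=> j; exact: vnorm2_ge0.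
- by move=> j; rewrite bpos/=; exact: b_le.
apply: le_trans cur _; rewrite -/Delta -/S_O -/S_Oc.
have := lambda_SO; have : 0 <= lambda * S_Oc by rewrite mulr_ge0// ltW.
rewrite mulrBr !(mulrCA lambda); move: (lambda * S_O) (lambda * S_Oc) => u v.
by rewrite -mulrA; move: (tt * N) => y; lra.
Qed.

Lemma outlier_error : [/\
  norm11 Delta <= 3 * 400 * sigmax * o * p%:R * Num.sqrt (L / n%:R),
  norm21 Delta <= 3 * 400 * sigmax * o * Num.sqrt (p%:R * L / n%:R) &
  N <= 400 * sigmax * tt].
Proof.
have tt0 : 0 <= tt by exact: sqrtr_ge0.
have so : Num.sqrt o * tt = o * Num.sqrt (p%:R * L / n%:R).
  have -> : tt = Num.sqrt o * Num.sqrt (p%:R * L / n%:R).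
    by rewrite -sqrtrM; [congr Num.sqrt; ring|exact: ltW].
  by rewrite mulrA -expr2 (sqr_sqrtr (ltW o0)).
have h21 : norm21 Delta <= 3 * 400 * sigmax * o * Num.sqrt (p%:R * L / n%:R).
  apply: le_trans norm21_le _.
  rewrite (_ : 3 * 400 * sigmax * o * _ =
    1200 * (sigmax * (o * Num.sqrt (p%:R * L / n%:R)))); last by ring.
  rewrite -so.
  apply: (@le_trans _ _ (10 / 3 * (Num.sqrt o * (300 * sigmax * tt)))).
    by rewrite ler_pM2l ?ler_wpM2l ?sqrtr_ge0//; lra.
  rewrite (_ : 10 / 3 * _ = 1000 * (sigmax * (Num.sqrt o * tt))); last by field.
  by rewrite ler_wpM2r ?mulr_ge0 ?sqrtr_ge0 ?(ltW sigmax_gt0)// ler_nat.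
split => //.
  apply: le_trans norm11_le _.
  apply: (@le_trans _ _ (Num.sqrt p%:R * (3 * 400 * sigmax * o * Num.sqrt (p%:R * L / n%:R)))).
    by rewrite ler_wpM2l ?sqrtr_ge0.
  rewrite le_eqVlt; apply/orP; left; apply/eqP.
  rewrite -(mulrA p%:R) sqrtrM ?(ltW p0)//.
  rewrite (_ : Num.sqrt p%:R * _ = 3 * 400 * sigmax * o * (Num.sqrt p%:R ^+ 2) *
    Num.sqrt (L / n%:R)); last by ring.
  by rewrite sqr_sqrtr ?(ltW p0).
apply: le_trans N_le _; rewrite ler_wpM2r// ler_pM2r//; lra.
Qed.

End outliers.

End deterministic.

Theorem theorem1 (R : realType) :
  exists C0 : R, C0 < 4224 /\
  forall (n p : nat) (d : measure_display) (T : measurableType d)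
    (P : probability T R)
    (Y : T -> 'M[R]_(n, p)) (Sigma : 'M[R]_p) (E : 'M[R]_(n, p))
    (O : {set 'I_n}) (ME delta : R),
  (1 <= n)%N -> (1 <= p)%N ->
  (* (C1) *)
  (forall i j, measurable_fun setT (fun w => Y w i j)) ->
  symmetric_pd Sigma ->
  rows_independent P Y ->
  (forall i, row_gaussian P Y i Sigma) ->
  (* (C2) *)
  (forall i, i \notin O -> forall j, E i j = 0) ->
  (forall i, Num.sqrt ((row i E *m invmx Sigma *m (row i E)^T) 0 0)
             <= ME * Num.sqrt p%:R) ->
  0 < delta < 1 ->
  #|O|%:R + 8 * p%:R + 16 * ln (4 / delta) <= n%:R ->
  40 * #|O|%:R * p%:R * (13 * ln (2 * n%:R * p%:R / delta) + 2 * (1 + ME) ^+ 2)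
    <= n%:R - #|O|%:R ->
  let Omega := invmx Sigma in
  let Thstar := (Num.sqrt n%:R)^-1 *: (E *m Bstar Omega) in
  let lambda := 6 * Num.sqrt (p%:R * ln (2 * n%:R * p%:R / delta) / n%:R) in
  let L := ln (2 * n%:R * p%:R / delta) in
  exists Ev : set T, measurable Ev /\ ((1 - 3 * delta)%:E <= P Ev)%E /\
  forall w, Ev w ->
  let X := Y w + E in
  let Xn := (Num.sqrt n%:R)^-1 *: X in
  forall Zs : 'I_p -> 'M[R]_n,
  (forall j, orth_proj_compl (Zs j) (col' j X)) ->
  forall Thhat : 'M[R]_(n, p),
  (forall Th, robust_obj Zs Xn lambda Thhat <= robust_obj Zs Xn lambda Th) ->
  [/\ norm11 (Thhat - Thstar)
        <= 3 * C0 * max_inv_sqrt_diag Omega * #|O|%:R * p%:R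
             * Num.sqrt (L / n%:R),
      norm21 (Thhat - Thstar)
        <= 3 * C0 * max_inv_sqrt_diag Omega * #|O|%:R
             * Num.sqrt (p%:R * L / n%:R) &
      norm22 (Thhat - Thstar)
        <= C0 * max_inv_sqrt_diag Omega
             * Num.sqrt (#|O|%:R * p%:R * L / n%:R)].
Proof.
exists 400; split; first by rewrite ltr_nat.
move=> n p d T P Y Sigma E O ME delta n_gt0 p_gt0 mY Spd Yindep Ygauss EO Esize delta01 hn hbig.
move=> Omega Thstar lambda L.
have [M Mw] := whitening Spd.
have hn8 : 8 * p%:R + 16 * ln (4 / delta) <= n%:R.
  by apply: le_trans hn; rewrite -addrA lerDr.
have hO : O != finset.set0 -> 520 * p%:R * L <= #|~: O|%:R.
  move=> O_neq0; apply: le_trans (inlier_count_ge hbig).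
  have L0 : 0 <= L.
    rewrite ln_ge0//; case/andP: delta01 => d0 d1.
    rewrite ler_pdivlMr// mul1r; apply: le_trans (ltW d1) _.
    by rewrite -!natrM ler1n !muln_gt0/= n_gt0.
  rewrite -mulrA ler_pM2l ?ltr0n// ler_wpM2r// ler_peMl// ler1n card_gt0 //.
have [Ev [mEv PEv hEv]] :=
  good_event E n_gt0 p_gt0 mY Spd Yindep Ygauss Mw delta01 hn8 hO.
exists Ev; split => //; split => // w /hEv[hnum hrow hproj hnorm hnet] X Xn Zs hZ Thhat hopt.
have PE j := gsproj_orth_proj (hZ j).
have hnum' i j : `|(Zs j *m resid Y Sigma j w) i 0| <= Num.sqrt (2 * L).
  by have := hnum i j; rewrite -PE opprB addrCA subrr addr0.
have hproj' j : dotv ((1%:M - Zs j) *m resid Y Sigma j w) (resid Y Sigma j w) <=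
    4 * (ln (4 / delta) + ln p%:R + p%:R * (3 / 8)) by rewrite PE.
have [empO|nempO] := eqVneq O finset.set0; last first.
  exact: (outlier_error n_gt0 p_gt0 Spd Mw EO Esize delta01 hn hbig hZ hopt hnum' hrow hproj' hnorm hnet).
have -> : Thhat - Thstar = 0.
  exact: (no_outlier_exact n_gt0 p_gt0 Spd Mw EO delta01 hn hZ hopt hnum' hproj' hnorm empO).
rewrite empO cards0 !(mulr0, mul0r) sqrtr0 mulr0; split.
- by rewrite /norm11 big1// => i _; rewrite big1// => j _; rewrite mxE normr0.
- rewrite /norm21 big1// => i _.
  by rewrite big1 ?sqrtr0// => j _; rewrite mxE expr0n.
- rewrite /norm22 big1 ?sqrtr0// => i _.
  by rewrite big1// => j _; rewrite mxE expr0n.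
Qed.
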